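(* Let $\mathbb{F}$ be an algebraically closed field of characteristic different from $2$ and $\mathcal{C}$ the Cayley algebra over $\mathbb{F}$. Up to equivalence there are exactly six different fine gradings on $\mathcal{C}\otimes\mathcal{C}$, namely the following (with $\mathcal{S}:=(\mathcal{C}_0\otimes\mathbb{F}1)\oplus(\mathbb{F}1\otimes\mathcal{C}_0)$): 1. $\Gamma^1_{\mathcal{C}}\otimes\Gamma^1_{\mathcal{C}}$, with universal group $\mathbb{Z}^2\times\mathbb{Z}^2\simeq\mathbb{Z}^4$. 2. $\Gamma^1_{\mathcal{C}}\otimes\Gamma^2_{\mathcal{C}}$, with universal group $\mathbb{Z}^2\times(\mathbb{Z}/2)^3$. 3. $\Gamma^2_{\mathcal{C}}\otimes\Gamma^2_{\mathcal{C}}$, with universal group $(\mathbb{Z}/2)^3\times(\mathbb{Z}/2)^3\simeq(\mathbb{Z}/2)^6$. 4. The grading with universal group $\mathbb{Z}/2\times\mathbb{Z}^2$ generated by the following homogeneous components in $\mathcal{S}$: $\mathcal{S}_{(\bar0,0,0)}=\mathbb{F}((e_1-e_2)\otimes1+1\otimes(e_1-e_2))$, $\mathcal{S}_{(\bar1,0,0)}=\mathbb{F}((e_1-e_2)\otimes1-1\otimes(e_1-e_2))$, and $\mathcal{S}_{(\bar0,g)}=\{x\otimes1+1\otimes x: x\in\mathcal{C}_g\}$, $\mathcal{S}_{(\bar1,g)}=\{x\otimes1-1\otimes x: x\in\mathcal{C}_g\}$ for $g\in\mathbb{Z}^2\setminus\{(0,0)\}$, with $\mathcal{C}_g$ the components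 of $\Gamma^1_{\mathcal{C}}$. 5. The grading with universal group $(\mathbb{Z}/2)^4$ generated by the following homogeneous components in $\mathcal{S}$: $\mathcal{S}_{(\bar0,g)}=\{x\otimes1+1\otimes x:x\in\mathcal{C}_g\}$, $\mathcal{S}_{(\bar1,g)}=\{x\otimes1-1\otimes x:x\in\mathcal{C}_g\}$ for $g\in(\mathbb{Z}/2)^3\setminus\{(\bar0,\bar0,\bar0)\}$, with $\mathcal{C}_g$ the components of $\Gamma^2_{\mathcal{C}}$. 6. The grading with universal group $\mathbb{Z}/4\times(\mathbb{Z}/2)^2$ generated by the following homogeneous components in $\mathcal{S}$: $\mathcal{S}_{(\widehat m,\bar n,\bar p)}=\{x\otimes1+\mathbf{i}^m\,1\otimes x: x\in\mathcal{C}_{(\bar m,\bar n,\bar p)}\}$ for $(\widehat m,\bar n,\bar p)\in\mathbb{Z}/4\times(\mathbb{Z}/2)^2$ with $(\bar m,\bar n,\bar p)\neq(\bar0,\bar0,\bar0)$, with $\mathcal{C}_{(\bar m,\bar n,\bar p)}$ the components of $\Gamma^2_{\mathcal{C}}$; here $\widehat m$ is the class of $m$ modulo $4$, $\bar m$ the class modulo $2$, and $\mathbf{i}\in\mathbb{F}$ is a square root of $-1$.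
   Context: The Cayley algebra $\mathcal{C}$ (unique $8$-dimensional unital composition algebra over $\mathbb{F}$) has a canonical basis $\{e_1,e_2,u_1,u_2,u_3,v_1,v_2,v_3\}$ with (indices mod $3$) $e_1,e_2$ orthogonal idempotents, $e_1+e_2=1$, $e_1u_i=u_i=u_ie_2$, $e_2v_i=v_i=v_ie_1$, $u_iv_i=-e_1$, $v_iu_i=-e_2$, $u_iu_{i+1}=-u_{i+1}u_i=v_{i+2}$, $v_iv_{i+1}=-v_{i+1}v_i=u_{i+2}$, all other products of basis elements $0$. $\mathcal{C}_0=\mathrm{span}\{e_1-e_2,u_i,v_i\}$ is the space of skew elements for the standard involution. Cartan grading $\Gamma^1_{\mathcal{C}}$ by $\mathbb{Z}^2$: $\mathcal{C}_{(0,0)}=\mathbb{F}e_1\oplus\mathbb{F}e_2$, $\mathcal{C}_{(1,0)}=\mathbb{F}u_1$, $\mathcal{C}_{(-1,0)}=\mathbb{F}v_1$, $\mathcal{C}_{(0,1)}=\mathbb{F}u_2$, $\mathcal{C}_{(0,-1)}=\mathbb{F}v_2$, $\mathcal{C}_{(1,1)}=\mathbb{F}v_3$, $\mathcal{C}_{(-1,-1)}=\mathbb{F}u_3$. Grading $\Gamma^2_{\mathcal{C}}$ by $(\mathbb{Z}/2)^3$: with $u=e_1-e_2$, $v=u_1+v_1$, $w=u_2+v_2$, the basis elements $1,u,v,w,uv,uw,vw,(uv)w$ are homogeneous, with $\deg u=(\bar1,\bar0,\bar0)$, $\deg v=(\bar0,\bar1,\bar0)$, $\deg w=(\bar0,\bar0,\bar1)$.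 A $G$-grading ($G$ an abelian group) on an algebra $\mathcal{A}$ is a decomposition $\mathcal{A}=\bigoplus_{g\in G}\mathcal{A}_g$ with $\mathcal{A}_g\mathcal{A}_h\subseteq\mathcal{A}_{gh}$; its support is $\{g:\mathcal{A}_g\ne0\}$. For a $G$-grading $\Gamma^1$ on $\mathcal{A}$ and an $H$-grading $\Gamma^2$ on $\mathcal{B}$, $\Gamma^1\otimes\Gamma^2$ is the $G\times H$-grading on $\mathcal{A}\otimes\mathcal{B}$ with $(\mathcal{A}\otimes\mathcal{B})_{(g,h)}=\mathcal{A}_g\otimes\mathcal{B}_h$. A $G$-grading and an $H$-grading are equivalent if there is an algebra isomorphism mapping each nonzero component of the first onto a nonzero component of the second (inducing a bijection of supports). A grading is fine if it has no proper refinement, a refinement being a grading each of whose components is contained in a component of the given one (proper if some inclusion is strict). The universal group of a grading is the abelian group generated by its support subject to the relations $gh=k$ whenever $0\neq\mathcal{A}_g\mathcal{A}_h\subseteq\mathcal{A}_k$. The subspace $\mathcal{S}$ generates the algebra $\mathcal{C}\otimes\mathcal{C}$; ''the grading generated by'' given components of $\mathcal{S}$ means the unique grading on $\mathcal{C}\otimes\mathcal{C}$ in which the elements of these components are homogeneous of the indicated degrees. (All gradings and automorphisms of $\mathcal{C}\otimes\mathcal{C}$ preserve the tensor product of the standard involutions.) *)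

(* Defs.v *)
From HB Require Import structures.
From mathcomp Require Import all_boot all_order all_algebra.
From mathcomp Require Import boolp.
From mathcomp.multinomials Require Import freeg.

Set Implicit Arguments.
Unset Strict Implicit.
Unset Printing Implicit Defensive.

Import GRing.Theory.
Local Open Scope ring_scope.

(* A (not necessarily associative) algebra is a finite-dimensional vector     *)
(* space A together with a product m : {bilinear A -> A -> A}.  Grading       *)
(* groups are abelian and written additively.                                 *)

Section Gradings.
Variables (F : fieldType) (A : vectType F) (m : {bilinear A -> A -> A}).

(* The span of all the products m x y with x \in U and y \in W.               *)
Definition prod_space (U W : {vspace A}) : {vspace A} :=
  <<[seq m x y | x <- vbasis U, y <- vbasis W]>>%VS.

(* As A is finite-dimensional, only finitely many components of a direct sum  *)
(* decomposition are nonzero, even when G is infinite.                        *)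
Definition is_grading (G : zmodType) (Gamma : G -> {vspace A}) : Prop :=
  [/\ forall s : seq G, uniq s -> directv (\sum_(g <- s) Gamma g)%VS,
      exists s : seq G, (\sum_(g <- s) Gamma g)%VS = fullv
    & forall g h : G, (prod_space (Gamma g) (Gamma h) <= Gamma (g + h)%R)%VS].

Definition refines (G H : zmodType)
    (Delta : H -> {vspace A}) (Gamma : G -> {vspace A}) : Prop :=
  forall h, exists g, (Delta h <= Gamma g)%VS.

(* Only the inclusions of nonzero components are considered for properness.   *)
Definition refines_properly (G H : zmodType)
    (Delta : H -> {vspace A}) (Gamma : G -> {vspace A}) : Prop :=
  refines Delta Gamma /\
  exists h g, [/\ Delta h != 0%VS, (Delta h <= Gamma g)%VS
                & Delta h != Gamma g].

Definition is_fine_grading (G : zmodType) (Gamma : G -> {vspace A}) : Prop :=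
  is_grading Gamma /\
  forall (H : zmodType) (Delta : H -> {vspace A}),
    is_grading Delta -> ~ refines_properly Delta Gamma.

(* "The grading generated by" the components S_ g of the subspace S.          *)
Definition is_grading_generated_by (G : zmodType) (S : {vspace A})
    (S_ Gamma : G -> {vspace A}) : Prop :=
  [/\ is_grading Gamma,
      forall g, (S :&: Gamma g)%VS = S_ g
    & forall Delta : G -> {vspace A}, is_grading Delta ->
        (forall g, (S_ g <= Delta g)%VS) -> Delta =1 Gamma].

End Gradings.

Section Equivalence.
Variables (F : fieldType) (A B : vectType F).
Variables (mA : {bilinear A -> A -> A}) (mB : {bilinear B -> B -> B}).

Definition is_alg_isomorphism (f : 'Hom(A, B)) : Prop :=
  [/\ lker f = 0%VS, limg f = fullv
    & forall x y, f (mA x y) = mB (f x) (f y)].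

Definition equivalent_gradings (G H : zmodType)
    (Gamma : G -> {vspace A}) (Delta : H -> {vspace B}) : Prop :=
  exists (f : 'Hom(A, B)) (alpha : G -> H),
    [/\ is_alg_isomorphism f,
        forall g, Gamma g != 0%VS -> (f @: Gamma g)%VS = Delta (alpha g),
        {in [pred g | Gamma g != 0%VS] &, injective alpha}
      & forall h, Delta h != 0%VS <->
          exists2 g, Gamma g != 0%VS & alpha g = h].

End Equivalence.

Section GeneratedSubgroup.
Variables (M : zmodType) (R : M -> Prop).

Inductive in_generated_subgroup : M -> Prop :=
| in_gen_zero : in_generated_subgroup 0
| in_gen_mem x : R x -> in_generated_subgroup x
| in_gen_sub x y : in_generated_subgroup x -> in_generated_subgroup y ->
    in_generated_subgroup (x - y).

Definition generated_subgroup : {pred M} :=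
  fun x => `[< in_generated_subgroup x >].

Fact generated_subgroup_closed : zmod_closed generated_subgroup.
Proof.
split; first exact/asboolP/in_gen_zero.
by move=> x y /asboolP Rx /asboolP Ry; apply/asboolP/in_gen_sub.
Qed.

HB.instance Definition _ :=
  GRing.isZmodClosed.Build M generated_subgroup generated_subgroup_closed.

End GeneratedSubgroup.

Section UniversalGroup.
Variables (F : fieldType) (A : vectType F) (m : {bilinear A -> A -> A}).
Variables (G : zmodType) (Gamma : G -> {vspace A}).

Definition support_type := {g : G | Gamma g != 0%VS}.

Definition free_gen (g : support_type) : {freeg support_type / int} :=
  [freeg [:: (1, g)]].

Definition universal_relator (x : {freeg support_type / int}) : Prop :=
  exists g h k : support_type,
    [/\ prod_space m (Gamma (val g)) (Gamma (val h)) != 0%VS,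
        (prod_space m (Gamma (val g)) (Gamma (val h)) <= Gamma (val k))%VS
      & x = free_gen g + free_gen h - free_gen k].

Definition universal_group : zmodType :=
  Quotient.quot (generated_subgroup universal_relator).

Definition universal_degree (g : support_type) : universal_group :=
  (\pi_universal_group (free_gen g))%qT.

(* The grading group G itself is the universal group: the inclusion of the    *)
(* support in G extends to an isomorphism from the universal group onto G.    *)
Definition graded_by_universal_group : Prop :=
  exists phi : {additive universal_group -> G},
    bijective phi /\ forall g, phi (universal_degree g) = val g.

End UniversalGroup.

Definition isomorphic_groups (G H : zmodType) : Prop :=
  exists phi : {additive G -> H}, bijective phi.

Record graded_family (F : fieldType) (A : vectType F) := GradedFamily {
  degree_group : zmodType;
  component :> degree_group -> {vspace A}
}.

(* Algebras with a finite basis indexed by I, given by the products T a b of  *)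
(* their basis elements.                                                      *)
Section StructureConstants.
Variables (F : fieldType) (I : finType).

Definition free_space : vectType F := {ffun I -> F^o}.

Definition basis_vector (a : I) : free_space := [ffun b => (b == a)%:R].

Variable T : I -> I -> free_space.

Definition table_mul (x y : free_space) : free_space :=
  \sum_(a : I) \sum_(b : I) (x a * y b) *: T a b.

Fact table_mul_bilinear : bilinear_for *:%R *:%R table_mul.
Proof.
split=> [y | x] c /= z t; rewrite /table_mul /applyr scaler_sumr -big_split;
  apply: eq_bigr => a _; rewrite scaler_sumr -big_split;
  apply: eq_bigr => b _; rewrite /= !ffunE scalerA -scalerDl.
  by rewrite mulrDl mulrA.
by rewrite mulrDr mulrCA.
Qed.

HB.instance Definition _ := bilinear_isBilinear.Build F
  free_space free_space free_space _ _ table_mul table_mul_bilinear.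

End StructureConstants.

(* The tensor product of the spaces with bases I and J is the space with      *)
(* basis I * J, the pair (a, b) standing for a \otimes b.                     *)
Section TensorProduct.
Variables (F : fieldType) (I J : finType).

Definition tensor (x : free_space F I) (y : free_space F J) :
    free_space F (I * J)%type :=
  [ffun p => x p.1 * y p.2].

Definition tensor_table (TI : I -> I -> free_space F I)
    (TJ : J -> J -> free_space F J) (p q : I * J) :
    free_space F (I * J)%type :=
  tensor (TI p.1 q.1) (TJ p.2 q.2).

Definition tensor_space (U : {vspace free_space F I})
    (W : {vspace free_space F J}) : {vspace free_space F (I * J)%type} :=
  <<[seq tensor x y | x <- vbasis U, y <- vbasis W]>>%VS.

Definition tensor_grading (G H : zmodType)
    (Gamma : G -> {vspace free_space F I})
    (Delta : H -> {vspace free_space F J}) (d : G * H) :=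
  tensor_space (Gamma d.1) (Delta d.2).

End TensorProduct.

Variant cayley_index := E1 | E2 | U of 'Z_3 | V of 'Z_3.

Definition cayley_index_code (a : cayley_index) : bool + ('Z_3 + 'Z_3) :=
  match a with
  | E1 => inl true | E2 => inl false | U i => inr (inl i) | V i => inr (inr i)
  end.

Definition cayley_index_decode (c : bool + ('Z_3 + 'Z_3)) : cayley_index :=
  match c with
  | inl true => E1 | inl false => E2 | inr (inl i) => U i | inr (inr i) => V i
  end.

Fact cayley_index_codeK : cancel cayley_index_code cayley_index_decode.
Proof. by case. Qed.

HB.instance Definition _ :=
  Finite.copy cayley_index (can_type cayley_index_codeK).

Section Cayley.
Variable F : fieldType.

Definition cayley : vectType F := free_space F cayley_index.

Definition e1 : cayley := basis_vector F E1.
Definition e2 : cayley := basis_vector F E2.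
Definition u_ (i : 'Z_3) : cayley := basis_vector F (U i).
Definition v_ (i : 'Z_3) : cayley := basis_vector F (V i).

Definition cayley_table (a b : cayley_index) : cayley :=
  match a, b with
  | E1, E1 => e1
  | E2, E2 => e2
  | E1, U i | U i, E2 => u_ i
  | E2, V i | V i, E1 => v_ i
  | U i, V j => if i == j then - e1 else 0
  | V i, U j => if i == j then - e2 else 0
  | U i, U j => if j == i + 1 then v_ (i + 2)
                else if i == j + 1 then - v_ (j + 2) else 0
  | V i, V j => if j == i + 1 then u_ (i + 2)
                else if i == j + 1 then - u_ (j + 2) else 0
  | _, _ => 0
  end.

Definition cayley_mul : {bilinear cayley -> cayley -> cayley} :=
  table_mul cayley_table.

Definition cayley_one : cayley := e1 + e2.

Definition cayley_skew : {vspace cayley} :=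
  <<[:: e1 - e2; u_ 1; u_ 2; u_ 3; v_ 1; v_ 2; v_ 3]>>%VS.

Definition cartan_grading (g : int * int) : {vspace cayley} :=
  if g == (0, 0) then <<[:: e1; e2]>>%VS
  else if g == (1, 0) then <[u_ 1]>%VS
  else if g == (-1, 0) then <[v_ 1]>%VS
  else if g == (0, 1) then <[u_ 2]>%VS
  else if g == (0, -1) then <[v_ 2]>%VS
  else if g == (1, 1) then <[v_ 3]>%VS
  else if g == (-1, -1) then <[u_ 3]>%VS
  else 0%VS.

Definition z2cube_grading (g : 'Z_2 * 'Z_2 * 'Z_2) : {vspace cayley} :=
  let u := e1 - e2 in
  let v := u_ 1 + v_ 1 in
  let w := u_ 2 + v_ 2 in
  let pow x (k : 'Z_2) := if k == 0 then cayley_one else x in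
  let: (a, b, c) := g in
  <[cayley_mul (cayley_mul (pow u a) (pow v b)) (pow w c)]>%VS.

Definition cayley2 : vectType F :=
  free_space F (cayley_index * cayley_index)%type.

Definition cayley2_mul : {bilinear cayley2 -> cayley2 -> cayley2} :=
  table_mul (tensor_table cayley_table cayley_table).

Definition skew_sum : {vspace cayley2} :=
  (tensor_space cayley_skew <[cayley_one]> +
   tensor_space <[cayley_one]> cayley_skew)%VS.

(* The subspace of the x \otimes 1 + c (1 \otimes x) with x \in W.            *)
Definition twisted_diag (c : F) (W : {vspace cayley}) : {vspace cayley2} :=
  <<[seq (tensor x cayley_one + c *: tensor cayley_one x)%R
      | x <- vbasis W]>>%VS.

Definition components4 (d : 'Z_2 * (int * int)) : {vspace cayley2} :=
  let: (k, g) := d in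
  twisted_diag ((-1) ^+ k)
    (if g == (0, 0) then <[e1 - e2]>%VS else cartan_grading g).

Definition components5 (d : 'Z_2 * ('Z_2 * 'Z_2 * 'Z_2)) : {vspace cayley2} :=
  let: (k, g) := d in
  if g == (0, 0, 0) then 0%VS else twisted_diag ((-1) ^+ k) (z2cube_grading g).

(* i is a square root of -1, and k%:R is the reduction of k modulo 2.         *)
Definition components6 (i : F) (d : 'Z_4 * 'Z_2 * 'Z_2) : {vspace cayley2} :=
  let: (k, n, p) := d in
  let g : 'Z_2 * 'Z_2 * 'Z_2 := ((k : nat)%:R, n, p) in
  if g == (0, 0, 0) then 0%VS else twisted_diag (i ^+ k) (z2cube_grading g).

End Cayley.

(* Main.v *)
(* Write A = C (x) C.  The subspace S = C_0 (x) 1 + 1 (x) C_0 generates A and   *)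
(* is graded by any grading of A: the elements z with (z,a,b) = (a,b,z) for all *)
(* a, b form C (x) 1 + 1 (x) C, and S is spanned by the commutators of such     *)
(* elements.  So a grading is determined by its restriction to S.  The          *)
(* homogeneous components of the projection of S onto C_0 (x) 1 are again       *)
(* combinations of the two projections; hence either both factors are graded    *)
(* or, for some h of order two, x (x) 1 + 1 (x) y |-> x (x) 1 - 1 (x) y shifts  *)
(* degrees by h.                                                                *)
(*   In the first case, a grading of C coarsens the Cartan grading (if there is *)
(* a skew element of degree zero) or the (Z/2)^3-grading (otherwise, by         *)
(* choosing a homogeneous Cayley-Dickson triple); this gives 1, 2 and 3.        *)
(*   In the second case, modulo h the first factor is graded, and the           *)
(* component of degree g of S is the graph of a linear map between subspaces of *)
(* C_0; suitably rescaled, these maps glue to an automorphism of C because they *)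
(* preserve brackets.  Lifting the degrees through G -> G/h yields 4 (Cartan),  *)
(* 5 (all lifts of order two) or 6 (some lift of order four).                   *)
(*   Each of the six gradings is rigid: the degrees of any refinement are given *)
(* by a homomorphism from its group.  Rigidity implies that the grading is fine *)
(* and universal, and that equivalent ones have isomorphic groups.              *)

From HB Require Import structures.
Require Import Defs.
From mathcomp Require Import all_boot all_order all_algebra.
From mathcomp Require Import boolp ring zify.
From mathcomp.multinomials Require Import freeg.

Set Implicit Arguments.
Unset Strict Implicit.
Unset Printing Implicit Defensive.

Import GRing.Theory.
Local Open Scope ring_scope.


(** * Gradings and projections *)

(** The product alone determines [S]. In an alternative algebra the associator is cyclically
    invariant, so the elements of C (x) 1 + 1 (x) C satisfy [cyclic_assoc]; as the nucleus of C is
    the line of the unit, no other elements do ([cyclic_assocP]). This condition passes to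
    homogeneous components, hence so does membership in [S], the span of the commutators of such
    elements ([S_proj]). Since [S] generates the algebra, inclusions between components need only be
    tested on [S] ([S_generates]).

    The projection [eps1] of [S] onto its first copy of C_0 commutes with brackets. Its homogeneous
    components do so too, hence act by one scalar on each copy ([eps_comp_scalar]). A component of
    degree [g] with two distinct scalars is a root of a quadratic polynomial whose terms have
    different degrees, unless [g = 0], or [2g = 0] and the scalars are opposite. This is the
    dichotomy [split_or_twisted].

    In the split case both factors are graded. A skew element of degree zero, once normalised, is an
    involution [a]; eigenvectors of left multiplication by [a] provide homogeneous images of the
    canonical basis ([cartan_type]). Without such an element all degrees have order at most two, and
    a Cayley-Dickson triple can be chosen homogeneous ([cube_type]). All triples have the same
    multiplication table, so they come from automorphisms ([triple_automorphism]).

    In the twisted case, dividing the group by [h] gives back a split grading. The components of [S]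
    are then graphs of maps between subspaces of C_0; divided by a character, these maps glue to an
    automorphism, because the bracket determines the product ([bracket_automorphism],
    [second_auto]). It remains to lift degrees through the quotient by [h] ([cartan_case],
    [cube_case]). In every case a model is mapped into the given grading component by component, and
    fineness makes this an equivalence ([fine_equivalent]).

    Conversely, gradings 4, 5 and 6 are built from eigenspaces of an automorphism, [twist_swap]. In
    a refinement of any of the six, the lines of [S] stay homogeneous ([line_homogeneous]) and
    brackets force their degrees to be additive: the grading is [rigid]. Hence it is fine and
    universal ([rigid_fine], [rigid_universal]), and an equivalence between two of the six would
    give isomorphic groups ([equivalent_rigid_iso]), which [grading_group_inj] excludes. *)

Lemma sum_pred1_seq (V : nmodType) (I : eqType) (r : seq I) (i : I) (E : I -> V) :
  uniq r -> i \in r -> \sum_(j <- r | j == i) E j = E i.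
Proof. by move=> ur ir; rewrite -big_filter filter_pred1_uniq // big_seq1. Qed.

Lemma subv_sum_seqP (F : fieldType) (A : vectType F) (G : eqType) (s : seq G)
    (P : pred G) (Gamma : G -> {vspace A}) (W : {vspace A}) :
  (forall g, g \in s -> P g -> (Gamma g <= W)%VS) ->
  (\sum_(g <- s | P g) Gamma g <= W)%VS.
Proof.
move=> H; rewrite big_seq_cond; elim/big_ind: _ => [|U V hU hV|g /andP[]].
- exact: sub0v.
- by rewrite subv_add hU hV.
- exact: H.
Qed.

(** Serves both [prod_space] and [tensor_space]: bilinearity removes the dependence on the bases
    chosen by [vbasis]. *)
Lemma span_bilinear_subP (F : fieldType) (A B C : vectType F)
    (f : {bilinear A -> B -> C}) (U : {vspace A}) (W : {vspace B})
    (X : {vspace C}) :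
  reflect (forall x y, x \in U -> y \in W -> f x y \in X)
          (<<[seq f x y | x <- vbasis U, y <- vbasis W]>> <= X)%VS.
Proof.
apply: (iffP span_subvP) => [H x y xU yW | H _ /allpairsP[[x y] /= [xU yW ->]]].
  rewrite (coord_vbasis xU) (coord_vbasis yW) linear_sumlz /=.
  apply: memv_suml => i _; rewrite linearZl_LR linear_sumr memvZ //.
  apply: memv_suml => j _; rewrite linearZr_LR memvZ //=; apply: H.
  by apply/allpairsP; exists ((vbasis U)`_i, (vbasis W)`_j);
    rewrite !mem_nth ?size_tuple.
by apply: H; apply: vbasis_mem.
Qed.

Section Decomposition.
Variables (F : fieldType) (A : vectType F) (G : zmodType).
Implicit Types (Gamma : G -> {vspace A}) (p : G -> 'End(A)) (s : seq G).

(* The nonzero components of [Gamma] have indices in [s]. *)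
Definition projections Gamma s p : Prop :=
  [/\ uniq s, forall g x, p g x \in Gamma g,
      forall x, \sum_(g <- s) p g x = x
    & forall g h x, x \in Gamma h -> p g x = if g == h then x else 0].

Lemma directv_seqP Gamma s : uniq s ->
  directv (\sum_(g <- s) Gamma g)%VS <->
  (forall x : G -> A, (forall g, x g \in Gamma g) ->
     \sum_(g <- s) x g = 0 -> forall g, g \in s -> x g = 0).
Proof.
move=> s_uniq; rewrite directvE /= (big_nth 0) big_mkord [X in _ == X](big_nth 0).
rewrite [X in _ == X]big_mkord.
have -> : (\dim (\sum_(i < size s) Gamma (nth 0%R s i))%VS
           == \sum_(i < size s) \dim (Gamma (nth 0%R s i)))%N
        = directv (\sum_(i < size s) Gamma (nth 0%R s i))%VS by rewrite directvE.
split=> [/directv_sum_independent H x xG x0 g gs | H].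
  have := H (fun i : 'I_(size s) => x (nth 0%R s i)) (fun i _ => xG _).
  rewrite -(big_mkord xpredT (fun i => x (nth 0%R s i))) -(big_nth 0 xpredT x).
  have ltgs : (index g s < size s)%N by rewrite index_mem.
  by move=> /(_ x0 (Ordinal ltgs) isT) /=; rewrite nth_index.
apply/directv_sum_independent => u uG u0 i _.
pose x g := if insub (index g s) is Some j then u j else 0.
have xE (j : 'I_(size s)) : x (nth 0%R s j) = u j.
  rewrite /x index_uniq //; case: insubP => [k _ /val_inj -> //|].
  by rewrite ltn_ord.
rewrite -xE; apply: H; last by rewrite mem_nth.
- move=> g; rewrite /x; case: insubP => [j _ jE|_]; last exact: mem0v.
  have gs : g \in s by rewrite -index_mem -jE; exact: ltn_ord.
  by have := uG j isT; rewrite [nat_of_ord j]jE nth_index.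
- rewrite (big_nth 0) big_mkord -[RHS]u0; apply: eq_bigr => j _; exact: xE.
Qed.

Lemma projectionsP Gamma :
  (exists s p, projections Gamma s p) <->
  (forall s, uniq s -> directv (\sum_(g <- s) Gamma g)%VS) /\
  (exists s, (\sum_(g <- s) Gamma g)%VS = fullv).
Proof.
split=> [[s [p [us pG ps pE]]]|[H [s0 s0f]]].
  split=> [t ut|]; last first.
    exists s; apply/eqP; rewrite eqEsubv subvf /=; apply/subvP => x _.
    by rewrite -(ps x) big_seq; apply: rpred_sum => g gs;
      rewrite (bigD1_seq g) //= (subvP (addvSl _ _)).
  apply/directv_seqP => // x xG x0 g gt.
  have : p g (\sum_(h <- t) x h) = 0 by rewrite x0 linear0.
  rewrite linear_sum /= (bigD1_seq g) //= (pE _ _ _ (xG g)) eqxx big1 ?addr0 //.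
  by move=> h hg; rewrite (pE _ _ _ (xG h)) eq_sym (negPf hg).
pose s := undup s0.
have us : uniq s by exact: undup_uniq.
have sf : fullv = (\sum_(g <- s) Gamma g)%VS.
  apply/eqP; rewrite eqEsubv subvf andbT -s0f; apply: subv_sum_seqP => g gs0 _.
  by rewrite (bigD1_seq g) /= ?mem_undup // addvSl.
pose p g : 'End(A) := if g \in s then sumv_pi_for sf g else 0.
have pG g x : p g x \in Gamma g.
  by rewrite /p; case: ifP => _; [exact: memv_sum_pi|rewrite lfunE mem0v].
have ps x : \sum_(g <- s) p g x = x.
  rewrite big_seq -[RHS](sumv_pi_uniq_sum sf (v := x)) ?memvf ?filter_predT //.
  by rewrite [RHS]big_seq; apply: eq_bigr => g gs; rewrite /p gs.
exists s, p; split=> // g h x xh.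
pose t := undup (g :: h :: s).
have ut : uniq t by exact: undup_uniq.
(* The difference of two decompositions of [x]: the one concentrated at [h] and the one given by
   [p]. It sums to zero over [t], so directness kills it at [g]. *)
pose y k := (if k == h then x else 0) - p k x.
have yG k : y k \in Gamma k.
  by rewrite /y memvB ?pG //; case: eqP => [->//|_]; rewrite mem0v.
have gt : g \in t by rewrite mem_undup !inE eqxx.
have ht : h \in t by rewrite mem_undup !inE eqxx orbT.
have st : {subset s <= t} by move=> k ks; rewrite mem_undup !inE ks !orbT.
have := (directv_seqP Gamma ut).1 (H t ut) y yG _ g gt.
rewrite /y => /(_ _) /subr0_eq -> //; rewrite sumrB -big_mkcond /=.
rewrite sum_pred1_seq // [X in _ - X](_ : _ = x) ?subrr //.
rewrite -[RHS]ps (bigID (mem s)) /= addrC big1 ?add0r; last first.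
  by move=> k /negPf ks; rewrite /p ks lfunE.
rewrite -big_filter; apply: perm_big; apply: uniq_perm => //.
  exact: filter_uniq.
by move=> k; rewrite mem_filter; case ks: (k \in s) => //=; rewrite (st k).
Qed.

Section WithProjections.
Variables (Gamma : G -> {vspace A}) (s : seq G) (p : G -> 'End(A)).
Hypothesis pP : projections Gamma s p.

Lemma proj_mem g x : p g x \in Gamma g. Proof. by case: pP. Qed.

Lemma proj_sum x : \sum_(g <- s) p g x = x. Proof. by case: pP. Qed.

Lemma proj_id g x : x \in Gamma g -> p g x = x.
Proof. by case: pP => _ _ _ H /H ->; rewrite eqxx. Qed.

Lemma proj_neq g h x : x \in Gamma h -> g != h -> p g x = 0.
Proof. by case: pP => _ _ _ H /H -> /negPf ->. Qed.

Lemma proj_supp g : g \notin s -> Gamma g = 0%VS.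
Proof.
move=> gs; apply/eqP; rewrite -subv0; apply/subvP => x xg.
rewrite memv0 -(proj_sum x) big1_seq // => h /= hs.
by apply: (proj_neq xg); apply: contraNneq gs => <-.
Qed.

Lemma proj_out g x : g \notin s -> p g x = 0.
Proof. by move=> /proj_supp g0; have := proj_mem g x; rewrite g0 memv0 => /eqP. Qed.

Lemma homogeneous_ind (P : A -> Prop) :
  (forall x y, P x -> P y -> P (x + y)) -> P 0 ->
  (forall g x, x \in Gamma g -> P x) -> forall x, P x.
Proof.
move=> PD P0 PG x; rewrite -(proj_sum x); elim/big_ind: _ => // g _.
exact: PG (proj_mem g x).
Qed.

Lemma homogeneous_degree_uniq g h x :
  x != 0 -> x \in Gamma g -> x \in Gamma h -> g = h.
Proof.
move=> x0 xg xh; apply: contraNeq x0 => gh.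
by rewrite -(proj_id xg) (proj_neq xh gh).
Qed.

Lemma proj_family (y : G -> A) (t : seq G) g :
    uniq t -> (forall h, h \in t -> y h \in Gamma h) ->
  p g (\sum_(h <- t) y h) = if g \in t then y g else 0.
Proof.
move=> ut yG; rewrite linear_sum /=; case: ifP => gt.
  rewrite (bigD1_seq g) //= (proj_id (yG g gt)) big_seq_cond big1 ?addr0 //.
  by move=> h /andP[/yG hG hg]; rewrite (proj_neq hG) // eq_sym.
rewrite big_seq big1 // => h ht; apply: (proj_neq (yG h ht)).
by apply: contraFneq gt => ->.
Qed.

End WithProjections.
End Decomposition.

Section Gradings.
Variables (F : fieldType) (A : vectType F) (m : {bilinear A -> A -> A}).

Lemma prod_space_subP (U W X : {vspace A}) :
  reflect (forall x y, x \in U -> y \in W -> m x y \in X)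
          (prod_space m U W <= X)%VS.
Proof. exact: span_bilinear_subP. Qed.

Lemma mem_prod_space (U W : {vspace A}) x y :
  x \in U -> y \in W -> m x y \in prod_space m U W.
Proof. by apply: prod_space_subP. Qed.

Lemma prod_space_neq0 (U W : {vspace A}) :
  prod_space m U W != 0%VS ->
  exists x y, [/\ x \in U, y \in W & m x y != 0].
Proof.
apply: contraNP => H; rewrite -subv0; apply/prod_space_subP => x y xU yW.
by rewrite memv0; apply: contra_notT H => xy; exists x, y.
Qed.

Definition graded_mul (G : zmodType) (Gamma : G -> {vspace A}) : Prop :=
  forall g h x y, x \in Gamma g -> y \in Gamma h -> m x y \in Gamma (g + h).

Lemma is_gradingP (G : zmodType) (Gamma : G -> {vspace A}) :
  is_grading m Gamma <->
  (exists s p, projections Gamma s p) /\ graded_mul Gamma.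
Proof.
rewrite projectionsP; split=> [[H1 H2 H3]|[[H1 H2] H3]].
  by split=> // g h x y xg yh; apply: (prod_space_subP _ _ _ (H3 g h)).
by split=> // g h; apply/prod_space_subP => x y; apply: H3.
Qed.

Lemma grading_mul (G : zmodType) (Gamma : G -> {vspace A}) :
  is_grading m Gamma -> graded_mul Gamma.
Proof. by case/is_gradingP. Qed.

Lemma proj_mul (G : zmodType) (Gamma : G -> {vspace A}) s p :
  projections Gamma s p -> graded_mul Gamma ->
  forall g x y, p g (m x y) = \sum_(a <- s) m (p a x) (p (g - a) y).
Proof.
move=> pP mG g x y.
rewrite -[in LHS](proj_sum pP x) linear_sumlz linear_sum /=; apply: eq_bigr => a _.
rewrite -[in LHS](proj_sum pP y) linear_sumr linear_sum /=.
have E b : p g (m (p a x) (p b y)) = if b == g - a then m (p a x) (p b y) else 0.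
  have H := mG _ _ _ _ (proj_mem pP a x) (proj_mem pP b y).
  case: eqP => [->|/eqP nb].
    by rewrite (proj_id pP) //; move: (mG _ _ _ _ (proj_mem pP a x)
      (proj_mem pP (g - a) y)); rewrite [a + _]addrC subrK.
  by apply: (proj_neq pP H); rewrite addrC -subr_eq eq_sym.
under eq_bigr => b _ do rewrite E.
case gs: (g - a \in s).
  by rewrite -big_mkcond sum_pred1_seq //; case: pP.
rewrite (proj_out pP y (negbT gs)) linear0r -big_mkcond big1_seq // => b /andP[/eqP ->].
by rewrite gs.
Qed.

(** The decomposition of an element along [Gamma] is also its decomposition along [Delta], so the
    projections coincide. *)
Lemma grading_eq (G : zmodType) (Gamma Delta : G -> {vspace A}) :
    is_grading m Gamma -> is_grading m Delta ->
    (forall g, (Gamma g <= Delta g)%VS) -> Delta =1 Gamma.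
Proof.
move=> /is_gradingP[[s [p pP]] _] /is_gradingP[[t [q qP]] _] GD g.
apply/eqP; rewrite eqEsubv GD andbT; apply/subvP => x xg.
have E : q g x = p g x.
  rewrite -{1}(proj_sum pP x) (proj_family qP); last 2 first.
  - by case: pP.
  - by move=> h _; apply: (subvP (GD h)); apply: (proj_mem pP).
  by case: ifP => // gs; rewrite (proj_out pP) // gs.
by rewrite -(proj_id qP xg) E (proj_mem pP).
Qed.

(* Meaningful only if [s] contains the support of [Gamma]. *)
Definition coarsening (G H : zmodType) (s : seq G) (a : G -> H)
    (Gamma : G -> {vspace A}) (h : H) : {vspace A} :=
  (\sum_(g <- s | a g == h) Gamma g)%VS.

Section Coarsening.
Variables (G H : zmodType) (Gamma : G -> {vspace A}) (s : seq G).
Variables (p : G -> 'End(A)) (a : G -> H).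
Hypotheses (pP : projections Gamma s p) (mG : graded_mul Gamma).

Definition coarse_proj h : 'End(A) := \sum_(g <- s | a g == h) p g.

Lemma coarse_projE h x : coarse_proj h x = \sum_(g <- s | a g == h) p g x.
Proof. by rewrite sum_lfunE. Qed.

Lemma mem_coarsening g x : x \in Gamma g -> x \in coarsening s a Gamma (a g).
Proof.
move=> xg; have [gs|gs] := boolP (g \in s).
  rewrite /coarsening (big_rem g) //= eqxx.
  exact: (subvP (addvSl _ _)).
by move: xg; rewrite (proj_supp pP gs) memv0 => /eqP ->; rewrite mem0v.
Qed.

Lemma coarse_proj_hom g h x :
  x \in Gamma g -> coarse_proj h x = if h == a g then x else 0.
Proof.
move=> xg; rewrite coarse_projE; case: eqP => [->|/eqP hg].
  rewrite -[RHS](proj_sum pP x) [RHS](bigID (fun k => a k == a g)) /=.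
  rewrite [X in _ = _ + X]big1 ?addr0 // => k kg; apply: (proj_neq pP xg).
  by apply: contraNneq kg => ->.
apply: big1 => k /eqP kh; apply: (proj_neq pP xg).
by apply: contraNneq hg => <-; rewrite -kh.
Qed.

Lemma coarsening_projections :
  projections (coarsening s a Gamma) (undup (map a s)) coarse_proj.
Proof.
split=> [|h x|x|h h' x xh'].
- exact: undup_uniq.
- rewrite coarse_projE big_seq_cond; apply: rpred_sum => g /andP[gs /eqP <-].
  exact/mem_coarsening/(proj_mem pP).
- under eq_bigr => h _ do rewrite coarse_projE.
  rewrite (exchange_big_dep xpredT) //= -[RHS](proj_sum pP x).
  rewrite big_seq [RHS]big_seq; apply: eq_bigr => g gs.
  under eq_bigl => h do rewrite eq_sym.
  by rewrite sum_pred1_seq ?undup_uniq // mem_undup map_f.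
- have /subvP/(_ _ xh') : (coarsening s a Gamma h'
      <= lker (coarse_proj h - if h == h' then \1%VF else 0%R))%VS.
    apply: subv_sum_seqP => g _ /eqP gh'; apply/subvP => y yg.
    apply/eqlfunP; rewrite (coarse_proj_hom _ yg) gh'.
    by case: ifP; rewrite ?id_lfunE ?lfunE.
  by move/eqlfunP => ->; case: ifP; rewrite ?id_lfunE ?lfunE.
Qed.

(** Additivity of [a] is asked only at nonzero products: the relabelling by universal degrees in
    [rigid_universal] is not known to be additive elsewhere. *)
Lemma coarsening_multiplicative :
  (forall g h x y, x \in Gamma g -> y \in Gamma h -> m x y != 0 ->
     a (g + h) = a g + a h) ->
  graded_mul (coarsening s a Gamma).
Proof.
move=> aD h h' x y xh yh'.
rewrite -(proj_id coarsening_projections xh) coarse_projE linear_sumlz /=.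
apply: rpred_sum => g /eqP <-.
rewrite -(proj_id coarsening_projections yh') coarse_projE linear_sumr /=.
apply: rpred_sum => g' /eqP <-.
have [->|xy] := eqVneq (m (p g x) (p g' y)) 0; first exact: mem0v.
rewrite -(aD _ _ _ _ (proj_mem pP g x) (proj_mem pP g' y) xy).
by apply: mem_coarsening; apply: mG; apply: (proj_mem pP).
Qed.

Lemma mem_coarseningP h x :
  reflect (forall g, a g != h -> p g x = 0) (x \in coarsening s a Gamma h).
Proof.
apply: (iffP idP) => [xh g gh | H0].
  rewrite -(proj_id coarsening_projections xh) coarse_projE linear_sum /=.
  apply: big1 => k /eqP kh; apply: (proj_neq pP (proj_mem pP k x)).
  by apply: contraNneq gh => ->; rewrite kh.
rewrite -(proj_sum pP x); apply: rpred_sum => g _.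
have [<-|/H0 ->] := eqVneq (a g) h; last exact: mem0v.
exact/mem_coarsening/(proj_mem pP).
Qed.

End Coarsening.

End Gradings.

Section Isomorphisms.
Variables (F : fieldType) (A : vectType F) (m : {bilinear A -> A -> A}).

Lemma iso_inv (f : 'End(A)) :
  is_alg_isomorphism m m f ->
  [/\ cancel f f^-1%VF, cancel f^-1%VF f & is_alg_isomorphism m m (f^-1)%VF].
Proof.
case=> f0 fT fM; have fK : cancel f f^-1%VF by apply: lker0_lfunK; rewrite f0.
have fVK : cancel f^-1%VF f by move=> x; rewrite limg_lfunVK // fT memvf.
split=> //; split.
- by apply/eqP/lker0P; apply: can_inj fVK.
- apply/eqP; rewrite eqEsubv subvf; apply/subvP => x _; apply/memv_imgP.
  by exists (f x); rewrite ?memvf ?fK.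
- by move=> x y; apply: (can_inj fK); rewrite fM !fVK.
Qed.

Lemma iso_comp (f g : 'End(A)) :
  is_alg_isomorphism m m f -> is_alg_isomorphism m m g ->
  is_alg_isomorphism m m (f \o g)%VF.
Proof.
move=> /[dup] /iso_inv[fK fVK _] [_ _ fM] /[dup] /iso_inv[gK gVK _] [_ _ gM].
split.
- by apply/eqP/lker0P => x y; rewrite !comp_lfunE => /(can_inj fK)/(can_inj gK).
- apply/eqP; rewrite eqEsubv subvf; apply/subvP => x _; apply/memv_imgP.
  exists ((g^-1 \o f^-1)%VF x); first exact: memvf.
  by rewrite !comp_lfunE gVK fVK.
- by move=> x y; rewrite !comp_lfunE gM fM.
Qed.

Lemma iso_of_injective (f : 'End(A)) :
  (forall x, f x = 0 -> x = 0) -> (forall x y, f (m x y) = m (f x) (f y)) ->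
  is_alg_isomorphism m m f.
Proof.
move=> finj fM; have f0 : lker f = 0%VS.
  by apply/eqP; rewrite -subv0; apply/subvP => x; rewrite memv_ker memv0 => /eqP/finj ->.
split=> //; apply/eqP; rewrite eqEdim subvf /=.
by rewrite -(limg_dim_eq (f := f) (U := fullv)) // f0 capv0.
Qed.

Lemma iso_grading (G : zmodType) (Gamma : G -> {vspace A}) (f : 'End(A)) :
  is_alg_isomorphism m m f -> is_grading m Gamma ->
  is_grading m (fun g => f @: Gamma g)%VS.
Proof.
move=> /[dup] /iso_inv[fK fVK _] [_ _ fM] /is_gradingP[[s [p [us pG ps pE]]] mG].
apply/is_gradingP; split.
  exists s, (fun g => f \o p g \o f^-1)%VF; split=> //.
  - by move=> g x; rewrite !comp_lfunE memv_img.
  - move=> x; under eq_bigr => g _ do rewrite !comp_lfunE.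
    by rewrite -linear_sum /= ps fVK.
  - move=> g h _ /memv_imgP[x xh ->]; rewrite !comp_lfunE fK (pE _ _ _ xh).
    by case: ifP; rewrite ?linear0.
move=> g h _ _ /memv_imgP[x xg ->] /memv_imgP[y yh ->].
by rewrite -fM memv_img // mG.
Qed.

End Isomorphisms.


(** * Rigid gradings *)

Section QuotientMap.
Variables (R : zmodType) (I : zmodClosed R).

Definition quotient_map (x : R) : Quotient.quot I := (\pi_(Quotient.quot I) x)%qT.

Lemma quotient_map_zmod_morphism : zmod_morphism quotient_map.
Proof. by move=> x y; rewrite /quotient_map !piE. Qed.

HB.instance Definition _ :=
  GRing.isZmodMorphism.Build R (Quotient.quot I) quotient_map
    quotient_map_zmod_morphism.

Lemma quotient_map_eq x y : quotient_map x = quotient_map y <-> x - y \in I.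
Proof.
by rewrite (Quotient.idealrBE I x y); split => [/eqP|/eqP].
Qed.

Lemma quotient_map_surj (u : Quotient.quot I) : exists x, quotient_map x = u.
Proof. by exists (repr u); rewrite /quotient_map reprK. Qed.

End QuotientMap.

Lemma freeg_additive_ext (K : choiceType) (M : zmodType)
    (f g : {additive {freeg K / int} -> M}) :
  (forall x : K, f [freeg [:: (1, x)]] = g [freeg [:: (1, x)]]) -> f =1 g.
Proof.
move=> fg D; rewrite -(freeg_sumE D) !raddf_sum; apply: eq_bigr => z _.
by rewrite -[coeff z D]intz -freegU_mulz !raddfMz fg.
Qed.

Section Rigidity.
Variables (F : fieldType) (A : vectType F) (m : {bilinear A -> A -> A}).
Variables (G : zmodType) (Gamma : G -> {vspace A}).

(* The universal property of the grading group [G], with respect to all the *)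
(* gradings refining [Gamma].                                               *)
Definition rigid : Prop :=
  forall (H : zmodType) (Delta : H -> {vspace A}),
    is_grading m Delta -> refines Delta Gamma ->
    exists psi : {additive G -> H}, forall g, (Gamma g <= Delta (psi g))%VS.

(** A consequence of generation by the support (see [support_spans_generates]), in the form that
    identifies a composite endomorphism of [G] with the identity. *)
Definition support_generates : Prop :=
  forall psi : {additive G -> G},
    (forall g, Gamma g != 0%VS -> psi g = g) -> psi =1 id.

Hypotheses (GammaP : is_grading m Gamma) (Gamma_rigid : rigid).

(** A nonzero [Delta h] lies in some [Gamma g], itself inside [Delta (psi g)]. Uniqueness of degrees
    gives [h = psi g], so both inclusions are equalities. *)
Lemma rigid_fine : is_fine_grading m Gamma.
Proof.
split=> // H Delta DeltaP [DG [h [g [h0 hg hNg]]]].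
have [psi psiP] := Gamma_rigid DeltaP DG.
have [[s [p pP]] _] := (is_gradingP m Delta).1 DeltaP.
case/negP: hNg; rewrite eqEsubv hg /=.
suff -> : h = psi g by [].
apply: (homogeneous_degree_uniq pP (x := vpick (Delta h))); rewrite ?vpick0 //.
  exact: memv_pick.
by apply: (subvP (psiP g)); apply: (subvP hg); apply: memv_pick.
Qed.

Hypothesis Gamma_gen : support_generates.

Local Notation univ := (universal_group m Gamma).
Local Notation relators :=
  (generated_subgroup (universal_relator m (Gamma := Gamma))).

Definition degree_lift : {freeg (support_type Gamma) / int} -> G :=
  fglift (fun g : support_type Gamma => (val g : zmodule G)).

Lemma degree_lift_zmod_morphism : zmod_morphism degree_lift.
Proof. exact: (lift_is_additive (M := zmodule G)). Qed.

HB.instance Definition _ :=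
  GRing.isZmodMorphism.Build {freeg (support_type Gamma) / int} G degree_lift
    degree_lift_zmod_morphism.

Lemma degree_lift_gen g : degree_lift (free_gen g) = val g.
Proof. by rewrite /degree_lift /free_gen liftU scale1r. Qed.

Lemma degree_lift_relator x : x \in relators -> degree_lift x = 0.
Proof.
move=> /asboolP; elim=> [|y [g [h [k [gh0 ghk ->]]]]|y z _ yE _ zE].
- by rewrite raddf0.
- rewrite raddfB raddfD /= !degree_lift_gen.
  have [[s [p pP]] mG] := (is_gradingP m Gamma).1 GammaP.
  suff -> : val k = val g + val h by rewrite subrr.
  have [x1 [x2 [x1g x2h x12]]] := prod_space_neq0 gh0.
  apply: (homogeneous_degree_uniq pP x12); last exact: mG.
  by apply: (subvP ghk); apply: mem_prod_space.
- by rewrite raddfB /= yE zE subrr.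
Qed.

Definition degree_map (u : univ) : G := degree_lift (repr u).

Lemma degree_map_pi x : degree_map (quotient_map relators x) = degree_lift x.
Proof.
apply/eqP; rewrite -subr_eq0 -raddfB; apply/eqP/degree_lift_relator.
by apply/quotient_map_eq; rewrite /quotient_map reprK.
Qed.

Lemma degree_map_zmod_morphism : zmod_morphism degree_map.
Proof.
move=> u v; have [x <-] := quotient_map_surj u; have [y <-] := quotient_map_surj v.
by rewrite -raddfB !degree_map_pi raddfB.
Qed.

HB.instance Definition _ :=
  GRing.isZmodMorphism.Build univ G degree_map degree_map_zmod_morphism.

(** Relabelling the components of [Gamma] by their universal degrees gives a grading that refines
    [Gamma]. Rigidity then yields a homomorphism from [G] to the universal group, which is inverse
    to [degree_map]. *)
Lemma rigid_universal : graded_by_universal_group m Gamma.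
Proof.
have degE g : degree_map (universal_degree m g) = val g.
  by rewrite [LHS](degree_map_pi (free_gen g)) degree_lift_gen.
exists degree_map; split=> //.
have [[s [p pP]] mG] := (is_gradingP m Gamma).1 GammaP.
(* The default value does no harm, since components outside the support are zero. *)
pose a (g : G) : univ := if insub g is Some d then universal_degree m d else 0.
have aE (d : support_type Gamma) : a (val d) = universal_degree m d.
  by rewrite /a valK.
have aD g h x y : x \in Gamma g -> y \in Gamma h -> m x y != 0 ->
    a (g + h) = a g + a h.
  move=> xg yh xy.
  have supp k z : z \in Gamma k -> z != 0 -> Gamma k != 0%VS.
    by move=> zk; apply: contraNneq => k0; rewrite k0 memv0 in zk.
  have xy0 : m x y \in Gamma (g + h) by apply: mG.
  have x0 : x != 0 by apply: contraNneq xy => ->; rewrite linear0l.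
  have y0 : y != 0 by apply: contraNneq xy => ->; rewrite linear0r.
  pose dg : support_type Gamma := exist _ g (supp g x xg x0).
  pose dh : support_type Gamma := exist _ h (supp h y yh y0).
  pose dk : support_type Gamma := exist _ (g + h) (supp (g + h) _ xy0 xy).
  apply/esym; rewrite (aE dg) (aE dh) (aE dk) /universal_degree.
  rewrite -[LHS](raddfD (quotient_map relators)) /=.
  apply/quotient_map_eq/asboolP/in_gen_mem; exists dg, dh, dk; split=> //.
    apply/eqP => E; case/negP: (xy); rewrite -memv0 -E; exact: mem_prod_space.
  by apply/prod_space_subP => x' y' x'g y'h; apply: mG.
pose Delta := coarsening s a Gamma.
have DeltaP : is_grading m Delta.
  apply/is_gradingP; split; last exact: (coarsening_multiplicative pP mG aD).
  by exists (undup (map a s)), (coarse_proj s p a); exact: (coarsening_projections a pP).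
have [psi psiP] : exists psi : {additive G -> univ},
    forall g, (Gamma g <= Delta (psi g))%VS.
  apply: Gamma_rigid => // u.
  have [[d <-]|noD] := pselect (exists d : support_type Gamma,
      universal_degree m d = u).
    exists (val d); apply: subv_sum_seqP => g _ /eqP ga.
    have [->|g0] := eqVneq (Gamma g) 0%VS; first exact: sub0v.
    move: ga; rewrite -[g]/(val (exist _ g g0 : support_type Gamma)) aE => ga.
    by rewrite -degE ga degE.
  (* Here [u] is the degree of no component, so [Delta u] is zero and any index will do. *)
  exists 0; apply: subv_sum_seqP => g _ /eqP ga.
  have [->|g0] := eqVneq (Gamma g) 0%VS; first exact: sub0v.
  case: noD; exists (exist _ g g0 : support_type Gamma).
  by rewrite -aE.
have psiE (d : support_type Gamma) : psi (val d) = universal_degree m d.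
  have v0 : vpick (Gamma (val d)) != 0 by rewrite vpick0 (valP d).
  apply: (homogeneous_degree_uniq (coarsening_projections a pP) v0).
    by apply: (subvP (psiP _)); apply: memv_pick.
  by rewrite -aE; apply: (mem_coarsening a pP); apply: memv_pick.
exists psi.
- move=> u; have [x <-] := quotient_map_surj u; rewrite [X in psi X]degree_map_pi.
  apply: (freeg_additive_ext (f := psi \o degree_lift)
    (g := quotient_map relators)) => d /=.
  by rewrite [degree_lift _](degree_lift_gen d) psiE.
- apply: (Gamma_gen (psi := degree_map \o psi)) => g g0 /=.
  by rewrite (psiE (exist _ g g0)) degE.
Qed.

End Rigidity.

Section Equivalence.
Variables (F : fieldType) (A : vectType F) (m : {bilinear A -> A -> A}).
Variables (G K : zmodType) (Gamma : G -> {vspace A}) (Lambda : K -> {vspace A}).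
Hypotheses (GammaP : is_grading m Gamma) (LambdaP : is_grading m Lambda).

Lemma iso_limg_eq0 (f : 'End(A)) (U : {vspace A}) :
  is_alg_isomorphism m m f -> ((f @: U)%VS == 0%VS) = (U == 0%VS).
Proof. by case=> f0 _ _; rewrite -{1}(limg0 f) eq_limg_ker0 ?f0. Qed.

(** The image of [Lambda] refines [Gamma], so fineness turns the inclusions of nonzero components
    into equalities; as the images span, every nonzero component of [Gamma] is reached. The
    classification thus only has to produce an isomorphism and inclusions. *)
Lemma fine_equivalent (f : 'End(A)) (a : K -> G) :
  is_fine_grading m Gamma -> is_alg_isomorphism m m f ->
  (forall d, (f @: Lambda d <= Gamma (a d))%VS) ->
  equivalent_gradings m m Gamma Lambda.
Proof.
move=> [_ fine] fP fa.
have [fK fVK fVP] := iso_inv fP.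
have [[s [p pP]] _] := (is_gradingP m Gamma).1 GammaP.
have [[t [q qP]] _] := (is_gradingP m Lambda).1 LambdaP.
have fLP := iso_grading fP LambdaP.
have E1 d : Lambda d != 0%VS -> (f @: Lambda d)%VS = Gamma (a d).
  move=> d0; apply/eqP; apply: contraT => neq.
  case: (fine K (fun d => f @: Lambda d)%VS fLP); split.
    by move=> d'; exists (a d').
  by exists d, (a d); split; rewrite ?iso_limg_eq0.
have E2 g : Gamma g != 0%VS -> exists2 d, Lambda d != 0%VS & a d = g.
  move=> g0; apply: contrapT => noD; case/negP: g0; rewrite -subv0.
  apply/subvP => x xg; rewrite memv0 -(proj_id pP xg).
  rewrite -[x]fVK -[(f^-1)%VF x](proj_sum qP) !linear_sum /=.
  rewrite big1 // => d _.
  have [d0|d0] := eqVneq (Lambda d) 0%VS.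
    by have := proj_mem qP d ((f^-1)%VF x);
       rewrite d0 memv0 => /eqP ->; rewrite !linear0.
  apply: (proj_neq pP (h := a d)).
    by apply: (subvP (fa d)); rewrite memv_img // (proj_mem qP).
  by apply: contra_notN noD => /eqP ->; exists d.
have [b bP] : exists b : G -> K,
    forall g, Gamma g != 0%VS -> Lambda (b g) != 0%VS /\ a (b g) = g.
  suff /choice[b bP] : forall g, exists d, Gamma g != 0%VS ->
      Lambda d != 0%VS /\ a d = g by exists b.
  move=> g; have [_|g0] := eqVneq (Gamma g) 0%VS; first by exists 0.
  by have [d d0 dg] := E2 g g0; exists d.
exists (f^-1)%VF, b; split=> //.
- move=> g g0; have [b0 {1}<-] := bP g g0; rewrite -E1 //.
  apply/vspaceP => x; apply/memv_imgP/idP.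
    by case=> _ /memv_imgP[y yb ->] ->; rewrite fK.
  by move=> xb; exists (f x); rewrite ?fK // memv_img.
- by move=> g h /bP[_ gb] /bP[_ hb] bgh; rewrite -gb -hb bgh.
- move=> d; split=> [d0|[g /bP[b0 _] <-] //].
  have ad0 : Gamma (a d) != 0%VS by rewrite -E1 // iso_limg_eq0.
  exists (a d) => //; have [b0 ab] := bP _ ad0.
  have v0 : vpick (Lambda d) != 0 by rewrite vpick0.
  apply: (homogeneous_degree_uniq qP v0 _ (memv_pick _)).
  have [f0 _ _] := fP.
  suff -> : Lambda (b (a d)) = Lambda d by exact: memv_pick.
  by apply/eqP; rewrite -(eq_limg_ker0 (f := f)) ?f0 // !E1 // ab.
Qed.

(** Each grading, transported by the equivalence, refines the other, so rigidity gives homomorphisms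
    both ways. Their composites fix the supports, hence are identities. *)
Lemma equivalent_rigid_iso : rigid m Gamma -> rigid m Lambda ->
  support_generates Gamma -> support_generates Lambda ->
  equivalent_gradings m m Gamma Lambda -> isomorphic_groups G K.
Proof.
move=> Gr Lr Gg Lg [f [a [fP fE aI aS]]].
have [fK fVK fVP] := iso_inv fP.
have [[s [p pP]] _] := (is_gradingP m Gamma).1 GammaP.
have [[t [q qP]] _] := (is_gradingP m Lambda).1 LambdaP.
have [psi psiP] : exists psi : {additive K -> G},
    forall k, (Lambda k <= f @: Gamma (psi k))%VS.
  apply: (Lr G (fun g => f @: Gamma g)%VS); first exact: iso_grading.
  move=> g; have [->|g0] := eqVneq (Gamma g) 0%VS.
    by exists 0; rewrite limg0 sub0v.
  by exists (a g); rewrite fE.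
have [phi phiP] : exists phi : {additive G -> K},
    forall g, (Gamma g <= f^-1 @: Lambda (phi g))%VS.
  apply: (Gr K (fun k => f^-1 @: Lambda k)%VS); first exact: iso_grading.
  move=> k; have [->|k0] := eqVneq (Lambda k) 0%VS.
    by exists 0; rewrite limg0 sub0v.
  have [g g0 <-] := (aS k).1 k0; exists g; rewrite -fE //.
  by apply/subvP => _ /memv_imgP[_ /memv_imgP[x xg ->] ->]; rewrite fK.
exists phi, psi.
- apply: (Gg (psi \o phi)) => g g0 /=.
  have v0 : vpick (Gamma g) != 0 by rewrite vpick0.
  apply: (homogeneous_degree_uniq pP v0 _ (memv_pick _)).
  have /memv_imgP[y yk ->] := subvP (phiP g) _ (memv_pick _).
  have /memv_imgP[x xg ->] := subvP (psiP _) _ yk; rewrite fK.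
  exact: xg.
- apply: (Lg (phi \o psi)) => k k0 /=.
  have v0 : vpick (Lambda k) != 0 by rewrite vpick0.
  apply: (homogeneous_degree_uniq qP v0 _ (memv_pick _)).
  have /memv_imgP[y yk ->] := subvP (psiP k) _ (memv_pick _).
  have /memv_imgP[x xg ->] := subvP (phiP _) _ yk; rewrite fVK.
  exact: xg.
Qed.

End Equivalence.


(** * Coordinates, norm and trace of the Cayley algebra *)

Lemma Z3_ind (P : 'Z_3 -> Prop) : P 0 -> P 1 -> P 2 -> forall i, P i.
Proof.
move=> P0 P1 P2 [[|[|[|//]]] Hi].
- by rewrite (_ : Ordinal Hi = 0) //; apply: val_inj.
- by rewrite (_ : Ordinal Hi = 1) //; apply: val_inj.
- by rewrite (_ : Ordinal Hi = 2) //; apply: val_inj.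
Qed.

Lemma cayley_index_ind' (P : cayley_index -> Prop) :
  P E1 -> P E2 -> P (U 0) -> P (U 1) -> P (U 2) -> P (V 0) -> P (V 1) ->
  P (V 2) -> forall a, P a.
Proof. by move=> ????????; case=> //; apply: Z3_ind. Qed.

Lemma sum_cayley (W : nmodType) (E : cayley_index -> W) :
  \sum_a E a = E E1 + E E2 + E (U 0) + E (U 1) + E (U 2) + E (V 0) + E (V 1)
               + E (V 2).
Proof.
rewrite (reindex cayley_index_decode) /=; last first.
  by exists cayley_index_code; [case; case|case].
rewrite big_sumType /= big_bool /= big_sumType /= !big_ord_recl !big_ord0.
rewrite !addr0 -!addrA /=; do !congr (_ + _); congr E; congr (_ _);
  exact: val_inj.
Qed.

(* An alias of the product that simplification does not unfold. *)
Definition cmul (F : fieldType) (x y : cayley F) : cayley F := cayley_mul F x y.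
Arguments cmul F x y : simpl never.

Notation "x ** y" := (cmul x y) (at level 40, left associativity).

(** The polar form of [cnorm], with no factor one half: [cbil x x = 2 * cnorm x]. It is locked, like
    [cnorm] and [ctr], to stay folded under simplification. *)
HB.lock Definition cbil (F : fieldType) (x y : cayley F) : F :=
  (x E1 : F) * y E2 + x E2 * y E1 + x (U 0) * y (V 0) + x (V 0) * y (U 0)
  + x (U 1) * y (V 1) + x (V 1) * y (U 1) + x (U 2) * y (V 2) + x (V 2) * y (U 2).
Canonical cbil_unlockable := Unlockable cbil.unlock.

HB.lock Definition cnorm (F : fieldType) (x : cayley F) : F :=
  (x E1 : F) * x E2 + x (U 0) * x (V 0) + x (U 1) * x (V 1) + x (U 2) * x (V 2).
Canonical cnorm_unlockable := Unlockable cnorm.unlock.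

HB.lock Definition ctr (F : fieldType) (x : cayley F) : F := (x E1 : F) + x E2.
Canonical ctr_unlockable := Unlockable ctr.unlock.

Section CayleyAlgebra.
Variable F : fieldType.
Local Notation C := (cayley F).
Implicit Types x y z : C.

Lemma cayleyP x y : x E1 = y E1 :> F -> x E2 = y E2 :> F ->
  x (U 0) = y (U 0) :> F -> x (U 1) = y (U 1) :> F -> x (U 2) = y (U 2) :> F ->
  x (V 0) = y (V 0) :> F -> x (V 1) = y (V 1) :> F -> x (V 2) = y (V 2) :> F ->
  x = y.
Proof. by move=> ????????; apply/ffunP; apply: cayley_index_ind'. Qed.


Definition cayley_coef (a b c : cayley_index) : F :=
  match a, b, c with
  | E1, E1, E1 | E2, E2, E2 => 1
  | E1, U i, U k | U i, E2, U k | E2, V i, V k | V i, E1, V k => (k == i)%:R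
  | U i, V j, E1 | V i, U j, E2 => - (i == j)%:R
  | U i, U j, V k | V i, V j, U k =>
      if j == i + 1 then (k == i + 2)%:R
      else if i == j + 1 then - (k == j + 2)%:R else 0
  | _, _, _ => 0
  end.

Lemma cayley_tableE a b c : cayley_table F a b c = cayley_coef a b c.
Proof.
case: a => [||i|i]; case: b => [||j|j]; case: c => [||k|k] /=;
  by do ?case: ifP => _; rewrite !ffunE //= ?ffunE ?oppr0.
Qed.

Lemma mulc_coord x y c :
  (x ** y) c = \sum_a \sum_b (x a : F) * (y b : F) * cayley_coef a b c.
Proof.
rewrite /cmul /cayley_mul /= /table_mul sum_ffunE; apply: eq_bigr => a _.
by rewrite sum_ffunE; apply: eq_bigr => b _; rewrite ffunE cayley_tableE.
Qed.

(** Zorn's vector matrices: dot products of the [U] and [V] parts enter the two diagonal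
    coordinates, and cross products of one part land in the other. Identities in C thereby become
    goals for [ring]. *)
Lemma mulcE x y :
  ((x ** y) E1 = (x E1 : F) * y E1 - x (U 0) * y (V 0) - x (U 1) * y (V 1)
                 - x (U 2) * y (V 2) :> F) *
  ((x ** y) E2 = (x E2 : F) * y E2 - x (V 0) * y (U 0) - x (V 1) * y (U 1)
                 - x (V 2) * y (U 2) :> F) *
  ((x ** y) (U 0) = (x E1 : F) * y (U 0) + x (U 0) * y E2
                 + x (V 1) * y (V 2) - x (V 2) * y (V 1) :> F) *
  ((x ** y) (U 1) = (x E1 : F) * y (U 1) + x (U 1) * y E2
                 + x (V 2) * y (V 0) - x (V 0) * y (V 2) :> F) *
  ((x ** y) (U 2) = (x E1 : F) * y (U 2) + x (U 2) * y E2
                 + x (V 0) * y (V 1) - x (V 1) * y (V 0) :> F) *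
  ((x ** y) (V 0) = (x E2 : F) * y (V 0) + x (V 0) * y E1
                 + x (U 1) * y (U 2) - x (U 2) * y (U 1) :> F) *
  ((x ** y) (V 1) = (x E2 : F) * y (V 1) + x (V 1) * y E1
                 + x (U 2) * y (U 0) - x (U 0) * y (U 2) :> F) *
  ((x ** y) (V 2) = (x E2 : F) * y (V 2) + x (V 2) * y E1
                 + x (U 0) * y (U 1) - x (U 1) * y (U 0) :> F).
Proof.
do !split; rewrite mulc_coord sum_cayley !(sum_cayley (fun b => _ * _)) /=; ring.
Qed.

Lemma addcE x y c : (x + y) c = (x c : F) + y c :> F.
Proof. by rewrite ffunE. Qed.
Lemma oppcE x c : (- x) c = - (x c : F) :> F.
Proof. by rewrite ffunE. Qed.
Lemma scalecE (k : F) x c : (k *: x) c = k * x c :> F.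
Proof. by rewrite ffunE. Qed.
Lemma zerocE c : (0 : C) c = 0 :> F.
Proof. by rewrite ffunE. Qed.

Local Notation "1c" := (cayley_one F).

Lemma onecE :
  (1c E1 = 1 :> F) * (1c E2 = 1 :> F) * (forall i, 1c (U i) = 0 :> F) *
  (forall i, 1c (V i) = 0 :> F).
Proof.
by do !split=> *; rewrite !ffunE /= ?addr0 ?add0r.
Qed.

Definition cbar x : C :=
  [ffun c => match c with
             | E1 => x E2 | E2 => x E1 | U i => - x (U i) | V i => - x (V i)
             end].

Lemma cbilE x y : cbil x y =
  (x E1 : F) * y E2 + x E2 * y E1 + x (U 0) * y (V 0) + x (V 0) * y (U 0)
  + x (U 1) * y (V 1) + x (V 1) * y (U 1) + x (U 2) * y (V 2) + x (V 2) * y (U 2).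
Proof. by rewrite unlock. Qed.

Lemma cnormE x : cnorm x =
  (x E1 : F) * x E2 + x (U 0) * x (V 0) + x (U 1) * x (V 1) + x (U 2) * x (V 2).
Proof. by rewrite unlock. Qed.

Lemma ctrE x : ctr x = (x E1 : F) + x E2.
Proof. by rewrite unlock. Qed.

Definition skewc x : Prop := ctr x = 0.

Lemma cbarE x :
  (cbar x E1 = x E2 :> F) * (cbar x E2 = x E1 :> F) *
  (forall i, cbar x (U i) = - x (U i) :> F) *
  (forall i, cbar x (V i) = - x (V i) :> F).
Proof.
by do !split=> *; rewrite ffunE.
Qed.

Definition cE := (mulcE, addcE, oppcE, scalecE, zerocE, onecE, cbarE).

End CayleyAlgebra.

Ltac cring :=
  rewrite ?cbilE ?cnormE ?ctrE; try apply: cayleyP; rewrite ?cE ?cbilE ?cnormE ?ctrE ?cE;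
  ring.


Section CayleyIdentities.
Variable F : fieldType.
Local Notation C := (cayley F).
Local Notation "1c" := (cayley_one F).
Implicit Types x y z : C.

Lemma mulcDl x y z : (x + y) ** z = x ** z + y ** z.
Proof. exact: (linearDl (cayley_mul F)). Qed.
Lemma mulcDr x y z : z ** (x + y) = z ** x + z ** y.
Proof. exact: (linearDr (cayley_mul F)). Qed.
Lemma mulcNl x z : (- x) ** z = - (x ** z).
Proof. exact: (linearNl (cayley_mul F)). Qed.
Lemma mulcNr x z : z ** (- x) = - (z ** x).
Proof. exact: (linearNr (cayley_mul F)). Qed.
Lemma mulcBl x y z : (x - y) ** z = x ** z - y ** z.
Proof. exact: (linearBl (cayley_mul F)). Qed.
Lemma mulcBr x y z : z ** (x - y) = z ** x - z ** y.
Proof. exact: (linearBr (cayley_mul F)). Qed.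
Lemma mulcZl (k : F) x z : (k *: x) ** z = k *: (x ** z).
Proof. exact: (linearZl_LR (cayley_mul F)). Qed.
Lemma mulcZr (k : F) x z : z ** (k *: x) = k *: (z ** x).
Proof. exact: (linearZr_LR (cayley_mul F)). Qed.
Lemma mulc0l z : 0 ** z = 0 :> C.
Proof. exact: (linear0l (cayley_mul F)). Qed.
Lemma mulc0r z : z ** 0 = 0 :> C.
Proof. exact: (linear0r (cayley_mul F)). Qed.

Lemma mul1c x : 1c ** x = x. Proof. cring. Qed.
Lemma mulc1 x : x ** 1c = x. Proof. cring. Qed.
Lemma cbar_def x : cbar x = ctr x *: 1c - x. Proof. cring. Qed.
Lemma csqr x : x ** x = ctr x *: x - cnorm x *: 1c. Proof. cring. Qed.
Lemma cbil1 x : cbil x 1c = ctr x. Proof. cring. Qed.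
Lemma cbilC x y : cbil x y = cbil y x. Proof. cring. Qed.
Lemma cbilxx x : cbil x x = 2 * cnorm x. Proof. cring. Qed.
Lemma cbilDl x y z : cbil (x + y) z = cbil x z + cbil y z. Proof. cring. Qed.
Lemma cbilZl (k : F) x y : cbil (k *: x) y = k * cbil x y. Proof. cring. Qed.
Lemma cnormD x y : cnorm (x + y) = cnorm x + cnorm y + cbil x y. Proof. cring. Qed.
Lemma cnormZ (k : F) x : cnorm (k *: x) = k ^+ 2 * cnorm x. Proof. cring. Qed.
Lemma cnormM x y : cnorm (x ** y) = cnorm x * cnorm y.
Proof. cring. Qed.
Lemma cbarM x y : cbar (x ** y) = cbar y ** cbar x.
Proof. cring. Qed.
Lemma cbil_mul x y : x ** cbar y + y ** cbar x = cbil x y *: 1c.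
Proof. cring. Qed.
Lemma ctrM x y : ctr (x ** y) = cbil x (cbar y).
Proof. cring. Qed.
Lemma ctrC x y : ctr (x ** y) = ctr (y ** x).
Proof. cring. Qed.
Lemma cbarK x : cbar (cbar x) = x.
Proof. cring. Qed.

Lemma cbarD x y : cbar (x + y) = cbar x + cbar y. Proof. cring. Qed.
Lemma cbil_bar x y : cbil (cbar x) (cbar y) = cbil x y. Proof. cring. Qed.
Lemma calt x y : cbar x ** (x ** y) = cnorm x *: y. Proof. cring. Qed.
Lemma cnorm_bar x : cnorm (cbar x) = cnorm x. Proof. cring. Qed.
Lemma cbarZ (k : F) x : cbar (k *: x) = k *: cbar x. Proof. cring. Qed.

Lemma caltr x y : (y ** x) ** cbar x = cnorm x *: y.
Proof. by apply: (can_inj cbarK); rewrite !cbarM calt cbarZ cnorm_bar. Qed.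

(** The linearisation of [calt]; the Cayley-Dickson doubling rules are instances of it and of its
    mirror image [cbarr]. *)
Lemma cbarl x y z : cbar x ** (y ** z) + cbar y ** (x ** z) = cbil x y *: z.
Proof.
have := calt (x + y) z; rewrite cbarD !mulcDl !mulcDr. rewrite !calt.
rewrite cnormD !scalerDl => H; apply: (addrI (cnorm x *: z + cnorm y *: z)).
by rewrite -H addrACA [X in _ + X = _]addrC.
Qed.

Lemma cbarr x y z : (z ** x) ** cbar y + (z ** y) ** cbar x = cbil x y *: z.
Proof.
by apply: (can_inj cbarK); rewrite cbarD !cbarM cbarl cbarZ cbil_bar cbilC.
Qed.

Lemma cbilMl x y z : cbil (x ** y) z = cbil y (cbar x ** z).
Proof. cring. Qed.

Lemma skew_bar x : skewc x -> cbar x = - x.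
Proof. by rewrite /skewc cbar_def => ->; rewrite scale0r sub0r. Qed.

End CayleyIdentities.


(** * Linear extension, Cayley-Dickson triples and their multiplication table *)

Lemma Z2_ind (P : 'Z_2 -> Prop) : P 0 -> P 1 -> forall i, P i.
Proof.
move=> P0 P1 [[|[|//]] Hi].
- by rewrite (_ : Ordinal Hi = 0) //; apply: val_inj.
- by rewrite (_ : Ordinal Hi = 1) //; apply: val_inj.
Qed.

Section LinearExtension.
Variables (F : fieldType) (I : finType) (W : vectType F) (Y : I -> W).

Definition lin_ext_fun (x : free_space F I) : W := \sum_i (x i : F) *: Y i.

Lemma lin_ext_fun_linear : linear lin_ext_fun.
Proof.
move=> k x y; rewrite /lin_ext_fun scaler_sumr -big_split; apply: eq_bigr => i _.
by rewrite /= !ffunE scalerA -scalerDl.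
Qed.

HB.instance Definition _ :=
  GRing.isLinear.Build F (free_space F I) W _ lin_ext_fun lin_ext_fun_linear.

Definition lin_ext : 'Hom(free_space F I, W) := linfun lin_ext_fun.

Lemma lin_extE x : lin_ext x = \sum_i (x i : F) *: Y i.
Proof. by rewrite lfunE. Qed.

Lemma lin_ext_basis i : lin_ext (basis_vector F i) = Y i.
Proof.
rewrite lin_extE (bigD1 i) //= ffunE eqxx scale1r big1 ?addr0 // => j ji.
by rewrite ffunE (negPf ji) scale0r.
Qed.

End LinearExtension.

Lemma free_space_sum (F : fieldType) (I : finType) (x : free_space F I) :
  x = \sum_i (x i : F) *: basis_vector F i.
Proof.
apply/ffunP => j; rewrite sum_ffunE (bigD1 j) //= !ffunE eqxx big1 ?addr0.
  by rewrite /GRing.scale /= mulr1.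
by move=> i ij; rewrite !ffunE eq_sym (negPf ij) /GRing.scale /= mulr0.
Qed.

Lemma free_space_ind (F : fieldType) (I : finType) (P : free_space F I -> Prop) :
  (forall (k : F) x y, P x -> P y -> P (k *: x + y)) -> P 0 ->
  (forall i, P (basis_vector F i)) -> forall x, P x.
Proof.
move=> PL P0 PB x; rewrite (free_space_sum x).
by elim/big_ind: _ => // [y z Py Pz|i _]; [rewrite -[y]scale1r|rewrite -[_ *: _]addr0];
  apply: PL.
Qed.

Lemma table_mul_basis (F : fieldType) (I : finType) (T : I -> I -> free_space F I) c d :
  table_mul T (basis_vector F c) (basis_vector F d) = T c d.
Proof.
rewrite /table_mul (bigD1 c) //= (bigD1 d) //= !ffunE !eqxx mulr1 scale1r.
rewrite !big1 ?addr0 // => [b bc|b bd].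
  by rewrite big1 // => b' _; rewrite !ffunE (negPf bc) mul0r scale0r.
by rewrite !ffunE (negPf bd) mulr0 scale0r.
Qed.

Section Triples.
Variable F : fieldType.
Local Notation C := (cayley F).
Local Notation "1c" := (cayley_one F).
Implicit Types a x y z : C.

Lemma cbilDr x y z : cbil x (y + z) = cbil x y + cbil x z.
Proof. by rewrite cbilC cbilDl !(cbilC x). Qed.
Lemma cbilZr (k : F) x y : cbil x (k *: y) = k * cbil x y.
Proof. by rewrite cbilC cbilZl cbilC. Qed.
Lemma cbilNr x y : cbil x (- y) = - cbil x y.
Proof. by rewrite -scaleN1r cbilZr mulN1r. Qed.
Lemma cbilNl x y : cbil (- x) y = - cbil x y.
Proof. by rewrite cbilC cbilNr cbilC. Qed.
Lemma cbil0r x : cbil x 0 = 0.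
Proof. by rewrite -(scale0r 0) cbilZr mul0r. Qed.
Lemma cbil0l x : cbil 0 x = 0.
Proof. by rewrite cbilC cbil0r. Qed.
Lemma cnorm1 : cnorm 1c = 1. Proof. cring. Qed.
Lemma ctr1 : ctr 1c = 2. Proof. cring. Qed.
Lemma cbar1 : cbar 1c = 1c. Proof. cring. Qed.

Lemma cbil_nondegenerate x : (forall y, cbil x y = 0) -> x = 0.
Proof.
move=> H; pose e (c : cayley_index) : C := basis_vector F c.
have E c d : e c d = (d == c)%:R :> F by rewrite ffunE.
have He c := H (e c).
by apply: cayleyP; rewrite zerocE;
 [ have := He E2 | have := He E1 | have := He (V 0) | have := He (V 1)
 | have := He (V 2) | have := He (U 0) | have := He (U 1) | have := He (U 2)];
 rewrite cbilE !E /= !(mulr0, mulr1, addr0, add0r).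
Qed.

(** When the norms are nonzero, [a] and [x] generate a quaternion subalgebra and [z] is orthogonal
    to it: the data of a Cayley-Dickson doubling. *)
Definition ortho_triple a x z : Prop :=
  [/\ skewc a, skewc x & skewc z] /\
  [/\ cbil a x = 0, cbil a z = 0, cbil x z = 0 & cbil (a ** x) z = 0].

Lemma skew_orthE x y : skewc x -> skewc y -> cbil x y = 0 -> y ** x = - (x ** y).
Proof.
move=> sx sy xy; have := cbil_mul x y; rewrite xy scale0r !skew_bar //.
by rewrite !mulcNr => /eqP; rewrite addr_eq0 opprK => /eqP <-.
Qed.

Lemma skew_orth_mul x y : skewc x -> skewc y -> cbil x y = 0 -> skewc (x ** y).
Proof. by move=> sx sy xy; rewrite /skewc ctrM skew_bar // cbilNr xy oppr0. Qed.

Section Doubling.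
Variables (b c z : C).
Hypotheses (zs : skewc z) (zb : cbil z b = 0) (zc : cbil z c = 0).

Lemma cbil_bar0 y : cbil z y = 0 -> cbil z (cbar y) = 0.
Proof. by move=> zy; rewrite -[z]opprK -(skew_bar zs) cbilNl cbil_bar zy oppr0. Qed.

Lemma doubling_comm y : cbil z y = 0 -> y ** z = z ** cbar y.
Proof.
move=> zy; have := cbil_mul y z; rewrite (cbilC y) zy scale0r skew_bar // mulcNr.
by rewrite addrC => /subr0_eq.
Qed.

(** With [doubling_l] and [doubling_lr], the three rules for multiplying elements of a subalgebra
    and of its translate by an orthogonal [z]. Each one moves [z] with a linearised alternative law
    whose right-hand side vanishes by orthogonality. *)
Lemma doubling_r : cbil z (c ** b) = 0 -> b ** (c ** z) = (c ** b) ** z.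
Proof.
move=> zcb; rewrite (doubling_comm zc).
have := cbarl (cbar b) z (cbar c); rewrite cbarK (cbilC _ z) (cbil_bar0 zb) scale0r.
rewrite (skew_bar zs) mulcNl => /subr0_eq ->.
by rewrite -cbarM -(doubling_comm zcb).
Qed.

Lemma doubling_l : (c ** z) ** b = (c ** cbar b) ** z.
Proof.
have := cbarr z (cbar b) c; rewrite cbarK (cbil_bar0 zb) scale0r.
by rewrite (skew_bar zs) mulcNr => /subr0_eq.
Qed.

Lemma doubling_lr : cbil z (cbar c ** b) = 0 ->
  (c ** z) ** (b ** z) = - cnorm z *: (cbar b ** c).
Proof.
move=> zcb.
have skcz : skewc (c ** z) by rewrite /skewc ctrM (skew_bar zs) cbilNr cbilC zc oppr0.
have := cbarl (c ** z) b z; rewrite cbilMl zcb scale0r (skew_bar skcz) mulcNl.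
move=> /eqP; rewrite addrC subr_eq0 => /eqP <-.
have := caltr z c; rewrite (skew_bar zs) mulcNr => /eqP; rewrite eqr_oppLR => /eqP ->.
by rewrite mulcNr mulcZr scaleNr.
Qed.

End Doubling.

Definition cdpow x (k : 'Z_2) : C := if k == 0 then 1c else x.

Definition cdbasis a x z (g : 'Z_2 * 'Z_2 * 'Z_2) : C :=
  let: (i, j, k) := g in (cdpow a i ** cdpow x j) ** cdpow z k.

Arguments cdbasis a x z g : simpl never.

Lemma z2cube_gradingE g :
  z2cube_grading F g = <[cdbasis (e1 F - e2 F) (u_ F 1 + v_ F 1) (u_ F 2 + v_ F 2) g]>%VS.
Proof. by case: g => [[]]. Qed.

Definition cd_triple a x z : Prop :=
  ortho_triple a x z /\ [/\ cnorm a = -1, cnorm x = 1 & cnorm z = 1].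

(** In the product of [a^p1 x^p2] and [a^q1 x^q2], moving [x] past [a] costs [p2 q1] signs and
    [x ** x = -1] costs [p2 q2] more, while [a ** a = 1] costs none. *)
Definition quat_sign (p q : 'Z_2 * 'Z_2) : F := (-1) ^+ ((p.2 * q.1 + p.2 * q.2)%R : 'Z_2).
Definition bar_sign (p : 'Z_2 * 'Z_2) : F := if p == 0 then 1 else -1.

(** The four cases are the quaternion product and the three doubling rules, with [cnorm z = 1]. *)
Definition cd_sign (g h : 'Z_2 * 'Z_2 * 'Z_2) : F :=
  if g.2 == 0 then
    if h.2 == 0 then quat_sign g.1 h.1 else quat_sign h.1 g.1
  else
    if h.2 == 0 then bar_sign h.1 * quat_sign g.1 h.1
    else - (bar_sign h.1 * quat_sign h.1 g.1).

Lemma cd_sign_neq0 g h : cd_sign g h != 0.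
Proof.
rewrite /cd_sign /quat_sign /bar_sign; do !case: ifP => _;
  by rewrite ?oppr_eq0 ?mulf_neq0 ?oppr_eq0 ?expf_neq0 ?oppr_eq0 ?oner_eq0.
Qed.

Section CDTable.
Variables (a x z : C).
Hypothesis axz : cd_triple a x z.

Let q (p : 'Z_2 * 'Z_2) : C := cdpow a p.1 ** cdpow x p.2.

Lemma quat_mul p r : q p ** q r = quat_sign p r *: q (p + r).
Proof.
have [[[sa sx sz] [ax az xz axz0]] [na nx nz]] := axz.
have sax : skewc (a ** x) by apply: skew_orth_mul.
have aa : a ** a = 1c by rewrite csqr sa na scale0r scaleN1r sub0r opprK.
have xx : x ** x = - 1c by rewrite csqr sx nx scale0r scale1r sub0r.
have ra y : a ** (a ** y) = y.
  have := calt a y; rewrite skew_bar // na scaleN1r mulcNl => /oppr_inj //.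
have rx y : x ** (x ** y) = - y.
  by have := calt x y; rewrite skew_bar // nx scale1r mulcNl => /eqP; rewrite eqr_oppLR => /eqP.
have la y : (y ** a) ** a = y.
  have := caltr a y; rewrite skew_bar // na scaleN1r mulcNr => /oppr_inj //.
have lx y : (y ** x) ** x = - y.
  by have := caltr x y; rewrite skew_bar // nx scale1r mulcNr => /eqP; rewrite eqr_oppLR => /eqP.
have xa : x ** a = - (a ** x) by apply: skew_orthE.
have axa : (a ** x) ** a = - x by rewrite -[a ** x]opprK -xa mulcNl la.
have xax : x ** (a ** x) = a by rewrite -[a ** x]opprK -xa mulcNr rx opprK.
have axax : (a ** x) ** (a ** x) = 1c.
  by rewrite csqr sax cnormM na nx scale0r mulr1 scaleN1r sub0r opprK.
case: p => i j; case: r => k l; rewrite /q /quat_sign /=.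
move: i j k l; do 4!apply: Z2_ind; rewrite /= /cdpow /=;
  rewrite ?(mul1c, mulc1, aa, xx, ra, rx, la, lx, xa, axa, xax, axax);
  by rewrite ?(expr0, expr1, scale1r, scaleN1r).
Qed.

Lemma quat_bar p : cbar (q p) = bar_sign p *: q p.
Proof.
have [[[sa sx sz] [ax az xz axz0]] _] := axz.
have sax : skewc (a ** x) by apply: skew_orth_mul.
case: p => i j; rewrite /q /bar_sign /=.
move: i j; do 2!apply: Z2_ind; rewrite /= /cdpow /= ?(mul1c, mulc1) ?cbar1 ?scale1r //;
 by rewrite skew_bar // scaleN1r.
Qed.

Lemma quat_orth p : cbil z (q p) = 0.
Proof.
have [[[sa sx sz] [ax az xz axz0]] _] := axz.
case: p => i j; rewrite /q /=; move: i j; do 2!apply: Z2_ind;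
 rewrite /= /cdpow /= ?(mul1c, mulc1) ?cbil1; by [exact: sz | rewrite cbilC].
Qed.

Lemma cdbasisE g : cdbasis a x z g = if g.2 == 0 then q g.1 else q g.1 ** z.
Proof. by case: g => [[i j] k]; rewrite /cdbasis [cdpow z k]/cdpow; case: ifP => _; rewrite ?mulc1. Qed.

(** The structure constants do not depend on the triple, which is why triples correspond to
    automorphisms. *)
Lemma cdbasis_mul g h :
  cdbasis a x z g ** cdbasis a x z h = cd_sign g h *: cdbasis a x z (g + h).
Proof.
have [[[sa sx sz] [ax az xz axz0]] [_ _ nz]] := axz.
have Q p r : cbil z (q p ** q r) = 0 by rewrite quat_mul cbilZr quat_orth mulr0.
have Qb p r : cbil z (cbar (q p) ** q r) = 0.
  by rewrite quat_bar mulcZl cbilZr Q mulr0.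
rewrite !cdbasisE /cd_sign; case: g => g k; case: h => h l /=.
move: k l; do 2!apply: Z2_ind; rewrite /=.
- exact: quat_mul.
- by rewrite doubling_r ?quat_orth // quat_mul mulcZl addrC.
- by rewrite doubling_l ?quat_orth // quat_bar mulcZr quat_mul !mulcZl scalerA.
- by rewrite doubling_lr ?quat_orth // nz quat_bar mulcZl quat_mul scaleN1r scalerA
    scaleNr addrC.
Qed.

End CDTable.
End Triples.


(** * Automorphisms obtained from triples and from brackets *)

Section CayleyAutomorphisms.
Variable F : fieldType.
Local Notation C := (cayley F).
Local Notation "1c" := (cayley_one F).
Implicit Types a x y z : C.

Lemma basisE (c d : cayley_index) : basis_vector F c d = (d == c)%:R :> F.
Proof. by rewrite ffunE. Qed.

Lemma onec_neq0 : 1c != 0.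
Proof.
by apply/eqP => /ffunP/(_ E1); rewrite !ffunE /= addr0 => /eqP; rewrite oner_eq0.
Qed.

Lemma scalec1_inj : injective (fun k : F => k *: 1c).
Proof.
move=> k l /eqP; rewrite -subr_eq0 -scalerBl scaler_eq0 (negPf onec_neq0) orbF.
by rewrite subr_eq0 => /eqP.
Qed.

Definition std_basis : 'Z_2 * 'Z_2 * 'Z_2 -> C :=
  cdbasis (e1 F - e2 F) (u_ F 1 + v_ F 1) (u_ F 2 + v_ F 2).

Arguments std_basis g : simpl never.

Lemma basis_mul c d : basis_vector F c ** basis_vector F d = cayley_table F c d.
Proof. exact: table_mul_basis. Qed.

Lemma std_basisE :
  (std_basis (0, 0, 0) = e1 F + e2 F) * (std_basis (1, 0, 0) = e1 F - e2 F) *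
  (std_basis (0, 1, 0) = u_ F 1 + v_ F 1) * (std_basis (1, 1, 0) = u_ F 1 - v_ F 1) *
  (std_basis (0, 0, 1) = u_ F 2 + v_ F 2) * (std_basis (1, 0, 1) = u_ F 2 - v_ F 2) *
  (std_basis (0, 1, 1) = u_ F 0 + v_ F 0) * (std_basis (1, 1, 1) = v_ F 0 - u_ F 0).
Proof.
have H k : (e1 F - e2 F) ** (u_ F k + v_ F k) = u_ F k - v_ F k.
  by rewrite mulcBl !mulcDr !basis_mul /= addr0 add0r.
have H1 : (u_ F 1 - v_ F 1) ** (u_ F 2 + v_ F 2) = v_ F 0 - u_ F 0.
  by rewrite mulcBl !mulcDr !basis_mul /= addr0 add0r.
have H2 : (u_ F 1 + v_ F 1) ** (u_ F 2 + v_ F 2) = u_ F 0 + v_ F 0.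
  by rewrite mulcDl !mulcDr !basis_mul /= addr0 add0r addrC.
by do !split; rewrite /std_basis /cdbasis /cdpow /= ?(mul1c, mulc1) ?H ?H1 ?H2.
Qed.

Lemma std_triple : cd_triple (e1 F - e2 F) (u_ F 1 + v_ F 1) (u_ F 2 + v_ F 2).
Proof.
have H : (e1 F - e2 F) ** (u_ F 1 + v_ F 1) = u_ F 1 - v_ F 1.
  by rewrite mulcBl !mulcDr !basis_mul /= addr0 add0r.
have HE1 : forall c, e1 F c = (c == E1)%:R :> F := basisE E1.
have HE2 : forall c, e2 F c = (c == E2)%:R :> F := basisE E2.
have HU k : forall c, u_ F k c = (c == U k)%:R :> F := basisE (U k).
have HV k : forall c, v_ F k c = (c == V k)%:R :> F := basisE (V k).
move: (e1 F) (e2 F) (u_ F) (v_ F) H HE1 HE2 HU HV => p q r s H Hp Hq Hr Hs.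
do !split; rewrite /skewc ?H ?ctrE ?cbilE ?cnormE ?addcE ?oppcE ?Hp ?Hq ?Hr ?Hs /=; ring.
Qed.

Lemma std_basis_mul g h :
  std_basis g ** std_basis h = cd_sign F g h *: std_basis (g + h).
Proof. exact/cdbasis_mul/std_triple. Qed.

Hypothesis two_neq0 : (2 : F) != 0.

Lemma half_sum (V : lmodType F) (x y : V) : x = 2^-1 *: ((x + y) + (x - y)).
Proof. by rewrite addrACA subrr addr0 -mulr2n -scaler_nat scalerA mulVf // scale1r. Qed.

Lemma half_diff (V : lmodType F) (x y : V) : y = 2^-1 *: ((x + y) - (x - y)).
Proof. by rewrite opprB [x + y]addrC addrACA subrr addr0 -mulr2n -scaler_nat scalerA mulVf // scale1r. Qed.

Lemma std_basis_ind (P : C -> Prop) :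
  (forall (k : F) x y, P x -> P y -> P (k *: x + y)) ->
  (forall g, P (std_basis g)) -> forall x, P x.
Proof.
move=> PL PB x; have P0 : P 0.
  by have := PL (-1) _ _ (PB 0) (PB 0); rewrite scaleN1r addNr.
have PZ k y : P y -> P (k *: y) by move=> Py; rewrite -[_ *: _]addr0; apply: PL.
have PD y z : P y -> P z -> P (y + z) by move=> Py Pz; rewrite -[y]scale1r; apply: PL.
have PN y : P y -> P (- y) by move=> Py; rewrite -scaleN1r; apply: PZ.
have PS y z : P (y + z) -> P (y - z) -> P y.
  by move=> ? ?; rewrite (half_sum y z); apply/PZ/PD.
have PT y z : P (y + z) -> P (y - z) -> P z.
  by move=> ? ?; rewrite (half_diff y z); apply/PZ/PD => //; apply: PN.
have Pe c : P (basis_vector F c).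
  have := PB; move: c; apply: cayley_index_ind' => B.
  - by apply: (PS _ (e2 F)); rewrite -std_basisE.
  - by apply: (PT (e1 F)); rewrite -std_basisE.
  - by apply: (PT (v_ F 0)); rewrite -?std_basisE // addrC -std_basisE.
  - by apply: (PS _ (v_ F 1)); rewrite -std_basisE.
  - by apply: (PS _ (v_ F 2)); rewrite -std_basisE.
  - by apply: (PS _ (u_ F 0)); rewrite -?std_basisE // addrC -std_basisE.
  - by apply: (PT (u_ F 1)); rewrite -std_basisE.
  - by apply: (PT (u_ F 2)); rewrite -std_basisE.
rewrite (free_space_sum x); elim/big_ind: _ => // c _; exact: PZ.
Qed.

Lemma cdbasis_bar a x z g : cd_triple a x z ->
  cbar (cdbasis a x z g) = (if g == 0 then 1 else -1 : F) *: cdbasis a x z g.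
Proof.
move=> axz; have [[[_ _ sz] _] _] := axz.
rewrite !(cdbasisE a x z); case: g => p k /=; move: k; apply: Z2_ind => /=.
  rewrite (quat_bar axz) /bar_sign.
  by have -> : ((p, 0 : 'Z_2) == 0) = (p == 0) by exact: andbT.
rewrite cbarM (skew_bar sz) mulcNl -doubling_comm ?(quat_orth axz) //.
have -> : ((p, 1 : 'Z_2) == 0) = false by exact: andbF.
by rewrite scaleN1r.
Qed.

(** [std_basisE] solved for the canonical basis. The signs for index [0] are exchanged because
    [std_basis (1, 1, 1)] is [v_ 0 - u_ 0]. *)
Definition triple_images a x z (c : cayley_index) : C :=
  let b := cdbasis a x z in
  match c with
  | E1 => 2^-1 *: (b (0, 0, 0) + b (1, 0, 0))
  | E2 => 2^-1 *: (b (0, 0, 0) - b (1, 0, 0))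
  | U i => if i == 1 then 2^-1 *: (b (0, 1, 0) + b (1, 1, 0))
           else if i == 2 then 2^-1 *: (b (0, 0, 1) + b (1, 0, 1))
           else 2^-1 *: (b (0, 1, 1) - b (1, 1, 1))
  | V i => if i == 1 then 2^-1 *: (b (0, 1, 0) - b (1, 1, 0))
           else if i == 2 then 2^-1 *: (b (0, 0, 1) - b (1, 0, 1))
           else 2^-1 *: (b (0, 1, 1) + b (1, 1, 1))
  end.

Lemma triple_images_basis a x z g :
  lin_ext (triple_images a x z) (std_basis g) = cdbasis a x z g.
Proof.
have S (u v : C) : 2^-1 *: (u + v) + 2^-1 *: (u - v) = u.
  by rewrite -scalerDr -half_sum.
have T (u v : C) : 2^-1 *: (u + v) - 2^-1 *: (u - v) = v.
  by rewrite -scalerBr -half_diff.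
case: g => [[i j] k]; move: i j k; do 3!apply: Z2_ind;
  rewrite std_basisE ?linearD ?linearN /= !lin_ext_basis /= ?S ?T //.
by rewrite addrC S.
Qed.

(** Multiplicativity holds because both families have the same table. For injectivity, the map
    commutes with [cbar], hence preserves [cbil], which is nondegenerate. *)
Lemma triple_automorphism a x z : cd_triple a x z ->
  exists f : 'End(C), is_alg_isomorphism (cayley_mul F) (cayley_mul F) f /\
    forall g, f (std_basis g) = cdbasis a x z g.
Proof.
move=> axz; pose f := lin_ext (triple_images a x z).
have fB : forall g, f (std_basis g) = cdbasis a x z g by exact: triple_images_basis.
exists f; split=> //.
have fM y t : f (y ** t) = f y ** f t.
  move: y; apply: std_basis_ind => [k y y' Hy Hy'|g].
    by rewrite mulcDl mulcZl !linearP /= mulcDl mulcZl Hy Hy'.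
  move: t; apply: std_basis_ind => [k t t' Ht Ht'|h].
    by rewrite mulcDr mulcZr !linearP /= mulcDr mulcZr Ht Ht'.
  by rewrite std_basis_mul linearZ /= !fB (cdbasis_mul axz).
have f1 : f 1c = 1c.
  have E : std_basis (0, 0, 0) = 1c by rewrite std_basisE.
  by rewrite -{1}E fB /cdbasis /cdpow /= !mulc1.
have fbar y : f (cbar y) = cbar (f y).
  move: y; apply: std_basis_ind => [k y y' Hy Hy'|g].
    by rewrite cbarD cbarZ !linearP /= cbarD cbarZ Hy Hy'.
  by rewrite fB (cdbasis_bar _ axz) (cdbasis_bar _ std_triple) linearZ /= fB.
have fbil y t : cbil (f y) (f t) = cbil y t.
  apply: scalec1_inj; rewrite /= -cbil_mul -!fbar -!fM -linearD /= cbil_mul.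
  by rewrite linearZ /= f1.
apply: iso_of_injective => // y fy0; apply: cbil_nondegenerate => t.
by rewrite -fbil fy0 cbil0l.
Qed.

Definition cbr x y : C := x ** y - y ** x.

Lemma cbrDl x y z : cbr (x + y) z = cbr x z + cbr y z.
Proof. by rewrite /cbr mulcDl mulcDr opprD addrACA. Qed.
Lemma cbrDr x y z : cbr z (x + y) = cbr z x + cbr z y.
Proof. by rewrite /cbr mulcDl mulcDr opprD addrACA. Qed.
Lemma cbrZl (k : F) x z : cbr (k *: x) z = k *: cbr x z.
Proof. by rewrite /cbr mulcZl mulcZr scalerBr. Qed.
Lemma cbrZr (k : F) x z : cbr z (k *: x) = k *: cbr z x.
Proof. by rewrite /cbr mulcZl mulcZr scalerBr. Qed.
Lemma cbr1l x : cbr 1c x = 0. Proof. by rewrite /cbr mul1c mulc1 subrr. Qed.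
Lemma cbr1r x : cbr x 1c = 0. Proof. by rewrite /cbr mul1c mulc1 subrr. Qed.
Lemma cbrC x y : cbr y x = - cbr x y. Proof. by rewrite opprB. Qed.
Lemma cbrxx x : cbr x x = 0. Proof. exact: subrr. Qed.

Lemma ctrD x y : ctr (x + y) = ctr x + ctr y. Proof. cring. Qed.
Lemma ctrZ (k : F) x : ctr (k *: x) = k * ctr x. Proof. cring. Qed.
Lemma ctr0 : ctr (0 : C) = 0. Proof. by rewrite -(scale0r 0) ctrZ mul0r. Qed.

Lemma cbr_skew x y : skewc (cbr x y).
Proof. by rewrite /skewc /cbr -scaleN1r ctrD ctrZ ctrC mulN1r subrr. Qed.

Lemma skew_mulE x y : skewc x -> skewc y ->
  2 *: (x ** y) = cbr x y - cbil x y *: 1c.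
Proof.
move=> sx sy; rewrite -cbil_mul !skew_bar // !mulcNr opprD !opprK /cbr.
by rewrite addrACA addNr addr0 scaler_nat mulr2n.
Qed.

(** The bracket alone knows the norm: it is read off from double brackets. *)
Lemma cbr_cbr x y : skewc x -> skewc y ->
  cbr x (cbr x y) = (- 4 * cnorm x) *: y + (2 * cbil x y) *: x.
Proof.
move=> sx sy.
have Hb := cbil_mul x y; rewrite !skew_bar // !mulcNr in Hb.
have A : x ** (x ** y) = - cnorm x *: y.
  have := calt x y; rewrite skew_bar // mulcNl => /eqP; rewrite eqr_oppLR => /eqP ->.
  by rewrite scaleNr.
have B : (y ** x) ** x = - cnorm x *: y.
  have := caltr x y; rewrite skew_bar // mulcNr => /eqP; rewrite eqr_oppLR => /eqP ->.
  by rewrite scaleNr.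
have Dyx : y ** x = - (cbil x y *: 1c) - x ** y by rewrite -Hb opprD !opprK addrAC subrr add0r.
have E : (x ** y) ** x = - (cbil x y *: x) + cnorm x *: y.
  have -> : x ** y = - (cbil x y *: 1c) - y ** x by rewrite -Hb opprD !opprK addrK.
  by rewrite mulcBl B mulcNl mulcZl mul1c scaleNr opprK.
have E' : x ** (y ** x) = - (cbil x y *: x) + cnorm x *: y.
  by rewrite Dyx mulcBr A mulcNr mulcZr mulc1 scaleNr opprK.
rewrite /cbr mulcBr mulcBl A B E E'.
by apply/ffunP => c; rewrite !ffunE /GRing.scale /=; ring.
Qed.

Lemma half_skew x : skewc (x - (2^-1 * ctr x) *: 1c).
Proof.
by rewrite /skewc -scaleN1r ctrD !ctrZ ctr1; field.
Qed.

Lemma skew_not_line x :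
  exists2 y, skewc y & forall k : F, y != k *: x.
Proof.
have su : skewc (e1 F - e2 F) by case: std_triple => [[[]]].
have sx : skewc (u_ F 1 + v_ F 1) by case: std_triple => [[[]]].
have [|] := pselect (exists k : F, e1 F - e2 F = k *: x); last first.
  move=> H; exists (e1 F - e2 F) => // k; apply: contra_notN H => /eqP ->.
  by exists k.
case=> k kx; exists (u_ F 1 + v_ F 1) => // l; apply/eqP => lx.
have /ffunP/(_ E1) := kx; have /ffunP/(_ E1) := lx.
rewrite !ffunE /= /GRing.scale /= addr0 subr0 => lx1 kx1.
have /eqP : k * x E1 != 0 :> F by rewrite -kx1 oner_neq0.
have /ffunP/(_ (U 1)) := lx; have /ffunP/(_ (U 1)) := kx.
rewrite !ffunE /= /GRing.scale /= !addr0 subr0 => kxU lxU.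
move/eqP; rewrite mulf_eq0 negb_or => /andP[k0 x10].
have l0 : l = 0 by apply/eqP; move/esym/eqP: lx1; rewrite mulf_eq0 (negPf x10) orbF.
by move/eqP: lxU; rewrite l0 mul0r oner_eq0.
Qed.

(** Comparing [cbr_cbr] before and after [f] shows that [f] preserves the norm of skew elements,
    hence [cbil]; then [skew_mulE] recovers the product from bracket and form. *)
Lemma bracket_automorphism (f : 'End(C)) :
  f 1c = 1c -> (forall x, skewc x -> skewc (f x)) ->
  (forall x y, f (cbr x y) = cbr (f x) (f y)) ->
  (forall x, f x = 0 -> x = 0) ->
  is_alg_isomorphism (cayley_mul F) (cayley_mul F) f.
Proof.
move=> f1 fS fB finj; apply: iso_of_injective => //.
have fD u w : f (u + w) = f u + f w by exact: linearD.
have fZ (k : F) u : f (k *: u) = k *: f u by exact: linearZ.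
have fN x : skewc x -> cnorm (f x) = cnorm x.
  (* As [f] is injective, [f z] is no multiple of [f x], so its coefficient in the comparison, four
     times the difference of the norms, must vanish. *)
  move=> sx; have [z sz zx] := skew_not_line x.
  have := fB x (cbr x z); rewrite (fB x z) (cbr_cbr sx sz).
  rewrite (cbr_cbr (fS _ sx) (fS _ sz)) fD !fZ => H.
  apply/eqP; apply: contraT => nn.
  have n4 : 4 * (cnorm (f x) - cnorm x) != 0.
    by rewrite mulf_neq0 ?subr_eq0 // (_ : 4 = 2 * 2 :> F) ?mulf_neq0 // -natrM.
  have key : (4 * (cnorm (f x) - cnorm x)) *: f z
           = (2 * (cbil (f x) (f z) - cbil x z)) *: f x.
    move/eqP: H; rewrite -subr_eq0 => /eqP H; apply/subr0_eq; rewrite -[RHS]H.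
    by apply/ffunP => c; rewrite !ffunE /GRing.scale /=; ring.
  case/eqP: (zx ((4 * (cnorm (f x) - cnorm x))^-1
                   * (2 * (cbil (f x) (f z) - cbil x z)))).
  apply/subr0_eq/finj; rewrite -scaleNr fD fZ scaleNr -scalerA -key scalerA mulVf //.
  by rewrite scale1r subrr.
have fbil x y : skewc x -> skewc y -> cbil (f x) (f y) = cbil x y.
  move=> sx sy; have sxy : skewc (x + y) by rewrite /skewc ctrD sx sy addr0.
  have := cnormD (f x) (f y); rewrite -fD !fN // cnormD.
  by move/addrI.
have fM x y : skewc x -> skewc y -> f (x ** y) = f x ** f y.
  move=> sx sy; apply: (scalerI two_neq0); rewrite -fZ (skew_mulE sx sy).
  by rewrite (skew_mulE (fS _ sx) (fS _ sy)) -!scaleNr fD fZ f1 fB fbil.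
have H x y k l : skewc x -> skewc y ->
    f ((x + k *: 1c) ** (y + l *: 1c)) = f (x + k *: 1c) ** f (y + l *: 1c).
  move=> sx sy; rewrite !fD !fZ f1 !mulcDl !mulcDr !fD fM //.
  by rewrite !mulcZl !mulcZr !mul1c !mulc1 !fZ f1.
move=> x y.
by have := H _ _ (2^-1 * ctr x) (2^-1 * ctr y) (half_skew x) (half_skew y); rewrite !subrK.
Qed.

End CayleyAutomorphisms.


(** By comparison of degrees, the degree zero part of [one] is already a left unit on homogeneous
    elements, hence on all elements, so it equals [one]. *)
Lemma grading_unit (F : fieldType) (A : vectType F) (m : {bilinear A -> A -> A})
    (one : A) (G : zmodType) (Gamma : G -> {vspace A}) :
  (forall x, m one x = x) -> (forall x, m x one = x) ->
  is_grading m Gamma -> one \in Gamma 0.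
Proof.
move=> m1 mr1 /is_gradingP[[s [p pP]] mG].
have H h x : x \in Gamma h -> m (p 0 one) x = x.
  move=> xh; rewrite -[in RHS](proj_id pP xh) -[in RHS](m1 x).
  rewrite -[in RHS](proj_sum pP one) linear_sumlz linear_sum /=.
  have E a : p h (m (p a one) x) = if a == 0 then m (p a one) x else 0.
    have ax : m (p a one) x \in Gamma (a + h) by apply: mG => //; apply: (proj_mem pP).
    case: eqP => [a0|/eqP a0].
      by apply: (proj_id pP); rewrite -[X in Gamma X]add0r -[X in X + h]a0.
    by apply: (proj_neq pP ax); rewrite -subr_eq0 opprD addrCA subrr addr0 oppr_eq0.
  under eq_bigr => a _ do rewrite E.
  have us : uniq s by case: pP.
  rewrite -big_mkcond /=; have [s0|s0] := boolP (0 \in s).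
    by rewrite sum_pred1_seq.
  rewrite (proj_out pP _ s0) linear0l big1_seq // => a /andP[/eqP ->].
  by rewrite (negPf s0).
suff E x : m (p 0 one) x = x by rewrite -(E one) mr1; apply: (proj_mem pP).
rewrite -(proj_sum pP x) linear_sumr /=.
by apply: eq_bigr => g _; apply: H; apply: (proj_mem pP).
Qed.

(** * Gradings of the Cayley algebra *)

Section Perp.
Variable F : fieldType.
Local Notation C := (cayley F).
Local Notation "1c" := (cayley_one F).
Hypothesis two_neq0 : (2 : F) != 0.
Implicit Types (x y z w : C) (Q : seq C).

Definition perp Q w : Prop := forall q, q \in Q -> cbil w q = 0.

Definition orthogonal_family Q : bool :=
  pairwise (fun x y => cbil x y == 0) Q && all (fun x => cnorm x != 0) Q.

Lemma perpD Q x y : perp Q x -> perp Q y -> perp Q (x + y).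
Proof. by move=> Qx Qy q qQ; rewrite cbilDl Qx // Qy // addr0. Qed.

Lemma perpZ Q (k : F) x : perp Q x -> perp Q (k *: x).
Proof. by move=> Qx q qQ; rewrite cbilZl Qx // mulr0. Qed.

(** Gram-Schmidt: the components of [y] along [Q] can be removed because the vectors of [Q] have
    nonzero norm. *)
Lemma perp_project Q y : orthogonal_family Q ->
  exists2 y', perp Q y' & forall z, perp Q z -> cbil z y' = cbil z y.
Proof.
elim: Q => [|q Q IH]; first by exists y.
rewrite /orthogonal_family /= => /andP[/andP[/allP qQ oQ] /andP[q0 nQ]].
have [|y1 Qy1 Hy1] := IH; first by rewrite /orthogonal_family oQ.
exists (y1 + (- cbil y1 q / (2 * cnorm q)) *: q).
  move=> r; rewrite inE cbilDl cbilZl => /orP[/eqP->|rQ].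
    by rewrite cbilxx divfK ?addrN // mulf_neq0.
  by rewrite (eqP (qQ r rQ)) mulr0 addr0 Qy1.
move=> z Qz; rewrite cbilDr cbilZr (Qz q) ?inE ?eqxx // mulr0 addr0 Hy1 // => r rQ.
by rewrite Qz // inE rQ orbT.
Qed.

Lemma cbil_sumr (I : Type) (r : seq I) (P : pred I) (E : I -> C) x :
  cbil x (\sum_(i <- r | P i) E i) = \sum_(i <- r | P i) cbil x (E i).
Proof.
elim/big_rec2: _ => [|i u v _ <-]; first by rewrite -(scale0r 0) cbilZr mul0r.
by rewrite cbilDr.
Qed.

Lemma cbil_suml (I : Type) (r : seq I) (P : pred I) (E : I -> C) x :
  cbil (\sum_(i <- r | P i) E i) x = \sum_(i <- r | P i) cbil (E i) x.
Proof. by rewrite cbilC cbil_sumr; apply: eq_bigr => i _; rewrite cbilC. Qed.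

Lemma dim_cayley : dim (cayley F) = 8%N.
Proof.
have -> : dim (cayley F) = (#|{: cayley_index}| * 1)%N by [].
by rewrite muln1 -sum1_card sum_cayley.
Qed.

Lemma perp_nonzero Q : (size Q < 8)%N -> exists2 z, z != 0 & perp Q z.
Proof.
move=> sQ; pose h z : 'rV[F]_(size Q) := \row_i cbil z (nth 0 Q i).
have hL : linear h.
  by move=> k x y; apply/rowP => i; rewrite !mxE cbilDl cbilZl.
pose hl : {linear C -> 'rV[F]_(size Q)} :=
  HB.pack h (GRing.isLinear.Build F C 'rV[F]_(size Q) _ h hL).
pose f : 'Hom(C, 'rV[F]_(size Q)) := linfun hl.
have fE z : f z = h z by rewrite lfunE.
have lk : lker f != 0%VS.
  apply: contraTneq sQ => l0; have := limg_ker_dim f fullv.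
  rewrite l0 capv0 dimv0 add0n dimvf dim_cayley => <-.
  by rewrite -leqNgt (leq_trans (dimvS (subvf _))) // dimvf dim_matrix mul1r.
exists (vpick (lker f)); first by rewrite vpick0.
move=> q qQ; have := memv_pick (lker f); rewrite memv_ker fE => /eqP/rowP.
have iq : (index q Q < size Q)%N by rewrite index_mem.
by move=> /(_ (Ordinal iq)); rewrite !mxE /= nth_index.
Qed.

Lemma nonisotropic_of_pair x y : cbil x y != 0 ->
  cnorm x != 0 \/ cnorm y != 0 \/ cnorm (x + y) != 0.
Proof.
move=> xy; have [x0|] := eqVneq (cnorm x) 0; last by left.
have [y0|] := eqVneq (cnorm y) 0; last by right; left.
by right; right; rewrite cnormD x0 y0 !add0r.
Qed.

End Perp.

Lemma cbil_mul_left (F : fieldType) (x y : cayley F) :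
  cbil x (x ** y) = cnorm x * ctr y.
Proof. cring. Qed.

Lemma cbil_mul_right (F : fieldType) (x y : cayley F) :
  cbil y (x ** y) = cnorm y * ctr x.
Proof. cring. Qed.

Section CayleyGradings.
Variable F : closedFieldType.
Local Notation C := (cayley F).
Local Notation "1c" := (cayley_one F).
Hypothesis two_neq0 : (2 : F) != 0.
Variables (G : zmodType) (D : G -> {vspace C}).
Hypothesis DP : is_grading (cayley_mul F) D.
Implicit Types (x y z w a : C) (Q : seq C).

Lemma sqrt_exists (c : F) : exists k : F, k ^+ 2 = c.
Proof.
have [k kE] := @solve_monicpoly F 2 (fun i => if i is 0%N then c else 0) isT.
by exists k; rewrite kE !big_ord_recl big_ord0 /= mulr1 mul0r !addr0.
Qed.

Lemma scale_norm x (c : F) : cnorm x != 0 -> c != 0 ->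
  exists2 k : F, k != 0 & cnorm (k *: x) = c.
Proof.
move=> x0 c0; have [k kE] := sqrt_exists (c / cnorm x).
exists k; last by rewrite cnormZ kE divfK.
by rewrite -sqrf_eq0 kE mulf_eq0 invr_eq0 negb_or c0.
Qed.

Lemma D_mul g h x y : x \in D g -> y \in D h -> x ** y \in D (g + h).
Proof. exact: (grading_mul DP). Qed.

Lemma D_one : 1c \in D 0.
Proof. by apply: (grading_unit _ _ DP) => x; [exact: mul1c | exact: mulc1]. Qed.

Lemma D_uniq g h x : x != 0 -> x \in D g -> x \in D h -> g = h.
Proof.
have [[s [p pP]] _] := (is_gradingP _ _).1 DP; exact: (homogeneous_degree_uniq pP).
Qed.

(** In [x ** x = ctr x *: x - cnorm x *: 1c] only the term [ctr x *: x] has a part of degree [g]. *)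
Lemma D_trace g x : x \in D g -> g != 0 -> ctr x = 0.
Proof.
move=> xg g0; have [[s [p pP]] _] := (is_gradingP _ _).1 DP.
have := congr1 (p g) (csqr x); rewrite linearB !linearZ /=.
rewrite (proj_neq pP (D_mul xg xg)); last first.
  by rewrite -subr_eq0 opprD addrA subrr sub0r oppr_eq0.
rewrite (proj_neq pP D_one g0) oppr0 scaler0 addr0 (proj_id pP xg) => /esym/eqP.
by rewrite scaler_eq0 => /orP[/eqP->//|/eqP ->]; rewrite ctr0.
Qed.

Lemma D_bar g x : x \in D g -> cbar x \in D g.
Proof.
move=> xg; rewrite cbar_def memvB //; have [->|g0] := eqVneq g 0.
  by rewrite memvZ // D_one.
by rewrite (D_trace xg) // scale0r mem0v.
Qed.

(** By [cbil_mul], the multiple [cbil x y *: 1c] of the unit is homogeneous of degree [g + h],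
    whereas the unit has degree zero. *)
Lemma D_cbil g h x y : x \in D g -> y \in D h -> g + h != 0 -> cbil x y = 0.
Proof.
move=> xg yh gh; apply: contraNeq gh => xy; apply/eqP.
have v0 : cbil x y *: 1c != 0 by rewrite scaler_eq0 negb_or xy onec_neq0.
apply: (D_uniq v0); last by rewrite memvZ // D_one.
by rewrite -cbil_mul memvD // ?[g + h]addrC; [rewrite addrC|]; apply: D_mul => //; apply: D_bar.
Qed.

Lemma perp_component Q s p g w : projections D s p ->
  (forall q, q \in Q -> exists h, q \in D h) -> perp Q w -> perp Q (p g w).
Proof.
move=> pP hQ Qw q qQ; have [h qh] := hQ q qQ.
have [gh|gh] := eqVneq (g + h) 0; last by apply: (D_cbil (proj_mem pP g w) qh).
have us : uniq s by case: pP.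
have [gs|gs] := boolP (g \in s); last by rewrite (proj_out pP _ gs) cbil0l.
rewrite -(Qw q qQ) -[in RHS](proj_sum pP w) cbil_suml (bigD1_seq g) //=.
rewrite [X in _ + X]big1 ?addr0 // => k kg; apply: (D_cbil (proj_mem pP k w) qh).
by apply: contraNneq kg => kh; rewrite -(addrK h k) kh -gh addrK.
Qed.

(** [Q] is orthogonal, so that one can project onto its complement; [R] is homogeneous, so that this
    same complement is graded. The two families differ at the second use in [cartan_type]. *)
Lemma pick_pair Q R : (size Q < 8)%N -> orthogonal_family Q ->
  (forall w, perp Q w <-> perp R w) ->
  (forall q, q \in R -> exists h, q \in D h) ->
  exists g x y, [/\ x \in D g, y \in D (- g), perp Q x, perp Q y & cbil x y != 0].
Proof.
move=> sQ oQ QR hR; have [z z0 Qz] := perp_nonzero sQ.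
have [[s [p pP]] _] := (is_gradingP _ _).1 DP.
have [y zy] : exists y, cbil z y != 0.
  apply: contrapT => H; case/eqP: z0; apply: cbil_nondegenerate => y.
  by apply/eqP; apply: contra_notT H => zy; exists y.
have [y' Qy' y'E] := perp_project two_neq0 y oQ; rewrite -(y'E z Qz) in zy.
apply: contrapT => H; case/eqP: zy.
rewrite -[z](proj_sum pP) -[y'](proj_sum pP) cbil_suml big1 // => g _.
rewrite cbil_sumr big1 // => h _.
have [gh|gh] := eqVneq (g + h) 0; last first.
  by apply: (D_cbil (proj_mem pP g z) (proj_mem pP h y')).
apply/eqP; apply: contra_notT H => nz; exists g, (p g z), (p h y'); split=> //.
- exact: (proj_mem pP).
- by rewrite -(_ : h = - g) ?(proj_mem pP) //; apply/eqP; rewrite -addr_eq0 addrC gh.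
- by apply/QR; apply: (perp_component _ pP hR); apply/QR.
- by apply/QR; apply: (perp_component _ pP hR); apply/QR.
Qed.

Section CartanCase.
Variable a0 : C.
Hypotheses (a0D : a0 \in D 0) (a0_skew : skewc a0) (a0_neq0 : a0 != 0).

Lemma degree_zero_involution : exists a, [/\ a \in D 0, skewc a & cnorm a = -1].
Proof.
have [[s [p pP]] _] := (is_gradingP _ _).1 DP.
suff [a [aD sa na]] : exists a, [/\ a \in D 0, skewc a & cnorm a != 0].
  have n1 : (-1 : F) != 0 by rewrite oppr_eq0 oner_neq0.
  have [k k0 kE] := scale_norm na n1; exists (k *: a); split=> //.
    by rewrite memvZ.
  by rewrite /skewc ctrZ sa mulr0.
have [y ay] : exists y, cbil a0 y != 0.
  apply: contrapT => H; case/eqP: a0_neq0; apply: cbil_nondegenerate => y.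
  by apply/eqP; apply: contra_notT H => zy; exists y.
have us : uniq s by case: pP.
have ay0 : cbil a0 (p 0 y) != 0.
  apply: contraNneq ay => E; rewrite -[y](proj_sum pP) cbil_sumr big1 // => g _.
  have [->//|g0] := eqVneq g 0.
  by apply: (D_cbil a0D (proj_mem pP g y)); rewrite add0r.
pose b := p 0 y - (2^-1 * ctr (p 0 y)) *: 1c.
have sb : skewc b by apply: half_skew.
have bD : b \in D 0 by rewrite memvB ?(proj_mem pP) // memvZ // D_one.
have ab : cbil a0 b != 0.
  by rewrite /b cbilDr cbilNr cbilZr cbil1 a0_skew mulr0 oppr0 addr0.
case: (nonisotropic_of_pair ab) => [?|[?|?]].
- by exists a0.
- by exists b.
- by exists (a0 + b); rewrite memvD // /skewc ctrD a0_skew sb addr0.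
Qed.

(** Left multiplication by [a] is an involution that preserves degrees and reverses the sign of
    [cbil]. So its two eigenspaces are totally isotropic and are paired with each other, and [x],
    [y] can be traded for eigenvectors. [P] carries the orthogonality to vectors chosen earlier. *)
Lemma peirce_split a g x y (P : C -> Prop) :
  a \in D 0 -> skewc a -> cnorm a = -1 ->
  (forall (k : F) x y, P x -> P y -> P (k *: x + y)) ->
  (forall x, P x -> P (a ** x)) ->
  x \in D g -> y \in D (- g) -> P x -> P y -> cbil x y != 0 ->
  exists h x1 y1, [/\ x1 \in D h, y1 \in D (- h), P x1 & P y1] /\
    [/\ a ** x1 = x1, a ** y1 = - y1 & cbil x1 y1 = 1].
Proof.
move=> aD sa na PL Pa xg yg Px Py xy.
have aa w : a ** (a ** w) = w.
  by have := calt a w; rewrite skew_bar // na scaleN1r mulcNl => /oppr_inj.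
have PZ (k : F) w : P w -> P (k *: w).
  move=> Pw; have := PL (k - 1) _ _ Pw Pw.
  by rewrite -[X in _ + X]scale1r -scalerDl subrK.
pose e w := w + a ** w; pose e' w := w - a ** w.
have aDm h w : w \in D h -> a ** w \in D h.
  by move=> wh; rewrite -[h]add0r; apply: D_mul.
have eD h w : w \in D h -> e w \in D h by move=> wh; rewrite memvD ?aDm.
have e'D h w : w \in D h -> e' w \in D h by move=> wh; rewrite memvB ?aDm.
have eP w : P w -> P (e w) by move=> Pw; rewrite /e -[w]scale1r; apply: PL; rewrite ?scale1r //; apply: Pa.
have e'P w : P w -> P (e' w).
  by move=> Pw; rewrite /e' addrC -scaleN1r; apply: PL => //; apply: Pa.
have ae w : a ** e w = e w by rewrite mulcDr aa addrC.
have ae' w : a ** e' w = - e' w by rewrite mulcBr aa opprB.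
have suff_pair h w1 w2 : w1 \in D h -> w2 \in D (- h) -> P w1 -> P w2 ->
    cbil (e w1) (e' w2) != 0 -> exists h x1 y1,
    [/\ x1 \in D h, y1 \in D (- h), P x1 & P y1] /\
    [/\ a ** x1 = x1, a ** y1 = - y1 & cbil x1 y1 = 1].
  move=> w1h w2h Pw1 Pw2 nz.
  exists h, (e w1), ((cbil (e w1) (e' w2))^-1 *: e' w2); split; split.
  - exact: eD.
  - by rewrite memvZ // e'D.
  - exact: eP.
  - exact/PZ/e'P.
  - exact: ae.
  - by rewrite mulcZr ae' scalerN.
  - by rewrite cbilZr mulVf.
have [H|H] := eqVneq (cbil (e x) (e' y)) 0; last exact: (suff_pair g x y).
have [H'|H'] := eqVneq (cbil (e y) (e' x)) 0; last first.
  by apply: (suff_pair (- g) y x) => //; rewrite opprK.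
have axy w w' : cbil (a ** w) w' = - cbil w (a ** w').
  by rewrite cbilMl skew_bar // mulcNl cbilNr.
(* The two pairings between eigenvectors, assumed zero, add up to four times [cbil x y]. *)
case/eqP: xy; apply: (mulfI two_neq0); apply: (mulfI two_neq0); rewrite !mulr0.
move: H H'; rewrite /e /e' !(cbilDl, cbilDr, cbilNr) !axy !aa.
rewrite (cbilC y x) (cbilC y (a ** x)) axy.
by move=> /(congr2 +%R) H /H; rewrite addr0 => <-; ring.
Qed.

(** The eigenvectors [x1], [x2] and [y1], [y2] become the images of [u_ 1], [u_ 2] and [v_ 1],
    [v_ 2]. The sums [x = x1 + y1] and [z = x2 + y2] complete [a] to a triple, and the last two
    basis vectors are products of these. *)
Lemma cartan_type : exists (f : 'End(C)) (g1 g2 : G),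
  is_alg_isomorphism (cayley_mul F) (cayley_mul F) f /\
  [/\ f (e1 F) \in D 0 /\ f (e2 F) \in D 0,
      f (u_ F 1) \in D g1 /\ f (v_ F 1) \in D (- g1),
      f (u_ F 2) \in D g2 /\ f (v_ F 2) \in D (- g2)
    & f (v_ F 0) \in D (g1 + g2) /\ f (u_ F 0) \in D (- g1 - g2)].
Proof.
have [a [aD sa na]] := degree_zero_involution.
have nn : - (1 : F) != 0 by rewrite oppr_eq0 oner_neq0.
have aa w : a ** (a ** w) = w.
  by have := calt a w; rewrite skew_bar // na scaleN1r mulcNl => /oppr_inj.
have axy w w' : cbil (a ** w) w' = - cbil w (a ** w').
  by rewrite cbilMl skew_bar // mulcNl cbilNr.
have perpL Q (k : F) x y : perp Q x -> perp Q y -> perp Q (k *: x + y).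
  by move=> Qx Qy; apply: perpD => //; apply: perpZ.
have aa1 : a ** a = 1c by rewrite -[a in _ ** a]mulc1 aa.
(* Multiplication by [a] changes the sign of the norm, so eigenvectors for [1] and [-1] are
   isotropic. *)
have iso w : a ** w = w \/ a ** w = - w -> cnorm w = 0.
  move=> H; apply/eqP; have : cnorm w = - cnorm w.
    rewrite -{1}(_ : cnorm (a ** w) = cnorm w); last first.
      by case: H => ->; rewrite // -scaleN1r cnormZ sqrrN expr1n mul1r.
    by rewrite cnormM na mulN1r.
  by move/eqP; rewrite -addr_eq0 -mulr2n -mulr_natl mulf_eq0 (negPf two_neq0).
have [g [x [y [xg yg Qx Qy xy]]]] : exists g x y,
    [/\ x \in D g, y \in D (- g), perp [:: 1c; a] x, perp [:: 1c; a] y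
      & cbil x y != 0].
  apply: (@pick_pair [:: 1c; a] [:: 1c; a] isT _ (fun _ => iff_refl _)) => [|q].
    by rewrite /orthogonal_family /= cnorm1 na nn oner_neq0 cbilC cbil1 sa eqxx.
  by rewrite !inE => /orP[] /eqP ->; exists 0; rewrite ?D_one.
have Pa1 w : perp [:: 1c; a] w -> perp [:: 1c; a] (a ** w).
  move=> Qw q; rewrite !inE => /orP[] /eqP ->.
    by rewrite axy mulc1 Qw ?oppr0 // !inE eqxx orbT.
  by rewrite axy aa1 Qw ?oppr0 // !inE eqxx.
have [g1 [x1 [y1 [[x1g y1g Qx1 Qy1] [ax1 ay1 xy1]]]]] :=
  peirce_split aD sa na (perpL _) Pa1 xg yg Qx Qy xy.
move=> {x y g xg yg Qx Qy xy Pa1}.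
have nx1 : cnorm x1 = 0 by apply: iso; left.
have ny1 : cnorm y1 = 0 by apply: iso; right.
pose x := x1 + y1; have ax : a ** x = x1 - y1 by rewrite mulcDr ax1 ay1.
have nx : cnorm x = 1 by rewrite cnormD nx1 ny1 !add0r.
have Qx : perp [:: 1c; a] x by apply: perpD.
have sx : skewc x by rewrite /skewc -cbil1 Qx // !inE eqxx.
have cax : cbil a x = 0 by rewrite cbilC Qx // !inE eqxx orbT.
pose Q := [:: 1c; a; x; a ** x]; pose R := [:: 1c; a; x1; y1].
have QR w : perp Q w <-> perp R w.
  split=> Hw q; rewrite !inE => /or4P[] /eqP ->.
  - by apply: Hw; rewrite !inE eqxx.
  - by apply: Hw; rewrite !inE eqxx orbT.
  - have := Hw x; have := Hw (a ** x); rewrite !inE !eqxx !orbT ax.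
    move=> /(_ isT) E1 /(_ isT) E2; apply: (mulfI two_neq0); rewrite mulr0.
    have := congr2 +%R E1 E2; rewrite addr0 /x !(cbilDr, cbilNr) => <-; ring.
  - have := Hw x; have := Hw (a ** x); rewrite !inE !eqxx !orbT ax.
    move=> /(_ isT) E1 /(_ isT) E2; apply: (mulfI two_neq0); rewrite mulr0.
    have := congr2 (fun u v => u - v) E2 E1; rewrite subr0 /x !(cbilDr, cbilNr) => <-.
    ring.
  - by apply: Hw; rewrite !inE eqxx.
  - by apply: Hw; rewrite !inE eqxx orbT.
  - by rewrite cbilDr (Hw x1) ?(Hw y1) ?addr0 // !inE eqxx ?orbT.
  - by rewrite ax cbilDr cbilNr (Hw x1) ?(Hw y1) ?subr0 // !inE eqxx ?orbT.
have [g [x' [y' [xg yg Qx' Qy' xy]]]] : exists g x y,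
    [/\ x \in D g, y \in D (- g), perp Q x, perp Q y & cbil x y != 0].
  apply: (@pick_pair Q R isT _ QR) => [|q].
    rewrite /orthogonal_family /= cnorm1 cnormM na nx mulr1 nn !oner_neq0.
    rewrite !(cbilC 1c) !cbil1 sa sx cax !eqxx /= ctrM (skew_bar sx) cbilNr cax oppr0.
    by rewrite cbil_mul_left cbil_mul_right sa sx !mulr0 !eqxx.
  rewrite !inE => /or4P[] /eqP ->.
  - by exists 0; apply: D_one.
  - by exists 0.
  - by exists g1.
  - by exists (- g1).
have Pa2 w : perp Q w -> perp Q (a ** w).
  move=> Qw q; rewrite !inE axy => /or4P[] /eqP ->;
  by rewrite ?mulc1 ?aa1 ?aa Qw ?oppr0 // !inE eqxx ?orbT.
have [g2 [x2 [y2 [[x2g y2g Qx2 Qy2] [ax2 ay2 xy2]]]]] :=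
  peirce_split aD sa na (perpL _) Pa2 xg yg Qx' Qy' xy.
have nx2 : cnorm x2 = 0 by apply: iso; left.
have ny2 : cnorm y2 = 0 by apply: iso; right.
pose z := x2 + y2; have az : a ** z = x2 - y2 by rewrite mulcDr ax2 ay2.
have nz : cnorm z = 1 by rewrite cnormD nx2 ny2 !add0r.
have Qz : perp Q z by apply: perpD.
have axz : cd_triple a x z.
  split; [split; split|split] => //.
  - by rewrite /skewc -cbil1 Qz // !inE eqxx.
  - by rewrite cbilC Qz // !inE eqxx orbT.
  - by rewrite cbilC Qz // !inE eqxx !orbT.
  - by rewrite cbilC Qz // !inE eqxx !orbT.
have [f [fP fB]] := triple_automorphism two_neq0 axz.
have fM u w : f (u ** w) = f u ** f w by case: fP => _ _; apply.
have HS (u w : C) : u = 2^-1 *: ((u + w) + (u - w)) := half_sum two_neq0 u w.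
have HT (u w : C) : w = 2^-1 *: ((u + w) - (u - w)) := half_diff two_neq0 u w.
have fadd u w : f (u + w) = f u + f w by exact: linearD.
have fsub u w : f (u - w) = f u - f w by exact: linearB.
have fscal (k : F) w : f (k *: w) = k *: f w by exact: linearZ.
have fS u w : f u = 2^-1 *: (f (u + w) + f (u - w)) by rewrite -fadd -fscal -HS.
have fT u w : f w = 2^-1 *: (f (u + w) - f (u - w)) by rewrite -fsub -fscal -HT.
have b000 : f (e1 F + e2 F) = 1c.
  by rewrite -[e1 F + e2 F](std_basisE F) fB /cdbasis /cdpow /= !mulc1.
have b100 : f (e1 F - e2 F) = a.
  by rewrite -std_basisE fB /cdbasis /cdpow /= !mulc1.
have b010 : f (u_ F 1 + v_ F 1) = x.
  by rewrite -std_basisE fB /cdbasis /cdpow /= mul1c mulc1.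
have b110 : f (u_ F 1 - v_ F 1) = x1 - y1.
  by rewrite -std_basisE fB /cdbasis /cdpow /= mulc1.
have b001 : f (u_ F 2 + v_ F 2) = z.
  by rewrite -std_basisE fB /cdbasis /cdpow /= !mul1c.
have b101 : f (u_ F 2 - v_ F 2) = x2 - y2.
  by rewrite -std_basisE fB /cdbasis /cdpow /= mulc1.
have fu1 : f (u_ F 1) = x1 by rewrite (fS _ (v_ F 1)) b010 b110 -HS.
have fv1 : f (v_ F 1) = y1 by rewrite (fT (u_ F 1)) b010 b110 -HT.
have fu2 : f (u_ F 2) = x2 by rewrite (fS _ (v_ F 2)) b001 b101 -HS.
have fv2 : f (v_ F 2) = y2 by rewrite (fT (u_ F 2)) b001 b101 -HT.
exists f, g1, g2; split=> //; rewrite fu1 fv1 fu2 fv2; split=> //; split.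
- by rewrite (fS _ (e2 F)) b000 b100 memvZ // memvD // D_one.
- by rewrite (fT (e1 F)) b000 b100 memvZ // memvB // D_one.
- have -> : v_ F 0 = u_ F 1 ** u_ F 2 by rewrite basis_mul.
  by rewrite fM fu1 fu2 D_mul.
- have -> : u_ F 0 = v_ F 1 ** v_ F 2 by rewrite basis_mul.
  by rewrite fM fv1 fv2 D_mul.
Qed.

End CartanCase.

Section CubeCase.
Hypothesis D0_skew : forall x, x \in D 0 -> skewc x -> x = 0.

(** If [2g] were nonzero, [x] would be isotropic and paired with some [y] of degree [-g]. Then
    [x ** y] and [y ** x] have degree zero, so they are scalars, and isotropy of [x] makes them
    vanish; but their sum is [- cbil x y] times the unit. *)
Lemma cube_two_torsion g x : x \in D g -> x != 0 -> g + g = 0.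
Proof.
move=> xg x0; have [->|g0] := eqVneq g 0; first exact: addr0.
apply/eqP; apply: contraT => gg.
have [[s [p pP]] _] := (is_gradingP _ _).1 DP.
have [y xy] : exists y, cbil x y != 0.
  apply: contrapT => H; case/eqP: x0; apply: cbil_nondegenerate => y.
  by apply/eqP; apply: contra_notT H => zy; exists y.
have us : uniq s by case: pP.
have xyg : cbil x (p (- g) y) != 0.
  apply: contraNneq xy => E; rewrite -[y](proj_sum pP) cbil_sumr big1 // => h _.
  have [->//|gh] := eqVneq h (- g).
  by apply: (D_cbil xg (proj_mem pP h y)); rewrite addrC addr_eq0.
have yg := proj_mem pP (- g) y; move: (p (- g) y) yg xyg => {xy}y yg xy.
have sx : skewc x by apply: D_trace xg g0.
have sy : skewc y by apply: (D_trace yg); rewrite oppr_eq0.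
have nx : cnorm x = 0.
  apply: (mulfI two_neq0); rewrite mulr0 -cbilxx; exact: (D_cbil xg xg gg).
have D0 w : w \in D 0 -> exists k : F, w = k *: 1c.
  move=> w0; exists (2^-1 * ctr w); apply/subr0_eq/D0_skew; last exact: half_skew.
  by rewrite memvB // memvZ // D_one.
have xy0 : x ** y = 0.
  have [k kE] : exists k : F, x ** y = k *: 1c by apply: D0; rewrite -(subrr g) D_mul.
  have := calt x y; rewrite nx scale0r skew_bar // mulcNl kE mulcZr mulc1 => /eqP.
  by rewrite oppr_eq0 scaler_eq0 (negPf x0) orbF => /eqP ->; rewrite scale0r.
have yx0 : y ** x = 0.
  have [k kE] : exists k : F, y ** x = k *: 1c by apply: D0; rewrite -(addNr g) D_mul.
  have := caltr x y; rewrite nx scale0r skew_bar // mulcNr kE mulcZl mul1c => /eqP.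
  by rewrite oppr_eq0 scaler_eq0 (negPf x0) orbF => /eqP ->; rewrite scale0r.
have := cbil_mul x y; rewrite !skew_bar // !mulcNr xy0 yx0 oppr0 addr0 => /esym/eqP.
by rewrite scaler_eq0 (negPf xy) (negPf (onec_neq0 _)).
Qed.

(** Since degrees have order at most two, a homogeneous pair that is not orthogonal lies in a single
    component, and polarisation finds an element of nonzero norm there. *)
Lemma cube_pick Q : (size Q < 8)%N -> orthogonal_family Q ->
  (forall q, q \in Q -> exists h, q \in D h) ->
  exists g x, [/\ x \in D g, perp Q x & cnorm x != 0].
Proof.
move=> sQ oQ hQ; have [g [x [y [xg yg Qx Qy xy]]]] := pick_pair sQ oQ (fun _ => conj id id) hQ.
have gg : g + g = 0.
  by apply: (cube_two_torsion xg); apply: contraNneq xy => ->; rewrite cbil0l.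
have yg' : y \in D g by rewrite -(_ : - g = g) //; apply/eqP; rewrite eq_sym -addr_eq0 gg.
case: (nonisotropic_of_pair xy) => [?|[?|?]]; first by exists g, x.
  by exists g, y.
by exists g, (x + y); split; rewrite ?memvD //; apply: perpD.
Qed.

Lemma cube_type : exists a x z ga gx gz,
  [/\ ortho_triple a x z, [/\ cnorm a != 0, cnorm x != 0 & cnorm z != 0],
      [/\ a \in D ga, x \in D gx & z \in D gz]
    & [/\ ga + ga = 0, gx + gx = 0 & gz + gz = 0]].
Proof.
have nonz (w : C) : cnorm w != 0 -> w != 0.
  by apply: contraNneq => ->; rewrite -(scale0r 0) cnormZ expr0n mul0r.
have h1 (q : C) : q \in [:: 1c] -> exists h, q \in D h.
  by rewrite inE => /eqP ->; exists 0; apply: D_one.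
have [|ga [a [aD Qa na]]] := cube_pick (Q := [:: 1c]) isT _ h1.
  by rewrite /orthogonal_family /= cnorm1 oner_neq0.
have sa : skewc a by rewrite /skewc -cbil1 Qa // inE.
have h2 (q : C) : q \in [:: 1c; a] -> exists h, q \in D h.
  by rewrite !inE => /orP[] /eqP ->; [exists 0; apply: D_one | exists ga].
have [|gx [x [xD Qx nx]]] := cube_pick (Q := [:: 1c; a]) isT _ h2.
  by rewrite /orthogonal_family /= cnorm1 na oner_neq0 cbilC cbil1 sa eqxx.
have sx : skewc x by rewrite /skewc -cbil1 Qx // !inE eqxx.
have cax : cbil a x = 0 by rewrite cbilC Qx // !inE eqxx orbT.
pose Q := [:: 1c; a; x; a ** x].
have h3 (q : C) : q \in Q -> exists h, q \in D h.
  rewrite !inE => /or4P[] /eqP ->; [exists 0; apply: D_one|by exists ga|by exists gx|].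
  by exists (ga + gx); apply: D_mul.
have [|gz [z [zD Qz nz]]] := cube_pick (Q := Q) isT _ h3.
  rewrite /orthogonal_family /= cnorm1 cnormM mulf_neq0 ?na ?nx ?oner_neq0 //.
  rewrite !(cbilC 1c) !cbil1 sa sx cax !eqxx /= ctrM (skew_bar sx) cbilNr cax oppr0 eqxx /=.
  by rewrite cbil_mul_left cbil_mul_right sa sx !mulr0 !eqxx.
have sz : skewc z by rewrite /skewc -cbil1 Qz // !inE eqxx.
exists a, x, z, ga, gx, gz; split=> //; split=> //.
- by split; rewrite // cbilC Qz // !inE eqxx ?orbT.
- exact: cube_two_torsion aD (nonz _ na).
- exact: cube_two_torsion xD (nonz _ nx).
- exact: cube_two_torsion zD (nonz _ nz).
Qed.

End CubeCase.

End CayleyGradings.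


(** * The tensor square *)

Section TensorBilinear.
Variables (F : fieldType) (I J : finType).

Fact tensor_bilinear : bilinear_for *:%R *:%R (@tensor F I J).
Proof.
by split=> [y|x] k z t; apply/ffunP => p; rewrite !ffunE /GRing.scale /=; ring.
Qed.

HB.instance Definition _ := bilinear_isBilinear.Build F
  (free_space F I) (free_space F J) (free_space F (I * J)%type) _ _ (@tensor F I J)
  tensor_bilinear.

Lemma tensorDl x x' y : tensor (x + x') y = tensor x y + tensor x' y :> free_space F (I * J)%type.
Proof. exact: (linearDl (@tensor F I J)). Qed.
Lemma tensorDr x y y' : tensor x (y + y') = tensor x y + tensor x y' :> free_space F (I * J)%type.
Proof. exact: (linearDr (@tensor F I J)). Qed.
Lemma tensorZl (k : F) x y : tensor (k *: x) y = k *: tensor x y :> free_space F (I * J)%type.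
Proof. exact: (linearZl_LR (@tensor F I J)). Qed.
Lemma tensorZr (k : F) x y : tensor x (k *: y) = k *: tensor x y :> free_space F (I * J)%type.
Proof. exact: (linearZr_LR (@tensor F I J)). Qed.
Lemma tensor0l y : tensor 0 y = 0 :> free_space F (I * J)%type.
Proof. exact: (linear0l (@tensor F I J)). Qed.
Lemma tensor0r x : tensor x 0 = 0 :> free_space F (I * J)%type.
Proof. exact: (linear0r (@tensor F I J)). Qed.
Lemma tensorNl x y : tensor (- x) y = - tensor x y :> free_space F (I * J)%type.
Proof. exact: (linearNl (@tensor F I J)). Qed.
Lemma tensorNr x y : tensor x (- y) = - tensor x y :> free_space F (I * J)%type.
Proof. exact: (linearNr (@tensor F I J)). Qed.

Lemma tensor_basis a b :
  tensor (basis_vector F a) (basis_vector F b) = basis_vector F (a, b) :> free_space F (I * J)%type.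
Proof.
apply/ffunP => -[c d]; rewrite !ffunE /= xpair_eqE.
by case: (c == a); case: (d == b); rewrite ?mulr1 ?mulr0 ?mul0r.
Qed.

Lemma tensor_ind (P : free_space F (I * J)%type -> Prop) :
  (forall (k : F) x y, P x -> P y -> P (k *: x + y)) -> P 0 ->
  (forall x y, P (tensor x y)) -> forall z, P z.
Proof.
move=> PL P0 PT; apply: free_space_ind => // -[a b].
by rewrite -tensor_basis.
Qed.

End TensorBilinear.

Notation "x *t y" := (tensor x y) (at level 41, no associativity).

(* An alias of the product that simplification does not unfold. *)
Definition amul (F : fieldType) (x y : cayley2 F) : cayley2 F := cayley2_mul F x y.
Arguments amul F x y : simpl never.
Notation "x *** y" := (amul x y) (at level 40, left associativity).

Section TensorSquare.
Variable F : fieldType.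
Local Notation C := (cayley F).
Local Notation A := (cayley2 F).
Local Notation "1c" := (cayley_one F).
Implicit Types (x y : C) (z t w : A).

Lemma amulDl z t w : (z + t) *** w = z *** w + t *** w.
Proof. exact: (linearDl (cayley2_mul F)). Qed.
Lemma amulDr z t w : w *** (z + t) = w *** z + w *** t.
Proof. exact: (linearDr (cayley2_mul F)). Qed.
Lemma amulZl (k : F) z t : (k *: z) *** t = k *: (z *** t).
Proof. exact: (linearZl_LR (cayley2_mul F)). Qed.
Lemma amulZr (k : F) z t : z *** (k *: t) = k *: (z *** t).
Proof. exact: (linearZr_LR (cayley2_mul F)). Qed.
Lemma amul0l z : 0 *** z = 0.
Proof. exact: (linear0l (cayley2_mul F)). Qed.
Lemma amul0r z : z *** 0 = 0.
Proof. exact: (linear0r (cayley2_mul F)). Qed.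

Lemma tensor_mul x y x' y' : (x *t y) *** (x' *t y') = (x ** x') *t (y ** y').
Proof.
move: x; apply: free_space_ind => [k x1 x2 H1 H2||a].
- by rewrite tensorDl tensorZl amulDl amulZl H1 H2 mulcDl mulcZl tensorDl tensorZl.
- by rewrite tensor0l amul0l mulc0l tensor0l.
move: y; apply: free_space_ind => [k x1 x2 H1 H2||b].
- by rewrite tensorDr tensorZr amulDl amulZl H1 H2 mulcDl mulcZl tensorDr tensorZr.
- by rewrite tensor0r amul0l mulc0l tensor0r.
move: x'; apply: free_space_ind => [k x1 x2 H1 H2||a'].
- by rewrite tensorDl tensorZl amulDr amulZr H1 H2 mulcDr mulcZr tensorDl tensorZl.
- by rewrite tensor0l amul0r mulc0r tensor0l.
move: y'; apply: free_space_ind => [k x1 x2 H1 H2||b'].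
- by rewrite tensorDr tensorZr amulDr amulZr H1 H2 mulcDr mulcZr tensorDr tensorZr.
- by rewrite tensor0r amul0r mulc0r tensor0r.
by rewrite !tensor_basis !basis_mul; apply: table_mul_basis.
Qed.

Definition j1 : 'Hom(C, A) := lin_ext (fun c => basis_vector F c *t 1c).
Definition j2 : 'Hom(C, A) := lin_ext (fun c => 1c *t basis_vector F c).

Lemma j1E x : j1 x = x *t 1c.
Proof.
move: x; apply: free_space_ind => [k x y Hx Hy||c].
- by rewrite linearP /= tensorDl tensorZl Hx Hy.
- by rewrite linear0 tensor0l.
- exact: lin_ext_basis.
Qed.

Lemma j2E x : j2 x = 1c *t x.
Proof.
move: x; apply: free_space_ind => [k x y Hx Hy||c].
- by rewrite linearP /= tensorDr tensorZr Hx Hy.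
- by rewrite linear0 tensor0r.
- exact: lin_ext_basis.
Qed.

Lemma j1M x y : j1 (x ** y) = j1 x *** j1 y.
Proof. by rewrite !j1E tensor_mul mulc1. Qed.
Lemma j2M x y : j2 (x ** y) = j2 x *** j2 y.
Proof. by rewrite !j2E tensor_mul mulc1. Qed.
Lemma j12M x y : j1 x *** j2 y = x *t y.
Proof. by rewrite j1E j2E tensor_mul mul1c mulc1. Qed.
Lemma j21M x y : j2 y *** j1 x = x *t y.
Proof. by rewrite j1E j2E tensor_mul mul1c mulc1. Qed.

Definition tmap (f g : 'End(C)) : 'End(A) :=
  lin_ext (fun p => f (basis_vector F p.1) *t g (basis_vector F p.2)).

Lemma tmapE f g x y : tmap f g (x *t y) = f x *t g y.
Proof.
move: x; apply: free_space_ind => [k x1 x2 H1 H2||a].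
- by rewrite tensorDl tensorZl !linearP /= H1 H2 tensorDl tensorZl.
- by rewrite linear0 !tensor0l linear0.
move: y; apply: free_space_ind => [k x1 x2 H1 H2||b].
- by rewrite tensorDr tensorZr !linearP /= H1 H2 tensorDr tensorZr.
- by rewrite linear0 !tensor0r linear0.
by rewrite tensor_basis; apply: lin_ext_basis.
Qed.

Definition swap : 'End(A) := lin_ext (fun p => basis_vector F (p.2, p.1)).

Lemma swapE x y : swap (x *t y) = y *t x.
Proof.
move: x; apply: free_space_ind => [k x1 x2 H1 H2||a].
- by rewrite tensorDl tensorZl linearP /= H1 H2 tensorDr tensorZr.
- by rewrite tensor0l linear0 tensor0r.
move: y; apply: free_space_ind => [k x1 x2 H1 H2||b].
- by rewrite tensorDr tensorZr linearP /= H1 H2 tensorDl tensorZl.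
- by rewrite tensor0r linear0 tensor0l.
rewrite !tensor_basis; exact: lin_ext_basis.
Qed.

Lemma tensor_lfun_ext (W : vectType F) (f g : 'Hom(A, W)) :
  (forall x y, f (x *t y) = g (x *t y)) -> f =1 g.
Proof.
move=> H; apply: tensor_ind => // [k z t Hz Ht|]; first by rewrite !linearP /= Hz Ht.
by rewrite !linear0.
Qed.

Lemma alg_hom_of_tensor (f : 'End(A)) :
  (forall x y x' y', f ((x ** x') *t (y ** y')) = f (x *t y) *** f (x' *t y')) ->
  forall z t, f (z *** t) = f z *** f t.
Proof.
move=> H z t; move: z; apply: tensor_ind => [k z1 z2 H1 H2||x y].
- by rewrite amulDl amulZl !linearP /= amulDl amulZl H1 H2.
- by rewrite amul0l !linear0 amul0l.
move: t; apply: tensor_ind => [k z1 z2 H1 H2||x' y'].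
- by rewrite amulDr amulZr !linearP /= amulDr amulZr H1 H2.
- by rewrite amul0r !linear0 amul0r.
by rewrite tensor_mul H.
Qed.

Lemma tmap_iso f g :
  is_alg_isomorphism (cayley_mul F) (cayley_mul F) f ->
  is_alg_isomorphism (cayley_mul F) (cayley_mul F) g ->
  is_alg_isomorphism (cayley2_mul F) (cayley2_mul F) (tmap f g).
Proof.
move=> fP gP; have [fK _ _] := iso_inv fP; have [gK _ _] := iso_inv gP.
have [_ _ fM] := fP; have [_ _ gM] := gP.
have fM' x y : f (x ** y) = f x ** f y by exact: fM.
have gM' x y : g (x ** y) = g x ** g y by exact: gM.
apply: iso_of_injective.
  have E : (tmap f^-1 g^-1 \o tmap f g)%VF =1 \1%VF.
    by apply: tensor_lfun_ext => x y; rewrite id_lfunE comp_lfunE !tmapE fK gK.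
  by move=> z z0; have := E z; rewrite id_lfunE comp_lfunE z0 linear0.
apply: alg_hom_of_tensor => x y x' y'.
by rewrite !tmapE tensor_mul fM' gM'.
Qed.

Lemma swap_swap z : swap (swap z) = z.
Proof.
have E : (swap \o swap)%VF =1 \1%VF.
  by apply: tensor_lfun_ext => x y; rewrite id_lfunE comp_lfunE !swapE.
by have := E z; rewrite id_lfunE comp_lfunE.
Qed.

Lemma swap_iso : is_alg_isomorphism (cayley2_mul F) (cayley2_mul F) swap.
Proof.
apply: iso_of_injective => [z z0|].
  by rewrite -(swap_swap z) z0 linear0.
by apply: alg_hom_of_tensor => x y x' y'; rewrite !swapE tensor_mul.
Qed.

Lemma skew_decomp x : skewc x -> x = (x E1 : F) *: (e1 F - e2 F)
  + (x (U 0) : F) *: u_ F 0 + (x (U 1) : F) *: u_ F 1 + (x (U 2) : F) *: u_ F 2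
  + (x (V 0) : F) *: v_ F 0 + (x (V 1) : F) *: v_ F 1 + (x (V 2) : F) *: v_ F 2.
Proof.
move=> sx; have xE2 : x E2 = - x E1 :> F by apply/eqP; rewrite -addr_eq0 addrC -ctrE sx.
rewrite [LHS]free_space_sum sum_cayley xE2 scalerBr scaleNr.
by rewrite -!addrA.
Qed.

Lemma mem_cayley_skew x : x \in cayley_skew F <-> skewc x.
Proof.
pose t : 'Hom(C, F^o) := lin_ext (fun c => match c with E1 | E2 => 1 : F^o | _ => 0 end).
have tE y : t y = ctr y.
  by rewrite lin_extE sum_cayley ctrE /= /GRing.scale /= !mulr1 !mulr0 !addr0.
(* [cayley_skew] lists [u_ 3] and [v_ 3], whose index is the class [0] modulo 3. *)
have three : (3 : 'Z_3) = 0 by apply: val_inj.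
split=> [xS|sx].
  have : (cayley_skew F <= lker t)%VS.
    apply/span_subvP => y; rewrite !inE memv_ker => Hy.
    have Hl c : t (basis_vector F c) = (if (c == E1) || (c == E2) then 1 else 0).
      by rewrite lin_ext_basis; case: (c).
    move: Hy; do 6?(case/orP => [/eqP ->|]); last move=> /eqP ->;
      by rewrite ?linearB /= !Hl //= ?subrr.
  by move/subvP/(_ x xS); rewrite memv_ker tE => /eqP.
rewrite (skew_decomp sx) -three.
pose s := [:: e1 F - e2 F; u_ F 1; u_ F 2; u_ F 3; v_ F 1; v_ F 2; v_ F 3].
have M k (c : F) : (k < 7)%N -> c *: nth 0 s k \in cayley_skew F.
  by move=> k7; apply/memvZ/memv_span/mem_nth.
apply: memvD (M 5%N _ isT); apply: memvD (M 4%N _ isT); apply: memvD (M 6%N _ isT).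
apply: memvD (M 2%N _ isT); apply: memvD (M 1%N _ isT).
exact: memvD (M 0%N _ isT) (M 3%N _ isT).
Qed.

Lemma mem_tensor_space (U W : {vspace C}) x y :
  x \in U -> y \in W -> x *t y \in tensor_space U W.
Proof.
move=> xU yW; have/span_bilinear_subP H : (tensor_space U W <= tensor_space U W)%VS by [].
exact: (H x y xU yW).
Qed.

Lemma tensor_space_subP (U W : {vspace C}) (X : {vspace A}) :
  (forall x y, x \in U -> y \in W -> x *t y \in X) -> (tensor_space U W <= X)%VS.
Proof. by move=> H; apply/(span_bilinear_subP (@tensor F _ _)). Qed.

Lemma mem_skew_sum z :
  z \in skew_sum F <-> exists x y, [/\ skewc x, skewc y & z = j1 x + j2 y].
Proof.
split=> [/memv_addP[z1 z1S [z2 z2S ->]]|[x [y [sx sy ->]]]]; last first.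
  rewrite j1E j2E memv_add // mem_tensor_space ?memv_line //; exact/mem_cayley_skew.
have H1 : (tensor_space (cayley_skew F) <[1c]> <= j1 @: cayley_skew F)%VS.
  apply: tensor_space_subP => x _ xS /vlineP[k ->].
  by rewrite tensorZr -tensorZl -j1E memv_img // memvZ.
have H2 : (tensor_space <[1c]> (cayley_skew F) <= j2 @: cayley_skew F)%VS.
  apply: tensor_space_subP => _ x /vlineP[k ->] xS.
  by rewrite tensorZl -tensorZr -j2E memv_img // memvZ.
have /memv_imgP[x xS ->] := subvP H1 _ z1S.
have /memv_imgP[y yS ->] := subvP H2 _ z2S.
by exists x, y; split=> //; apply/mem_cayley_skew.
Qed.

End TensorSquare.


(** * Associators, and recognition of C (x) 1 + 1 (x) C *)

Section Associator.
Variable F : fieldType.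
Local Notation C := (cayley F).
Local Notation A := (cayley2 F).
Local Notation "1c" := (cayley_one F).
Implicit Types (x y c e : C) (z t w : A).

Definition cassoc x c e : C := (x ** c) ** e - x ** (c ** e).

Lemma cassocDl x x' c e : cassoc (x + x') c e = cassoc x c e + cassoc x' c e.
Proof. by rewrite /cassoc !mulcDl opprD addrACA. Qed.
Lemma cassocDm x c c' e : cassoc x (c + c') e = cassoc x c e + cassoc x c' e.
Proof. by rewrite /cassoc !(mulcDl, mulcDr) opprD addrACA. Qed.
Lemma cassocDr x c e e' : cassoc x c (e + e') = cassoc x c e + cassoc x c e'.
Proof. by rewrite /cassoc !mulcDr opprD addrACA. Qed.
Lemma cassocZl (k : F) x c e : cassoc (k *: x) c e = k *: cassoc x c e.
Proof. by rewrite /cassoc !mulcZl scalerBr. Qed.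

Lemma cassoc_left x y : cassoc x x y = 0.
Proof.
have := calt x y; rewrite /cassoc cbar_def csqr !mulcBl !mulcZl !mul1c => /eqP.
by rewrite subr_eq => /eqP ->; rewrite [_ *: y + _]addrC addrK subrr.
Qed.

Lemma cassoc_right x y : cassoc y x x = 0.
Proof.
have := caltr x y; rewrite /cassoc cbar_def csqr !mulcBr !mulcZr !mulc1 => /eqP.
by rewrite subr_eq => /eqP ->; rewrite [_ *: y + _]addrC addrK subrr.
Qed.

(** By alternativity the associator changes sign when two neighbours are exchanged, and a cyclic
    shift is two such exchanges. *)
Lemma cassoc_cyc x c e : cassoc x c e = cassoc c e x.
Proof.
have := cassoc_left (x + c) e; rewrite cassocDl !cassocDm !cassoc_left.
rewrite addr0 add0r => /eqP; rewrite addr_eq0 => /eqP ->.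
have := cassoc_right (x + e) c; rewrite cassocDm !cassocDr !cassoc_right.
by rewrite addr0 add0r => /eqP; rewrite addr_eq0 => /eqP ->; rewrite opprK.
Qed.

(** Seven instances on basis vectors give [x E1 = x E2] and kill the six other coordinates. *)
Lemma cassoc_nucleus x : (forall c e, cassoc x c e = 0) -> x = (x E2 : F) *: 1c.
Proof.
have HE1 k : e1 F k = (k == E1)%:R :> F by rewrite ffunE.
have HE2 k : e2 F k = (k == E2)%:R :> F by rewrite ffunE.
have HU j k : u_ F j k = (k == U j)%:R :> F by rewrite ffunE.
have HV j k : v_ F j k = (k == V j)%:R :> F by rewrite ffunE.
move: (e1 F) (e2 F) (u_ F) (v_ F) HE1 HE2 HU HV => p q u v Hp Hq Hu Hv H.
have K c e k : ((x ** c) ** e) k = (x ** (c ** e)) k :> F.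
  by have /subr0_eq -> := H c e.
have := K (u 1) p (V 2); have := K (u 2) p (V 0); have := K (u 0) p (V 1).
have := K (v 1) q (U 2); have := K (v 2) q (U 0); have := K (v 0) q (U 1).
have := K (u 1) (u 2) (V 0); rewrite !mulcE.
rewrite ?Hp ?Hq ?Hu ?Hv /= => k1 k2 k3 k4 k5 k6 k7.
by apply: cayleyP; rewrite scalecE onecE ?mulr1 ?mulr0 //;
 [ move: k1 | move: k7 | move: k6 | move: k5 | move: k4 | move: k3 | move: k2 ];
 rewrite ?(mulr0, mul0r, mulr1, mul1r, addr0, add0r, subr0, oppr0).
Qed.

End Associator.


Section TensorAssociator.
Variable F : fieldType.
Local Notation C := (cayley F).
Local Notation A := (cayley2 F).
Local Notation "1c" := (cayley_one F).
Implicit Types (x y c e : C) (z t w : A).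

Definition aassoc z t w : A := (z *** t) *** w - z *** (t *** w).

Lemma aassoc_tensor x y x' y' x'' y'' :
  aassoc (x *t y) (x' *t y') (x'' *t y'') =
  ((x ** x') ** x'') *t ((y ** y') ** y'') - (x ** (x' ** x'')) *t (y ** (y' ** y'')).
Proof. by rewrite /aassoc !tensor_mul. Qed.

Lemma aassocDl z z' t w : aassoc (z + z') t w = aassoc z t w + aassoc z' t w.
Proof. by rewrite /aassoc !amulDl opprD addrACA. Qed.
Lemma aassocDm z t t' w : aassoc z (t + t') w = aassoc z t w + aassoc z t' w.
Proof. by rewrite /aassoc !(amulDl, amulDr) opprD addrACA. Qed.
Lemma aassocDr z t w w' : aassoc z t (w + w') = aassoc z t w + aassoc z t w'.
Proof. by rewrite /aassoc !amulDr opprD addrACA. Qed.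
Lemma aassocZl (k : F) z t w : aassoc (k *: z) t w = k *: aassoc z t w.
Proof. by rewrite /aassoc !amulZl scalerBr. Qed.
Lemma aassocZm (k : F) z t w : aassoc z (k *: t) w = k *: aassoc z t w.
Proof. by rewrite /aassoc !(amulZl, amulZr) scalerBr. Qed.
Lemma aassocZr (k : F) z t w : aassoc z t (k *: w) = k *: aassoc z t w.
Proof. by rewrite /aassoc !amulZr scalerBr. Qed.
Lemma aassoc0l t w : aassoc 0 t w = 0.
Proof. by rewrite -[X in aassoc X](scale0r 0) aassocZl scale0r. Qed.
Lemma aassoc0m z w : aassoc z 0 w = 0.
Proof. by rewrite -[X in aassoc _ X](scale0r 0) aassocZm scale0r. Qed.
Lemma aassoc0r z t : aassoc z t 0 = 0.
Proof. by rewrite -[X in aassoc _ _ X](scale0r 0) aassocZr scale0r. Qed.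

(* These elements form the subspace [j1 C + j2 C], which is thus graded. *)
Definition cyclic_assoc z : Prop := forall t w, aassoc z t w = aassoc t w z.

Lemma cyclic_assoc_of_tensor z :
  (forall x' y' x'' y'', aassoc z (x' *t y') (x'' *t y'')
                       = aassoc (x' *t y') (x'' *t y'') z) -> cyclic_assoc z.
Proof.
move=> H t w; move: t; apply: tensor_ind => [k t t' Ht Ht'||x' y'].
- by rewrite aassocDm aassocZm Ht Ht' aassocDl aassocZl.
- by rewrite aassoc0m aassoc0l.
move: w; apply: tensor_ind => [k t t' Ht Ht'||x'' y''].
- by rewrite aassocDr aassocZr Ht Ht' aassocDm aassocZm.
- by rewrite aassoc0r aassoc0m.
exact: H.
Qed.

Lemma tensor_subl x x' y : (x - x') *t y = x *t y - x' *t y :> A.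
Proof. by rewrite tensorDl tensorNl. Qed.
Lemma tensor_subr x y y' : x *t (y - y') = x *t y - x *t y' :> A.
Proof. by rewrite tensorDr tensorNr. Qed.

Lemma cyclic_assoc_j x y : cyclic_assoc (j1 F x + j2 F y).
Proof.
apply: cyclic_assoc_of_tensor => x' y' x'' y''.
rewrite aassocDl aassocDr j1E j2E !aassoc_tensor !mul1c !mulc1.
rewrite -tensor_subl -tensor_subl -tensor_subr -tensor_subr.
by rewrite -/(cassoc _ _ _) -/(cassoc _ _ _) cassoc_cyc [cassoc y _ _]cassoc_cyc.
Qed.

Lemma slice_sum z : z = \sum_b [ffun a => z (a, b)] *t basis_vector F b.
Proof.
apply/ffunP => -[a b]; rewrite sum_ffunE (bigD1 b) //= !ffunE /= eqxx mulr1.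
rewrite big1 ?addr0 // => d db; rewrite !ffunE /= eq_sym (negPf db); exact: mulr0.
Qed.

Lemma aassoc_suml (I : Type) (r : seq I) (P : pred I) (E : I -> A) t w :
  aassoc (\sum_(i <- r | P i) E i) t w = \sum_(i <- r | P i) aassoc (E i) t w.
Proof.
by elim/big_rec2: _ => [|i u v _ <-]; rewrite ?aassoc0l ?aassocDl.
Qed.

Lemma aassoc_sumr (I : Type) (r : seq I) (P : pred I) (E : I -> A) t w :
  aassoc t w (\sum_(i <- r | P i) E i) = \sum_(i <- r | P i) aassoc t w (E i).
Proof.
by elim/big_rec2: _ => [|i u v _ <-]; rewrite ?aassoc0r ?aassocDr.
Qed.

(** Write [z] as the sum of [Z b *t eb b]. Testing against [c *t 1c] and [e *t f], the sum of
    [cassoc (Z b) c e *t [eb b, f]] is zero. With [f = e1] this puts [Z (U k)] and [Z (V k)] in the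
    nucleus, and then [f = u_ F 1] puts [Z E1 - Z E2] there; so the [Z b] are scalars, except for a
    common part of [Z E1] and [Z E2], which multiplies [e1 + e2 = 1]. *)
Lemma cyclic_assocP z : cyclic_assoc z -> exists x y, z = j1 F x + j2 F y.
Proof.
move=> zN; pose Z b : C := [ffun a => z (a, b)]; pose eb (b : cayley_index) : C := basis_vector F b.
have zE : z = \sum_b Z b *t eb b by exact: slice_sum.
have H c e f : \sum_b cassoc (Z b) c e *t (eb b ** f - f ** eb b) = 0.
  have := zN (c *t 1c) (e *t f); rewrite [in LHS]zE [in RHS]zE aassoc_suml aassoc_sumr.
  move=> /eqP; rewrite -subr_eq0 -sumrB => /eqP E; rewrite -[RHS]E; apply: eq_bigr => b _.
  rewrite !aassoc_tensor !mulc1 !mul1c -!tensor_subl -!/(cassoc _ _ _).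
  by rewrite -(cassoc_cyc (Z b)) -tensor_subr.
have Hq c e f p q : \sum_b (cassoc (Z b) c e p : F) * (eb b ** f - f ** eb b) q = 0.
  have /ffunP/(_ (p, q)) := H c e f; rewrite sum_ffunE ffunE => E.
  by apply: etrans E; apply: eq_bigr => b _; rewrite [RHS]ffunE.
have HU k c e : cassoc (Z (U k)) c e = 0.
  apply/ffunP => p; have := Hq c e (e1 F) p (U k).
  rewrite (bigD1 (U k)) //= big1 => [|b bk].
    by rewrite /eb !basis_mul /= addr0 !ffunE eqxx /= sub0r mulrN1 => /eqP; rewrite oppr_eq0 => /eqP.
  rewrite /eb /e1 !basis_mul; case: b bk => [||j|j] jk /=; rewrite !ffunE /= ?subrr ?mulr0 //.
  have -> : (U k == U j) = false by apply: contraNF jk => /eqP ->.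
  by rewrite subrr mulr0.
have HV k c e : cassoc (Z (V k)) c e = 0.
  apply/ffunP => p; have := Hq c e (e1 F) p (V k).
  rewrite (bigD1 (V k)) //= big1 => [|b bk].
    by rewrite /eb !basis_mul /= addr0 !ffunE eqxx /= subr0 mulr1.
  rewrite /eb /e1 !basis_mul; case: b bk => [||j|j] jk /=; rewrite !ffunE /= ?subrr ?mulr0 //.
  have -> : (V k == V j) = false by apply: contraNF jk => /eqP ->.
  by rewrite subrr mulr0.
have HE c e : cassoc (Z E1 - Z E2) c e = 0.
  apply/ffunP => p; have := Hq c e (u_ F 1) p (U 1).
  have -> : cassoc (Z E1 - Z E2) c e = cassoc (Z E1) c e - cassoc (Z E2) c e.
    by rewrite cassocDl -(scaleN1r (Z E2)) cassocZl scaleN1r.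
  rewrite sum_cayley !HU !HV /eb !basis_mul /= ![(0 : C) _]ffunE !mul0r !addr0.
  by rewrite !ffunE /= subr0 sub0r mulr1 mulrN1.
have nU k := cassoc_nucleus (HU k); have nV k := cassoc_nucleus (HV k).
have nE := cassoc_nucleus HE.
pose k b : F := match b with E1 => (Z E1 - Z E2) E2 | E2 => 0 | _ => Z b E2 end.
pose X b : C := match b with E1 | E2 => Z E2 | _ => 0 end.
have ZE b : Z b = X b + k b *: 1c.
  by case: b => [||j|j] /=; rewrite /X /k; rewrite -?nE -?nU -?nV ?scale0r ?addr0 ?add0r // addrC subrK.
exists (Z E2), (\sum_b k b *: eb b); rewrite j1E j2E zE.
have -> : \sum_b Z b *t eb b = \sum_b X b *t eb b + \sum_b 1c *t (k b *: eb b).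
  rewrite -big_split; apply: eq_bigr => b _.
  by rewrite {1}ZE tensorDl tensorZl -tensorZr.
congr (_ + _); last by rewrite (linear_sumr (@tensor F _ _)).
by rewrite sum_cayley /X !tensor0l !addr0 -tensorDr.
Qed.

End TensorAssociator.


(** * Gradings of the tensor square and the skew subspace *)

Section SkewPart.
Variable F : fieldType.
Local Notation C := (cayley F).
Local Notation A := (cayley2 F).
Local Notation "1c" := (cayley_one F).
Local Notation S := (skew_sum F).
Hypothesis two_neq0 : (2 : F) != 0.
Implicit Types (x y : C) (z t w : A).

Definition abr z t : A := z *** t - t *** z.

Lemma abrDl z t w : abr (z + t) w = abr z w + abr t w.
Proof. by rewrite /abr amulDl amulDr opprD addrACA. Qed.
Lemma abrDr z t w : abr w (z + t) = abr w z + abr w t.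
Proof. by rewrite /abr amulDl amulDr opprD addrACA. Qed.
Lemma abr0l z : abr 0 z = 0. Proof. by rewrite /abr amul0l amul0r subrr. Qed.
Lemma abr0r z : abr z 0 = 0. Proof. by rewrite /abr amul0l amul0r subrr. Qed.

Lemma abr_suml (I : Type) (r : seq I) (E : I -> A) z :
  abr (\sum_(i <- r) E i) z = \sum_(i <- r) abr (E i) z.
Proof. by elim/big_rec2: _ => [|i u v _ <-]; rewrite ?abr0l ?abrDl. Qed.
Lemma abr_sumr (I : Type) (r : seq I) (E : I -> A) z :
  abr z (\sum_(i <- r) E i) = \sum_(i <- r) abr z (E i).
Proof. by elim/big_rec2: _ => [|i u v _ <-]; rewrite ?abr0r ?abrDr. Qed.

Lemma j1D x y : j1 F (x + y) = j1 F x + j1 F y. Proof. exact: linearD. Qed.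
Lemma j1B x y : j1 F (x - y) = j1 F x - j1 F y. Proof. exact: linearB. Qed.
Lemma j1Z (k : F) x : j1 F (k *: x) = k *: j1 F x. Proof. exact: linearZ. Qed.
Lemma j10 : j1 F 0 = 0. Proof. exact: linear0. Qed.
Lemma j2D x y : j2 F (x + y) = j2 F x + j2 F y. Proof. exact: linearD. Qed.
Lemma j2B x y : j2 F (x - y) = j2 F x - j2 F y. Proof. exact: linearB. Qed.
Lemma j2Z (k : F) x : j2 F (k *: x) = k *: j2 F x. Proof. exact: linearZ. Qed.
Lemma j20 : j2 F 0 = 0. Proof. exact: linear0. Qed.

Lemma abr_j1 x x' : abr (j1 F x) (j1 F x') = j1 F (cbr x x').
Proof. by rewrite /abr -!j1M -j1B. Qed.
Lemma abr_j2 x x' : abr (j2 F x) (j2 F x') = j2 F (cbr x x').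
Proof. by rewrite /abr -!j2M -j2B. Qed.
Lemma abr_j12 x y : abr (j1 F x) (j2 F y) = 0.
Proof. by rewrite /abr j12M j21M subrr. Qed.
Lemma abr_j21 x y : abr (j2 F y) (j1 F x) = 0.
Proof. by rewrite /abr j12M j21M subrr. Qed.

Lemma abr_j x y x' y' :
  abr (j1 F x + j2 F y) (j1 F x' + j2 F y') = j1 F (cbr x x') + j2 F (cbr y y').
Proof.
by rewrite abrDl !abrDr abr_j1 abr_j2 abr_j12 abr_j21 addr0 add0r.
Qed.

Lemma skewcD x y : skewc x -> skewc y -> skewc (x + y).
Proof. by rewrite /skewc ctrD => -> ->; rewrite addr0. Qed.
Lemma skewcZ (k : F) x : skewc x -> skewc (k *: x).
Proof. by rewrite /skewc ctrZ => ->; rewrite mulr0. Qed.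
Lemma skewc0 : skewc (0 : C). Proof. exact: ctr0. Qed.
Lemma skewcN x : skewc x -> skewc (- x).
Proof. by move=> sx; rewrite -scaleN1r; apply: skewcZ. Qed.
Lemma skew_u : skewc (e1 F - e2 F).
Proof. by have [[[]]] := std_triple F. Qed.
Lemma skew_basis (c : cayley_index) : c != E1 -> c != E2 -> skewc (basis_vector F c).
Proof.
move=> c1 c2; rewrite /skewc ctrE !basisE eq_sym (negPf c1) eq_sym (negPf c2); exact: addr0.
Qed.

Lemma mem_S x y : skewc x -> skewc y -> j1 F x + j2 F y \in S.
Proof. by move=> sx sy; apply/mem_skew_sum; exists x, y. Qed.
Lemma mem_S1 x : skewc x -> j1 F x \in S.
Proof. by move=> sx; rewrite -[j1 F x]addr0 -j20 (mem_S sx skewc0). Qed.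
Lemma mem_S2 x : skewc x -> j2 F x \in S.
Proof. by move=> sx; rewrite -[j2 F x]add0r -j10 (mem_S skewc0 sx). Qed.

Lemma skew_bracket_ind (P : C -> Prop) :
  (forall x y, P x -> P y -> P (x + y)) -> (forall (k : F) x, P x -> P (k *: x)) ->
  (forall x y, P (cbr x y)) -> forall x, skewc x -> P x.
Proof.
move=> PD PZ PB x sx; rewrite (skew_decomp sx).
have Pu i : P (u_ F i).
  have -> : u_ F i = cbr (e1 F) (u_ F i) by rewrite /cbr !basis_mul /= subr0.
  exact: PB.
have Pv i : P (v_ F i).
  have -> : v_ F i = cbr (e2 F) (v_ F i) by rewrite /cbr !basis_mul /= subr0.
  exact: PB.
have Pe : P (e1 F - e2 F).
  have -> : e1 F - e2 F = cbr (v_ F 0) (u_ F 0).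
    by rewrite /cbr !basis_mul /= opprK addrC.
  exact: PB.
by do !apply: (PD); apply: PZ.
Qed.

Lemma alg_ind (P : A -> Prop) :
  (forall z t, P z -> P t -> P (z + t)) -> (forall (k : F) z, P z -> P (k *: z)) ->
  (forall z t, P z -> P t -> P (z *** t)) ->
  (forall x, skewc x -> P (j1 F x)) -> (forall x, skewc x -> P (j2 F x)) ->
  forall z, P z.
Proof.
move=> PD PZ PM P1 P2.
have uu : (e1 F - e2 F) ** (e1 F - e2 F) = 1c.
  have [_ [nu _ _]] := std_triple F.
  by rewrite csqr skew_u nu scale0r scaleN1r sub0r opprK.
have PJ1 x : P (j1 F x).
  rewrite -[x](subrK ((2^-1 * ctr x) *: 1c)) j1D; apply: (PD).
    exact/P1/half_skew.
  by rewrite j1Z -uu j1M; apply/PZ/PM; apply/P1/skew_u.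
have PJ2 x : P (j2 F x).
  rewrite -[x](subrK ((2^-1 * ctr x) *: 1c)) j2D; apply: (PD).
    exact/P2/half_skew.
  by rewrite j2Z -uu j2M; apply/PZ/PM; apply/P2/skew_u.
apply: tensor_ind => [k z t Pz Pt||x y]; first by apply/PD => //; apply/PZ.
  by rewrite -(scale0r (j1 F 0)); apply/PZ/PJ1.
by rewrite -j12M; apply: PM.
Qed.

Definition ctrace : 'Hom(C, F^o) :=
  lin_ext (fun c => match c with E1 | E2 => 1 : F^o | _ => 0 end).

Lemma ctraceE x : ctrace x = ctr x.
Proof. by rewrite lin_extE sum_cayley ctrE /= /GRing.scale /= !mulr1 !mulr0 !addr0. Qed.

(** Half the trace on one factor: [q1] and [q2] are retractions of [j1] and [j2], and each kills the
    skew elements of the other copy. *)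
Definition q1 : 'Hom(A, C) :=
  lin_ext (fun p => (2^-1 * ctrace (basis_vector F p.2) : F) *: basis_vector F p.1).
Definition q2 : 'Hom(A, C) :=
  lin_ext (fun p => (2^-1 * ctrace (basis_vector F p.1) : F) *: basis_vector F p.2).

Lemma q1E x y : q1 (x *t y) = (2^-1 * ctr y) *: x.
Proof.
move: x; apply: free_space_ind => [k x1 x2 H1 H2||a].
- by rewrite tensorDl tensorZl linearP /= H1 H2 scalerDr !scalerA [k * _]mulrC.
- by rewrite tensor0l linear0 scaler0.
move: y; apply: free_space_ind => [k x1 x2 H1 H2||b].
- rewrite tensorDr tensorZr linearP /= H1 H2 ctrD ctrZ mulrDr scalerDl scalerA.
  by congr (_ *: _ + _); rewrite mulrCA.
- by rewrite tensor0r linear0 ctr0 mulr0 scale0r.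
by rewrite tensor_basis [LHS]lin_ext_basis ctraceE.
Qed.

Lemma q2E x y : q2 (x *t y) = (2^-1 * ctr x) *: y.
Proof.
move: x; apply: free_space_ind => [k x1 x2 H1 H2||a].
- rewrite tensorDl tensorZl linearP /= H1 H2 ctrD ctrZ mulrDr scalerDl scalerA.
  by congr (_ *: _ + _); rewrite mulrCA.
- by rewrite tensor0l linear0 ctr0 mulr0 scale0r.
move: y; apply: free_space_ind => [k x1 x2 H1 H2||b].
- by rewrite tensorDr tensorZr linearP /= H1 H2 scalerDr !scalerA [k * _]mulrC.
- by rewrite tensor0r linear0 scaler0.
by rewrite tensor_basis [LHS]lin_ext_basis ctraceE.
Qed.

Lemma q1_j x y : skewc y -> q1 (j1 F x + j2 F y) = x.
Proof.
by move=> sy; rewrite linearD /= j1E j2E !q1E ctr1 sy mulVf // mulr0 scale1r scale0r addr0.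
Qed.

Lemma q2_j x y : skewc x -> q2 (j1 F x + j2 F y) = y.
Proof.
by move=> sx; rewrite linearD /= j1E j2E !q2E ctr1 sx mulVf // mulr0 scale1r scale0r add0r.
Qed.

Lemma j12_inj x y x' y' : skewc x -> skewc y -> skewc x' -> skewc y' ->
  j1 F x + j2 F y = j1 F x' + j2 F y' -> x = x' /\ y = y'.
Proof.
move=> sx sy sx' sy' E; split; first by rewrite -(q1_j x sy) E q1_j.
by rewrite -(q2_j y sx) E q2_j.
Qed.

Lemma j1_inj : injective (j1 F).
Proof.
by move=> x y /(congr1 q1); rewrite !j1E !q1E ctr1 mulVf // !scale1r.
Qed.

Lemma j2_inj : injective (j2 F).
Proof.
by move=> x y /(congr1 q2); rewrite !j2E !q2E ctr1 mulVf // !scale1r.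
Qed.

Lemma cbr_center x : skewc x -> (forall y, skewc y -> cbr x y = 0) -> x = 0.
Proof.
move=> sx H; pose u := e1 F - e2 F.
have nu : cnorm u = -1 by have [_ []] := std_triple F.
have su := skew_u.
have xu : exists k : F, x = k *: u.
  have := cbr_cbr su sx; rewrite (cbrC x) H // oppr0 /cbr mulc0r mulc0l subrr.
  rewrite -/u nu mulrN1 opprK => /esym/eqP; rewrite addr_eq0 => /eqP E.
  have f0 : (4 : F) != 0 by rewrite (_ : 4 = 2 * 2) ?mulf_neq0 // -natrM.
  exists (4^-1 * - (2 * cbil u x)); apply: (scalerI f0).
  by rewrite E scalerA mulrA mulfV // mul1r scaleNr.
have [k kE] := xu; have := H (u_ F 1) (skew_basis _ _).
rewrite kE cbrZl => /(_ isT isT)/eqP; rewrite scaler_eq0 => /orP[/eqP ->|].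
  by rewrite scale0r.
have -> : cbr u (u_ F 1) = 2 *: u_ F 1.
  by rewrite /cbr /u mulcBl mulcBr !basis_mul /= subr0 sub0r opprK scaler_nat.
by rewrite scaler_eq0 (negPf two_neq0) /= => /eqP/ffunP/(_ (U 1)) /eqP; rewrite !ffunE oner_eq0.
Qed.

Section WithGrading.
Variables (G : zmodType) (Gamma : G -> {vspace A}) (s : seq G) (p : G -> 'End(A)).
Hypotheses (pP : projections Gamma s p) (mG : graded_mul (cayley2_mul F) Gamma).

Lemma Gamma_mul g h z t : z \in Gamma g -> t \in Gamma h -> z *** t \in Gamma (g + h).
Proof. exact: mG. Qed.

Lemma Gamma_abr g h z t : z \in Gamma g -> t \in Gamma h -> abr z t \in Gamma (g + h).
Proof.
move=> zg th; rewrite memvB //; first exact: Gamma_mul.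
by rewrite addrC; apply: Gamma_mul.
Qed.

Lemma proj_shift (phi : A -> A) g k :
  (forall a z, z \in Gamma a -> phi z \in Gamma (a + k)) ->
  (forall z t, phi (z + t) = phi z + phi t) -> phi 0 = 0 ->
  forall z, p (g + k) (phi z) = phi (p g z).
Proof.
move=> phiG phiD phi0; apply: (homogeneous_ind pP) => [z t Hz Ht||a z za].
- by rewrite phiD !linearD /= phiD Hz Ht.
- by rewrite !(phi0, linear0).
have [->|ga] := eqVneq g a.
  by rewrite (proj_id pP (phiG _ _ za)) (proj_id pP za).
rewrite (proj_neq pP za ga) phi0 (proj_neq pP (phiG _ _ za)) //.
by apply: contraNneq ga => /addIr ->.
Qed.

(** The condition is linear in [z] and can be tested on homogeneous [t] and [w], for which both
    sides shift degrees by the same amount. *)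
Lemma cyclic_assoc_proj g z : cyclic_assoc z -> cyclic_assoc (p g z).
Proof.
move=> zN t w; move: t; apply: (homogeneous_ind pP) => [t t' Ht Ht'||h t th].
- by rewrite aassocDm aassocDl Ht Ht'.
- by rewrite aassoc0m aassoc0l.
move: w; apply: (homogeneous_ind pP) => [w w' Hw Hw'||k w wk].
- by rewrite aassocDr aassocDm Hw Hw'.
- by rewrite aassoc0r aassoc0m.
rewrite -(proj_shift (phi := fun z => aassoc z t w) g (k := h + k)); last first.
- exact: aassoc0l.
- by move=> *; rewrite aassocDl.
- move=> a z' za; rewrite memvB //; last by do 2!apply: Gamma_mul => //.
  by rewrite addrA; do 2!apply: Gamma_mul => //.
rewrite zN -(proj_shift (phi := fun z => aassoc t w z) g (k := h + k)) //.
- move=> a z' za; rewrite addrC memvB //; first by do 2!apply: Gamma_mul => //.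
  by rewrite -addrA; do 2!apply: Gamma_mul => //.
- by move=> *; rewrite aassocDr.
- exact: aassoc0r.
Qed.

(** [S] is spanned by commutators of elements satisfying [cyclic_assoc], and a component of such a
    commutator is a sum of commutators of components. *)
Lemma S_proj g z : z \in S -> p g z \in S.
Proof.
have abrS n n' : cyclic_assoc n -> cyclic_assoc n' -> abr n n' \in S.
  move=> /cyclic_assocP[x [y ->]] /cyclic_assocP[x' [y' ->]].
  by rewrite abr_j mem_S //; apply: cbr_skew.
have K n n' : cyclic_assoc n -> cyclic_assoc n' -> p g (abr n n') \in S.
  move=> nN nN'.
  rewrite -[n](proj_sum pP) -[n'](proj_sum pP).
  rewrite abr_suml linear_sum rpred_sum //= => a _.
  rewrite abr_sumr linear_sum rpred_sum //= => b _.
  have H := Gamma_abr (proj_mem pP a n) (proj_mem pP b n').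
  have [->|gab] := eqVneq g (a + b); last by rewrite (proj_neq pP H gab) mem0v.
  by rewrite (proj_id pP H); apply: abrS; apply: cyclic_assoc_proj.
have N1 x : cyclic_assoc (j1 F x).
  by have := cyclic_assoc_j x 0; rewrite j20 addr0.
have N2 x : cyclic_assoc (j2 F x).
  by have := cyclic_assoc_j 0 x; rewrite j10 add0r.
case/mem_skew_sum => x [y [sx sy ->]]; rewrite linearD memvD //.
  apply: (skew_bracket_ind (P := fun x => p g (j1 F x) \in S)) sx => [x1 x2 H1 H2|k x1 H1|x1 x2].
  - by rewrite j1D linearD memvD.
  - by rewrite j1Z linearZ memvZ.
  - by rewrite -abr_j1; apply: K.
apply: (skew_bracket_ind (P := fun x => p g (j2 F x) \in S)) sy => [x1 x2 H1 H2|k x1 H1|x1 x2].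
- by rewrite j2D linearD memvD.
- by rewrite j2Z linearZ memvZ.
- by rewrite -abr_j2; apply: K.
Qed.

Lemma S_ind (P : A -> Prop) :
  (forall z t, z \in S -> t \in S -> P z -> P t -> P (z + t)) -> P 0 ->
  (forall g z, z \in Gamma g -> z \in S -> P z) -> forall z, z \in S -> P z.
Proof.
move=> PD P0 PG z zS; rewrite -(proj_sum pP z).
suff [] : P (\sum_(g <- s) p g z) /\ \sum_(g <- s) p g z \in S by [].
elim/big_rec: _ => [|g t _ [Pt tS]]; first by rewrite mem0v.
split; last by rewrite memvD // S_proj.
by apply: (PD) => //; [rewrite S_proj|apply: (PG g); rewrite ?(proj_mem pP) ?S_proj].
Qed.

(** A projection of a product is a sum of products of projections, so the inclusions spread from [S]
    to the algebra it generates. *)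
Lemma S_generates (H : zmodType) (Delta : H -> {vspace A}) (psi : {additive G -> H}) :
  graded_mul (cayley2_mul F) Delta ->
  (forall g, (S :&: Gamma g <= Delta (psi g))%VS) ->
  forall g, (Gamma g <= Delta (psi g))%VS.
Proof.
move=> mD SD.
suff H0 z : forall g, p g z \in Delta (psi g).
  by move=> g; apply/subvP => z zg; rewrite -(proj_id pP zg).
move: z; apply: alg_ind => [z t Hz Ht g|k z Hz g|z t Hz Ht g|x sx g|x sx g].
- by rewrite linearD memvD ?Hz ?Ht.
- by rewrite linearZ memvZ ?Hz.
- rewrite [p g _](proj_mul pP mG) rpred_sum // => a _.
  have -> : psi g = psi a + psi (g - a) by rewrite -raddfD addrC subrK.
  exact: mD.
- by apply: (subvP (SD g)); rewrite memv_cap (proj_mem pP) S_proj ?mem_S1.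
- by apply: (subvP (SD g)); rewrite memv_cap (proj_mem pP) S_proj ?mem_S2.
Qed.

Definition eps1 : 'End(A) := (j1 F \o q1)%VF.

Lemma eps1_j x y : skewc y -> eps1 (j1 F x + j2 F y) = j1 F x.
Proof. by move=> sy; rewrite comp_lfunE q1_j. Qed.

(* The component of degree [g] of the centroid element [eps1]. *)
Definition eps_comp g : 'End(A) := \sum_(h <- s) (p (h + g) \o (eps1 \o p h))%VF.

Lemma eps_comp_hom g h z : z \in Gamma h -> eps_comp g z = p (h + g) (eps1 z).
Proof.
move=> zh; rewrite sum_lfunE; have us : uniq s by case: pP.
have [hs|hs] := boolP (h \in s).
  rewrite (bigD1_seq h) //= !comp_lfunE (proj_id pP zh) big1 ?addr0 // => k kh.
  by rewrite !comp_lfunE (proj_neq pP zh kh) !linear0.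
have z0 : z = 0 by move: zh; rewrite (proj_supp pP hs) memv0 => /eqP.
by rewrite z0 !linear0 big1 // => k _; rewrite !linear0.
Qed.

Lemma eps1_S z : z \in S -> eps1 z \in S.
Proof. by case/mem_skew_sum => x [y [sx sy ->]]; rewrite eps1_j // mem_S1. Qed.

Lemma eps_comp_S g z : z \in S -> eps_comp g z \in S.
Proof.
move: z; apply: S_ind => [z t _ _ Hz Ht||h z zh zS]; first by rewrite linearD memvD.
  by rewrite linear0 mem0v.
by rewrite (eps_comp_hom _ zh) S_proj // eps1_S.
Qed.

(** [eps1] commutes with brackets by elements of [S]; comparing degrees, so does each of its
    components. *)
Lemma eps_comp_abr g z t : z \in S -> t \in S -> eps_comp g (abr z t) = abr (eps_comp g z) t.
Proof.
move=> zS tS; move: z zS; apply: S_ind => [z z' _ _ Hz Hz'||h z zh zS].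
- by rewrite abrDl linearD [eps_comp g (z + z')]linearD /= abrDl Hz Hz'.
- by rewrite !(abr0l, linear0).
move: t tS; apply: S_ind => [z1 z2 _ _ H1 H2||k t tk tS].
- by rewrite abrDr linearD /= abrDr H1 H2.
- by rewrite !(abr0r, linear0).
rewrite (eps_comp_hom _ zh) (eps_comp_hom _ (Gamma_abr zh tk)).
have -> : eps1 (abr z t) = abr (eps1 z) t.
  case/mem_skew_sum: zS => x [y [sx sy ->]]; case/mem_skew_sum: tS => x' [y' [sx' sy' ->]].
  rewrite abr_j !eps1_j //; last exact: cbr_skew.
  by rewrite abrDr abr_j1 abr_j12 addr0.
rewrite addrAC; apply: (proj_shift (phi := fun w => abr w t)).
- by move=> a w wa; apply: Gamma_abr.
- by move=> *; rewrite abrDl.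
- exact: abr0l.
Qed.

(** The map preserves each copy of C_0, because an element of [S] whose bracket with one copy
    vanishes lies in the other. On one copy, the image of [u] commutes with [u], hence is a multiple
    of it, and the eigenvectors [u_ i], [v_ i] of the bracket with [u] are then multiplied by the
    same scalar. *)
Lemma eps_comp_scalar g : exists a b : F, forall x y, skewc x -> skewc y ->
  eps_comp g (j1 F x + j2 F y) = a *: j1 F x + b *: j2 F y.
Proof.
pose E := eps_comp g; pose u := e1 F - e2 F; have su : skewc u := skew_u.
have f0 : (4 : F) != 0 by rewrite (_ : 4 = 2 * 2) ?mulf_neq0 // -natrM.
have nu : cnorm u = -1 by have [_ []] := std_triple F.
have line x : skewc x -> cbr x u = 0 -> exists k : F, x = k *: u.
  move=> sx H; have := cbr_cbr su sx; rewrite (cbrC x) H // oppr0 /cbr mulc0r mulc0l subrr.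
  rewrite -/u nu mulrN1 opprK => /esym/eqP; rewrite addr_eq0 => /eqP Ex.
  exists (4^-1 * - (2 * cbil u x)); apply: (scalerI f0).
  by rewrite Ex scalerA mulrA mulfV // mul1r scaleNr.
have ES z : z \in S -> exists x y, [/\ skewc x, skewc y & E z = j1 F x + j2 F y].
  by move=> zS; apply/mem_skew_sum/eps_comp_S.
have scalar (M : C -> C) : (forall x, skewc x -> skewc (M x)) ->
    (forall x y, M (x + y) = M x + M y) -> (forall (k : F) x, M (k *: x) = k *: M x) ->
    (forall x y, skewc x -> skewc y -> M (cbr x y) = cbr (M x) y) ->
    exists a : F, forall x, skewc x -> M x = a *: x.
  move=> MS MD MZ MB; have [|a aE] := line (M u) (MS u su).
    by rewrite -MB // cbrxx -(scale0r 0) MZ !scale0r.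
  exists a => x sx; rewrite (skew_decomp sx).
  have Mu i : M (u_ F i) = a *: u_ F i.
    have H : cbr u (u_ F i) = 2 *: u_ F i.
      by rewrite /cbr /u mulcBl mulcBr !basis_mul /= subr0 sub0r opprK scaler_nat.
    apply: (scalerI two_neq0); rewrite -MZ -H (MB _ _ su (skew_basis (c := U i) isT isT)) aE cbrZl H.
    by rewrite !scalerA mulrC.
  have Mv i : M (v_ F i) = a *: v_ F i.
    have H : cbr u (v_ F i) = - 2 *: v_ F i.
      by rewrite /cbr /u mulcBl mulcBr !basis_mul /= subr0 sub0r -opprD scaleNr scaler_nat.
    have n2 : - (2 : F) != 0 by rewrite oppr_eq0.
    apply: (scalerI n2); rewrite -MZ -H (MB _ _ su (skew_basis (c := V i) isT isT)) aE cbrZl H.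
    by rewrite !scalerA mulrC.
  have WD x1 x2 : M x1 = a *: x1 -> M x2 = a *: x2 -> M (x1 + x2) = a *: (x1 + x2).
    by move=> H1 H2; rewrite MD H1 H2 scalerDr.
  have WZ (k : F) x1 : M x1 = a *: x1 -> M (k *: x1) = a *: (k *: x1).
    by move=> H1; rewrite MZ H1 !scalerA mulrC.
  by do !apply: (WD); apply: WZ.
have H1 : exists a : F, forall x, skewc x -> E (j1 F x) = a *: j1 F x.
  have Ex x : skewc x -> E (j1 F x) = j1 F (q1 (E (j1 F x))) /\ skewc (q1 (E (j1 F x))).
    move=> sx; have [x1 [y1 [sx1 sy1 xE]]] := ES _ (mem_S1 sx).
    rewrite xE q1_j //; split=> //.
    suff -> : y1 = 0 by rewrite j20 addr0.
    apply: cbr_center => // y sy; apply: j2_inj; rewrite j20 -abr_j2.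
    have := eps_comp_abr g (mem_S1 sx) (mem_S2 sy).
    by rewrite abr_j12 linear0 -/E xE abrDl abr_j12 add0r => <-.
  have [|||x y sx sy|a aE] := scalar (fun x => q1 (E (j1 F x))).
  - by move=> x /Ex[].
  - by move=> x y; rewrite j1D !linearD.
  - by move=> k x; rewrite j1Z !linearZ.
  - apply: j1_inj; rewrite -(Ex _ (cbr_skew x y)).1 -abr_j1 -abr_j1 -(Ex _ sx).1.
    by rewrite -eps_comp_abr ?mem_S1.
  by exists a => x sx; rewrite (Ex x sx).1 aE // j1Z.
have H2 : exists a : F, forall x, skewc x -> E (j2 F x) = a *: j2 F x.
  have Ex x : skewc x -> E (j2 F x) = j2 F (q2 (E (j2 F x))) /\ skewc (q2 (E (j2 F x))).
    move=> sx; have [x1 [y1 [sx1 sy1 xE]]] := ES _ (mem_S2 sx).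
    rewrite xE q2_j //; split=> //.
    suff -> : x1 = 0 by rewrite j10 add0r.
    apply: cbr_center => // y sy; apply: j1_inj; rewrite j10 -abr_j1.
    have := eps_comp_abr g (mem_S2 sx) (mem_S1 sy).
    by rewrite abr_j21 linear0 -/E xE abrDl abr_j21 addr0 => <-.
  have [|||x y sx sy|a aE] := scalar (fun x => q2 (E (j2 F x))).
  - by move=> x /Ex[].
  - by move=> x y; rewrite j2D !linearD.
  - by move=> k x; rewrite j2Z !linearZ.
  - apply: j2_inj; rewrite -(Ex _ (cbr_skew x y)).1 -abr_j2 -abr_j2 -(Ex _ sx).1.
    by rewrite -eps_comp_abr ?mem_S2.
  by exists a => x sx; rewrite (Ex x sx).1 aE // j2Z.
have [a aE] := H1; have [b bE] := H2; exists a, b => x y sx sy.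
by rewrite linearD /= -/E aE // bE.
Qed.

(* Either the two copies of C are graded, or the involution exchanging the   *)
(* eigenspaces of [eps1] shifts degrees by an element of order two.          *)
Lemma split_or_twisted :
  (forall g z, z \in S -> z \in Gamma g -> eps1 z \in Gamma g) \/
  exists h, [/\ h != 0, h + h = 0 & forall g x y, skewc x -> skewc y ->
    j1 F x + j2 F y \in Gamma g -> j1 F x - j2 F y \in Gamma (g + h)].
Proof.
have [ab abE] := choice eps_comp_scalar.
have {ab abE} [a [b E]] : exists a b : G -> F, forall g x y, skewc x -> skewc y ->
    eps_comp g (j1 F x + j2 F y) = a g *: j1 F x + b g *: j2 F y.
  have /choice[a aE] : forall g, exists a : F, exists b : F, forall x y, skewc x -> skewc y ->
    eps_comp g (j1 F x + j2 F y) = a *: j1 F x + b *: j2 F y by exact: eps_comp_scalar.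
  have /choice[b bE] := aE; by exists a, b.
pose u := e1 F - e2 F; have su : skewc u := skew_u.
have u0 : u != 0.
  apply/eqP => E0; have [_ [nu _ _]] := std_triple F.
  by move: nu; rewrite -/u E0 -(scale0r 0) cnormZ expr0n mul0r => /esym/eqP; rewrite oppr_eq0 oner_eq0.
have Eg1 g : eps_comp g (j1 F u) = a g *: j1 F u.
  by have := E g u 0 su skewc0; rewrite j20 addr0 scaler0 addr0.
have Eg2 g : eps_comp g (j2 F u) = b g *: j2 F u.
  by have := E g 0 u skewc0 su; rewrite j10 add0r scaler0 add0r.
have j1u : j1 F u != 0 by apply: contraNneq u0 => H; apply/eqP/j1_inj; rewrite H j10.
have j2u : j2 F u != 0 by apply: contraNneq u0 => H; apply/eqP/j2_inj; rewrite H j20.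
(* Otherwise all components of [eps1], and so [eps1] itself, would act on [S] by a scalar, although
   it fixes the first copy and kills the second. *)
have [g abg] : exists g, a g != b g.
  apply: contrapT => H.
  have ab g : a g = b g by apply/eqP; apply: contra_notT H => ?; exists g.
  have H0 z : z \in S -> eps1 z = a 0 *: z.
    move: z; apply: S_ind => [z t _ _ Hz Ht||h z zh zS].
    - by rewrite linearD /= Hz Ht scalerDr.
    - by rewrite linear0 scaler0.
    have Ez g : p (h + g) (eps1 z) = a g *: z.
      rewrite -(eps_comp_hom _ zh); case/mem_skew_sum: zS => x [y [sx sy ->]].
      by rewrite E // -ab scalerDr.
    rewrite -[eps1 z](proj_sum pP).
    have Hk k : p k (eps1 z) = if k == h then a 0 *: z else 0.
      have [->|kh] := eqVneq k h; first by rewrite -Ez addr0.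
      have := Ez (k - h); rewrite addrC subrK => Ek.
      by rewrite -(proj_id pP (proj_mem pP k _)) Ek linearZ /= (proj_neq pP zh kh) scaler0.
    under eq_bigr => k _ do rewrite Hk.
    have us : uniq s by case: pP.
    rewrite -big_mkcond /=; have [hs|hs] := boolP (h \in s); first by rewrite sum_pred1_seq.
    have -> : z = 0 by move: zh; rewrite (proj_supp pP hs) memv0 => /eqP.
    by rewrite scaler0 big1.
  have a0 : a 0 = 0.
    have := H0 _ (mem_S2 su); have := eps1_j 0 su; rewrite j10 add0r => -> /esym/eqP.
    by rewrite scaler_eq0 (negPf j2u) orbF => /eqP.
  have := H0 _ (mem_S1 su); have := eps1_j u skewc0; rewrite j20 addr0 => ->.
  by rewrite a0 scale0r => /eqP; rewrite (negPf j1u).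
have ab0 : a g - b g != 0 by rewrite subr_eq0.
have [g0|gN0] := eqVneq g 0; [left => h z zS zh|right].
  have : (a g - b g) *: eps1 z = eps_comp g z - b g *: z.
    case/mem_skew_sum: zS => x [y [sx sy ->]]; rewrite E // eps1_j // scalerDr scalerBl.
    by rewrite opprD addrACA subrr addr0.
  move=> Ez; rewrite -[eps1 z]scale1r -(mulVf ab0) -scalerA Ez memvZ // memvB ?memvZ //.
  by rewrite (eps_comp_hom _ zh) g0 addr0 (proj_mem pP).
(* The polynomial with roots [a g] and [b g]. On [z] homogeneous its terms shift the degree by [2g],
   [g] and [0]. *)
have quad z : z \in S ->
    eps_comp g (eps_comp g z) + (- (a g + b g)) *: eps_comp g z + (a g * b g) *: z = 0.
  case/mem_skew_sum => x [y [sx sy ->]]; rewrite E // linearD !linearZ /=.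
  have Ex : eps_comp g (j1 F x) = a g *: j1 F x.
    by have := E g x 0 sx skewc0; rewrite j20 addr0 scaler0 addr0.
  have Ey : eps_comp g (j2 F y) = b g *: j2 F y.
    by have := E g 0 y skewc0 sy; rewrite j10 add0r scaler0 add0r.
  rewrite Ex Ey; apply/ffunP => c; rewrite !ffunE /GRing.scale /=; ring.
have Edeg h z : z \in Gamma h -> eps_comp g z \in Gamma (h + g).
  by move=> zh; rewrite (eps_comp_hom _ zh) (proj_mem pP).
have neq h : h != h + g by rewrite -subr_eq0 opprD addrA subrr sub0r oppr_eq0.
have gg : g + g = 0.
  (* If [2g] is nonzero, the quadratic term is alone in its degree and vanishes, so both scalars are
     zero. *)
  apply/eqP; apply: contraT => gg.
  have EE0 z : z \in S -> eps_comp g (eps_comp g z) = 0.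
    move: z; apply: S_ind => [z t _ _ Hz Ht||h z zh zS].
    - by rewrite !linearD /= Hz Ht addr0.
    - by rewrite !linear0.
    have := congr1 (p (h + g + g)) (quad z zS); rewrite !linearD !linearZ linear0 /=.
    rewrite (proj_id pP (Edeg _ _ (Edeg _ _ zh))).
    rewrite (proj_neq pP (Edeg _ _ zh)) 1?eq_sym // scaler0 addr0.
    rewrite (proj_neq pP zh) ?scaler0 ?addr0 //.
    by rewrite -addrA -subr_eq0 addrAC subrr add0r.
  have := EE0 _ (mem_S1 su); have := EE0 _ (mem_S2 su).
  rewrite Eg1 Eg2 !linearZ /= Eg1 Eg2 => /eqP; rewrite !scaler_eq0 (negPf j2u) orbF orbb.
  move=> /eqP bg /eqP; rewrite !scaler_eq0 (negPf j1u) orbF orbb => /eqP ag.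
  by move: ab0; rewrite ag bg subrr eqxx.
(* Now the linear term is alone in its degree. Hence the scalars are opposite, and the component
   divided by [a g] is the required map. *)
have sum0 : a g + b g = 0.
  have E0 z : z \in S -> (a g + b g) *: eps_comp g z = 0.
    move: z; apply: S_ind => [z t _ _ Hz Ht||h z zh zS].
    - by rewrite linearD /= scalerDr Hz Ht addr0.
    - by rewrite linear0 scaler0.
    have := congr1 (p (h + g)) (quad z zS); rewrite !linearD !linearZ linear0 /=.
    rewrite (proj_id pP (Edeg _ _ zh)) (proj_neq pP (Edeg _ _ (Edeg _ _ zh))); last first.
      by rewrite -addrA gg addr0 eq_sym.
    rewrite (proj_neq pP zh) 1?eq_sym // scaler0 addr0 add0r scaleNr => /eqP.
    by rewrite oppr_eq0 => /eqP.
  have := E0 _ (mem_S1 su); have := E0 _ (mem_S2 su); rewrite Eg1 Eg2 => /eqP.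
  rewrite !scaler_eq0 (negPf j2u) orbF => /orP[/eqP//|/eqP bg] /eqP.
  rewrite !scaler_eq0 (negPf j1u) orbF => /orP[/eqP//|/eqP ag].
  by rewrite ag bg addr0.
exists g; split=> // h x y sx sy zh.
have bE : b g = - a g by apply/eqP; rewrite -addr_eq0 addrC sum0.
have a0 : a g != 0 by apply: contraNneq ab0 => H; rewrite bE H oppr0 subrr.
have := Edeg _ _ zh; rewrite E // bE scaleNr -scalerBr => /(memvZ (a g)^-1).
by rewrite scalerA mulVf // scale1r.
Qed.

End WithGrading.
End SkewPart.


(** * Existence of the six gradings *)

Section BasisGradings.
Variables (F : fieldType) (V : vectType F) (m : {bilinear V -> V -> V}).
Variables (I : finType) (b : I -> V) (G : zmodType) (deg : I -> G).
Hypothesis (cardI : #|I| = dim V) (bspan : forall x, x \in (\sum_i <[b i]>)%VS).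

Definition basis_grading (g : G) : {vspace V} := (\sum_(i | deg i == g) <[b i]>)%VS.

Lemma basis_grading_mem i : b i \in basis_grading (deg i).
Proof. by apply: (subvP (sumv_sup i _ (subvv _))); rewrite ?eqxx ?memv_line. Qed.

Lemma basis_projections : exists s p, projections basis_grading s p.
Proof.
have defV : fullv = (\sum_i <[b i]>)%VS.
  by apply/eqP; rewrite eqEsubv subvf andbT; apply/subvP => x _.
have dirV : directv (\sum_i <[b i]>)%VS.
  rewrite directvE /= eqn_leq; apply/andP; split; first exact: dimv_leq_sum.
  rewrite -defV dimvf -cardI -sum1_card; apply: leq_sum => i _.
  by rewrite dim_vline; case: (b i != 0).
pose e i : 'End(V) := sumv_pi_for defV i.
have eb i x : e i x \in <[b i]>%VS by exact: memv_sum_pi.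
have es x : \sum_i e i x = x by apply: sumv_pi_sum; rewrite memvf.
have ej i j x : x \in <[b j]>%VS -> e i x = if i == j then x else 0.
  move=> xj; have := directv_sum_unique dirV (e^~ x) (fun k => if k == j then x else 0).
  rewrite es -big_mkcond big_pred1_eq eqxx => H.
  have := H (fun k _ => eb k x) => /(_ _)/esym/forall_inP/(_ i isT)/eqP; apply.
  by move=> k _; case: eqP => [->//|_]; rewrite mem0v.
pose p g : 'End(V) := \sum_(i | deg i == g) e i.
have pE g x : p g x = \sum_(i | deg i == g) e i x by rewrite sum_lfunE.
exists (undup [seq deg i | i <- enum I]), p; split=> [|g x|x|g h x xh].
- exact: undup_uniq.
- by rewrite pE; apply: memv_sumr.
- under eq_bigr => g _ do rewrite pE.
  rewrite (exchange_big_dep xpredT) //= -[RHS]es; apply: eq_bigr => i _.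
  under eq_bigl => g do rewrite eq_sym.
  by rewrite sum_pred1_seq ?undup_uniq // mem_undup map_f ?mem_enum.
- have /subvP/(_ x xh)/eqlfunP -> : (basis_grading h
      <= lker (p g - if g == h then \1%VF else 0%R))%VS.
    apply/subv_sumP => i /eqP ih; apply/subvP => y yi; apply/eqlfunP.
    rewrite pE; under eq_bigr => k _ do rewrite (ej _ _ _ yi).
    case: eqP => [->|/eqP gh].
      rewrite id_lfunE (bigD1 i) ?ih //= eqxx big1 ?addr0 // => k /andP[_ /negPf -> //].
    rewrite lfunE big1 // => k /eqP kg; case: eqP => // ki.
    by move: gh; rewrite -kg -ih ki eqxx.
  by case: ifP; rewrite ?id_lfunE ?lfunE.
Qed.

Lemma basis_is_grading :
  (forall i j, m (b i) (b j) \in basis_grading (deg i + deg j)) ->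
  is_grading m basis_grading.
Proof.
move=> bM; apply/is_gradingP; split; first exact: basis_projections.
move=> g h x y /memv_sumP[xs xsP ->] /memv_sumP[ys ysP ->].
rewrite linear_sumlz rpred_sum //= => i ig; have /vlineP[k ->] := xsP i ig.
rewrite linear_sumr rpred_sum //= => j jh; have /vlineP[l ->] := ysP j jh.
by rewrite linearZl_LR linearZr_LR !memvZ //= -(eqP ig) -(eqP jh) bM.
Qed.

End BasisGradings.

Section CayleyGradings.
Variable F : fieldType.
Local Notation C := (cayley F).
Local Notation "1c" := (cayley_one F).
Local Notation bv := (@basis_vector F cayley_index : cayley_index -> C).

Definition cartan_degree (c : cayley_index) : int * int :=
  match c with
  | E1 | E2 => (0, 0)
  | U i => if i == 1 then (1, 0) else if i == 2 then (0, 1) else (-1, -1)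
  | V i => if i == 1 then (-1, 0) else if i == 2 then (0, -1) else (1, 1)
  end.

Lemma cartan_gradingE :
  cartan_grading F =1 basis_grading bv cartan_degree.
Proof.
have three : (3 : 'Z_3) = 0 by apply: val_inj.
have M c g : cartan_degree c = g ->
    basis_vector F c \in basis_grading bv cartan_degree g.
  by move=> <-; apply: basis_grading_mem.
move=> g; apply/eqP; rewrite eqEsubv; apply/andP; split.
  rewrite /cartan_grading three; case: eqP => [->|_].
    apply/span_subvP => x; rewrite !inE => /orP[] /eqP ->; exact: M.
  do 6![case: eqP => [->|_]; first by rewrite -memvE; apply: M].
  exact: sub0v.
apply/subv_sumP => c /eqP <-; rewrite -memvE.
by move: c; apply: cayley_index_ind'; rewrite /cartan_grading /= ?three ?memv_line //;
  apply: memv_span; rewrite !inE eqxx ?orbT.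
Qed.

Lemma cayley_spanned (x : C) : x \in (\sum_c <[basis_vector F c]>)%VS.
Proof.
by rewrite (free_space_sum x); apply: memv_sumr => c _; rewrite memvZ // memv_line.
Qed.

Lemma cartan_is_grading : is_grading (cayley_mul F) (cartan_grading F).
Proof.
suff H : is_grading (cayley_mul F) (basis_grading bv cartan_degree).
  by rewrite (_ : cartan_grading F = basis_grading bv cartan_degree) //;
    apply/funext => g; apply: cartan_gradingE.
apply: basis_is_grading => [||i j]; first by rewrite dim_cayley -sum1_card sum_cayley.
  exact: cayley_spanned.
rewrite -[cayley_mul F _ _]/(basis_vector F i ** basis_vector F j) basis_mul.
have M c g : cartan_degree c = g ->
    basis_vector F c \in basis_grading bv cartan_degree g.
  by move=> <-; apply: basis_grading_mem.
by move: i j; do 2!apply: cayley_index_ind'; rewrite /= ?mem0v ?memvN //; apply: M.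
Qed.

Hypothesis two_neq0 : (2 : F) != 0.

Lemma z2cube_is_grading : is_grading (cayley_mul F) (z2cube_grading F).
Proof.
have E : z2cube_grading F = basis_grading (std_basis F) id.
  apply/funext => g; rewrite z2cube_gradingE /basis_grading big_pred1_eq //.
rewrite E; apply: basis_is_grading => [|x|i j].
- by rewrite dim_cayley !card_prod !card_ord.
- move: x; apply: (std_basis_ind two_neq0) => [k x y Hx Hy|g].
    by rewrite memvD // memvZ.
  by apply: (subvP (sumv_sup g _ (subvv _))); rewrite ?memv_line.
- rewrite -[cayley_mul F _ _]/(std_basis F i ** std_basis F j) std_basis_mul.
  by rewrite memvZ // basis_grading_mem.
Qed.

Lemma tensor_space_ind (U W : {vspace C}) (P : cayley2 F -> Prop) :
  (forall (k : F) z t, P z -> P t -> P (k *: z + t)) -> P 0 ->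
  (forall x y, x \in U -> y \in W -> P (x *t y)) ->
  forall z, z \in tensor_space U W -> P z.
Proof.
move=> PL P0 PT z zUW.
rewrite (coord_span (zUW : z \in <<in_tuple [seq x *t y | x <- vbasis U, y <- vbasis W]>>%VS)).
elim/big_ind: _ => // [w t Pw Pt|i _].
  by rewrite -[w]scale1r; apply: PL.
rewrite -[X in P X]addr0; apply: PL => //.
have /allpairsP[[x y] /= [xU yW ->]] :
    [seq x *t y | x <- vbasis U, y <- vbasis W]`_i
    \in [seq x *t y | x <- vbasis U, y <- vbasis W] by apply: mem_nth.
by apply: PT; apply: vbasis_mem.
Qed.

Lemma tensor_is_grading (G H : zmodType) (Gamma : G -> {vspace C})
    (Delta : H -> {vspace C}) :
  is_grading (cayley_mul F) Gamma -> is_grading (cayley_mul F) Delta ->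
  is_grading (cayley2_mul F) (tensor_grading Gamma Delta).
Proof.
move=> /is_gradingP[[s [p pP]] mG] /is_gradingP[[t [q qP]] mD].
have us : uniq s by case: pP.
have ut : uniq t by case: qP.
have mem g h x y : x \in Gamma g -> y \in Delta h ->
    x *t y \in tensor_grading Gamma Delta (g, h) by exact: mem_tensor_space.
apply/is_gradingP; split.
  exists [seq (g, h) | g <- s, h <- t], (fun d => tmap (p d.1) (q d.2)).
  split=> [|d z|z|d d' z zd].
  - by apply: allpairs_uniq => // -[a b] [a' b'].
  - move: z; apply: tensor_ind => [k z w Hz Hw||x y].
    + by rewrite linearP /= memvD // memvZ.
    + by rewrite linear0 mem0v.
    + by rewrite tmapE; case: d => g h; apply: mem; [apply: (proj_mem pP)|apply: (proj_mem qP)].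
  - move: z; apply: tensor_ind => [k z w Hz Hw||x y].
    + under eq_bigr => d _ do rewrite linearP /=.
      by rewrite big_split /= -scaler_sumr Hz Hw.
    + by rewrite big1 // => d _; rewrite linear0.
    + under eq_bigr => d _ do rewrite tmapE.
      rewrite big_allpairs /= -[in RHS](proj_sum pP x) (linear_sumlz (@tensor F _ _)) /=.
      apply: eq_bigr => g _; rewrite -[in RHS](proj_sum qP y).
      by rewrite (linear_sumr (@tensor F _ _)).
  - have /subvP/(_ z zd)/eqlfunP -> : (tensor_grading Gamma Delta d'
        <= lker (tmap (p d.1) (q d.2) - if d == d' then \1%VF else 0%R))%VS.
      apply: tensor_space_subP => x y xd yd; apply/eqlfunP; rewrite tmapE.
      case: d d' xd yd {zd} => g h [g' h'] /= xd yd; rewrite xpair_eqE.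
      have [->|gg] := eqVneq g g'; last by rewrite (proj_neq pP xd gg) tensor0l lfunE.
      have [->|hh] := eqVneq h h'; last by rewrite (proj_neq qP yd hh) tensor0r lfunE.
      by rewrite (proj_id pP xd) (proj_id qP yd) id_lfunE.
    by case: ifP; rewrite ?id_lfunE ?lfunE.
move=> [g h] [g' h'] z w zd wd; move: z zd; apply: tensor_space_ind.
- by move=> k z z' Hz Hz'; rewrite linearPl /= memvD // memvZ.
- by rewrite linear0l mem0v.
move=> x y xg yh; move: w wd; apply: tensor_space_ind.
- by move=> k w w' Hw Hw'; rewrite linearPr /= memvD // memvZ.
- by rewrite linear0r mem0v.
move=> x' y' xg' yh'; rewrite -[cayley2_mul F _ _]/(_ *** _) tensor_mul.
by apply: mem; [apply: mG|apply: mD].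
Qed.

End CayleyGradings.


(** * Twisted gradings as eigenspaces of a twisted exchange of factors *)

(** An extension [E] of [K] by [{0, eps}], with a character [chi] equal to [-1] at [eps]; [lift] is
    merely a section of sets. The extension splits for gradings 4 and 5, and involves [Z/4] over
    [Z/2] for grading 6. *)
Record twist_data (F : fieldType) (K E : zmodType) (bar : {additive E -> K})
    (lift : K -> E) (chi : E -> F) (eps : E) : Prop := TwistData {
  twist_lift : forall k, bar (lift k) = k;
  twist_chiD : forall d e, chi (d + e) = chi d * chi e;
  twist_chi_eps : chi eps = -1;
  twist_eps2 : eps + eps = 0;
  twist_bar_eps : bar eps = 0;
  twist_ker : forall d, bar d = 0 -> d = 0 \/ d = eps
}.

Section TwistedGrading.
Variable F : closedFieldType.
Local Notation C := (cayley F).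
Local Notation A := (cayley2 F).
Local Notation "1c" := (cayley_one F).
Local Notation S := (skew_sum F).
Hypothesis two_neq0 : (2 : F) != 0.
Variables (K : zmodType) (D : K -> {vspace C}) (s : seq K) (p : K -> 'End(C)).
Hypotheses (DP : is_grading (cayley_mul F) D) (pP : projections D s p).
Variables (E : zmodType) (bar : {additive E -> K}) (lift : K -> E) (chi : E -> F) (eps : E).
Hypothesis tP : twist_data bar lift chi eps.
Implicit Types (x y : C) (z t : A) (k l : K) (d : E).

Lemma chi0 : chi 0 = 1.
Proof.
have := twist_chiD tP 0 eps; rewrite add0r (twist_chi_eps tP) mulrN1 => /eqP.
by rewrite eqr_opp eq_sym => /eqP.
Qed.

Lemma chi_neq0 d : chi d != 0.
Proof.
have := oner_neq0 F; rewrite -chi0 -(subrr d) (twist_chiD tP).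
by apply: contraNneq => ->; rewrite mul0r.
Qed.

Lemma bar_eq d e : bar d = bar e -> d = e \/ d = e + eps.
Proof.
move=> de; have [H|H] : d - e = 0 \/ d - e = eps.
- by apply: (twist_ker tP); rewrite raddfB /= de subrr.
- by left; apply/subr0_eq.
- by right; rewrite addrC -H subrK.
Qed.

Lemma chi_sqr d e : bar d = bar e -> chi d ^+ 2 = chi e ^+ 2.
Proof.
by move=> /bar_eq[->//|->]; rewrite (twist_chiD tP) (twist_chi_eps tP) mulrN1 sqrrN.
Qed.

Lemma chi_add_eps d : chi (d + eps) = - chi d.
Proof. by rewrite (twist_chiD tP) (twist_chi_eps tP) mulrN1. Qed.

(** The square of [chi] does not see [eps], so it descends to a character of [K]. *)
Definition eta k := chi (lift k) ^+ 2.

Lemma eta_bar d : eta (bar d) = chi d ^+ 2.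
Proof. by apply: chi_sqr; rewrite (twist_lift tP). Qed.

Lemma etaD k l : eta (k + l) = eta k * eta l.
Proof.
rewrite -{1}(twist_lift tP k) -{1}(twist_lift tP l) -raddfD eta_bar.
by rewrite (twist_chiD tP) exprMn.
Qed.

Definition eta_scale : 'End(C) := \sum_(k <- s) eta k *: p k.

Lemma eta_scaleE k x : x \in D k -> eta_scale x = eta k *: x.
Proof.
move=> xk; have us : uniq s by case: pP.
rewrite sum_lfunE; under eq_bigr => l _ do rewrite scale_lfunE.
have [ks|ks] := boolP (k \in s); last first.
  have -> : x = 0 by move: xk; rewrite (proj_supp pP ks) memv0 => /eqP.
  by rewrite scaler0 big1 // => l _; rewrite linear0 scaler0.
rewrite (bigD1_seq k) //= (proj_id pP xk) big1 ?addr0 // => l lk.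
by rewrite (proj_neq pP xk lk) scaler0.
Qed.

Lemma eta_scaleM x y : eta_scale (x ** y) = eta_scale x ** eta_scale y.
Proof.
move: x; apply: (homogeneous_ind pP) => [x x' Hx Hx'||k x xk].
- by rewrite mulcDl !linearD /= Hx Hx' mulcDl.
- by rewrite mulc0l !linear0 mulc0l.
move: y; apply: (homogeneous_ind pP) => [y y' Hy Hy'||l y yl].
- by rewrite mulcDr !linearD /= Hy Hy' mulcDr.
- by rewrite mulc0r !linear0 mulc0r.
rewrite (eta_scaleE (D_mul DP xk yl)) (eta_scaleE xk) (eta_scaleE yl).
by rewrite mulcZl mulcZr scalerA etaD.
Qed.

Lemma eta_scale1 : eta_scale 1c = 1c.
Proof.
rewrite (eta_scaleE (D_one DP)) (_ : eta 0 = 1) ?scale1r //.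
by rewrite -(raddf0 bar) eta_bar chi0 expr1n.
Qed.

(** An automorphism whose square acts on total degree [k] as [eta k]. Its possible eigenvalues there
    are the values of [chi] at the two lifts of [k], so its eigenspaces refine the total grading to
    a grading by [E]. *)
Definition twist_swap : 'End(A) := (swap F \o tmap eta_scale \1)%VF.

Lemma twist_swapE x y : twist_swap (x *t y) = y *t eta_scale x.
Proof. by rewrite comp_lfunE tmapE swapE id_lfunE. Qed.

Lemma twist_swapM z t : twist_swap (z *** t) = twist_swap z *** twist_swap t.
Proof.
move: z t; apply: alg_hom_of_tensor => x y x' y'.
by rewrite !twist_swapE tensor_mul eta_scaleM.
Qed.

Lemma twist_swap_j x y : twist_swap (j1 F x + j2 F y) = j1 F y + j2 F (eta_scale x).
Proof.
by rewrite linearD /= !j1E !j2E !twist_swapE eta_scale1 addrC.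
Qed.

Let T := tensor_grading D D.
Let addK (kl : K * K) : K := kl.1 + kl.2.

Section Total.
Variables (sT : seq (K * K)) (pT : K * K -> 'End(A)).
Hypothesis pTP : projections T sT pT.

Definition total : K -> {vspace A} := coarsening sT addK T.

Lemma total_projections :
  projections total (undup (map addK sT)) (coarse_proj sT pT addK).
Proof. exact: coarsening_projections. Qed.

Lemma total_mul : graded_mul (cayley2_mul F) total.
Proof.
apply: (coarsening_multiplicative pTP) => [|g h x y _ _ _].
  exact: (grading_mul (tensor_is_grading DP DP)).
by rewrite /addK /= addrACA.
Qed.

Lemma mem_total k l x y : x \in D k -> y \in D l -> x *t y \in total (k + l).
Proof.
move=> xk yl; apply: (mem_coarsening addK pTP (g := (k, l))).
exact: mem_tensor_space.
Qed.

Lemma total_ind k (P : A -> Prop) :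
  (forall (c : F) z t, P z -> P t -> P (c *: z + t)) -> P 0 ->
  (forall l l' x y, l + l' = k -> x \in D l -> y \in D l' -> P (x *t y)) ->
  forall z, z \in total k -> P z.
Proof.
move=> PL P0 PT z zk; rewrite -(proj_id total_projections zk) coarse_projE.
elim/big_rec: _ => // -[l l'] t /eqP lk Pt; rewrite -[pT _ z]scale1r; apply: (PL) => //.
have := proj_mem pTP (l, l') z; move: (pT _ z).
apply: tensor_space_ind => // x y xl yl'; apply: PT lk xl yl'.
Qed.

Lemma twist_swap_total k z : z \in total k -> twist_swap z \in total k.
Proof.
move: z; apply: total_ind => [c z t Hz Ht||l l' x y <- xl yl'].
- by rewrite linearP memvD // memvZ.
- by rewrite linear0 mem0v.
by rewrite twist_swapE (eta_scaleE xl) addrC mem_total // memvZ.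
Qed.

Lemma twist_swap_swap k z : z \in total k -> twist_swap (twist_swap z) = eta k *: z.
Proof.
move: z; apply: total_ind => [c z t Hz Ht||l l' x y <- xl yl'].
- by rewrite linearP /= linearP /= Hz Ht scalerDr !scalerA mulrC.
- by rewrite !linear0.
rewrite !twist_swapE (eta_scaleE xl) (eta_scaleE yl') tensorZl tensorZr scalerA.
by rewrite etaD.
Qed.

Definition twisted_grading d : {vspace A} :=
  (total (bar d) :&: lker (twist_swap - chi d *: \1%VF))%VS.

Lemma mem_twisted d z :
  z \in twisted_grading d <-> z \in total (bar d) /\ twist_swap z = chi d *: z.
Proof.
rewrite memv_cap memv_ker add_lfunE opp_lfunE scale_lfunE id_lfunE subr_eq0.
by split=> [/andP[-> /eqP ->]|[-> ->]]; rewrite ?eqxx.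
Qed.

Let pi k := coarse_proj sT pT addK k.

Definition twisted_proj d : 'End(A) :=
  2^-1 *: (pi (bar d) + (chi d)^-1 *: (twist_swap \o pi (bar d)))%VF.

Lemma twisted_projE d z : twisted_proj d z =
  2^-1 *: (pi (bar d) z + (chi d)^-1 *: twist_swap (pi (bar d) z)).
Proof. by rewrite !lfun_simp. Qed.

Lemma twisted_is_grading : is_grading (cayley2_mul F) twisted_grading.
Proof.
have [us piM piS piE] := total_projections; set s' := undup _ in us piS.
have two (W : lmodType F) (w : W) : 2^-1 *: (w + w) = w.
  by rewrite -mulr2n -scaler_nat scalerA mulVf ?scale1r.
have eps0 : eps != 0.
  apply: contraNneq two_neq0 => e0; have := twist_chi_eps tP.
  by rewrite e0 chi0 => H; rewrite -[2]/(1 + 1) {1}H addNr.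
apply/is_gradingP; split; last first.
  move=> d e z t /mem_twisted[zd zE] /mem_twisted[te tE]; apply/mem_twisted; split.
    by rewrite raddfD total_mul.
  rewrite -[cayley2_mul F _ _]/(z *** t) twist_swapM zE tE amulZl amulZr scalerA.
  by rewrite (twist_chiD tP).
(* Every [k] has exactly two lifts, which differ by [eps]. *)
exists ([seq lift k | k <- s'] ++ [seq lift k + eps | k <- s']), twisted_proj; split.
- have liftI : injective lift by exact: can_inj (twist_lift tP).
  have liftI' : injective (fun k => lift k + eps) by move=> k l /addIr/liftI.
  rewrite cat_uniq (map_inj_uniq liftI) (map_inj_uniq liftI').
  rewrite us andbT /=; apply/hasPn => _ /mapP[k ks ->]; apply/mapP => -[l ls kl].
  have := congr1 bar kl; rewrite raddfD /= !(twist_lift tP) (twist_bar_eps tP) addr0 => E0.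
  move: kl; rewrite E0 => /eqP; rewrite -subr_eq0 addrAC subrr add0r.
  by rewrite (negPf eps0).
- move=> d z; apply/mem_twisted; rewrite twisted_projE; split.
    by rewrite memvZ // memvD ?piM // memvZ // twist_swap_total ?piM.
  rewrite [RHS]scalerA mulrC -scalerA linearZ /=; congr (_ *: _).
  rewrite linearD /= linearZ /= (twist_swap_swap (piM _ _)) eta_bar scalerDr !scalerA.
  by rewrite expr2 mulrA mulVf ?mulfV ?chi_neq0 // mul1r scale1r addrC.
- move=> z; rewrite big_cat !big_map /= -big_split /= -[RHS]piS; apply: eq_bigr => k _.
  have bE : bar (lift k + eps) = k.
    by rewrite raddfD /= (twist_lift tP) (twist_bar_eps tP) addr0.
  rewrite (twisted_projE (lift k)) (twisted_projE (lift k + eps)) bE (twist_lift tP) chi_add_eps.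
  by rewrite -scalerDr addrACA invrN scaleNr subrr addr0 two.
- move=> d e z /mem_twisted[ze zE]; rewrite twisted_projE /pi (piE _ _ _ ze).
  have [bde|bde] := eqVneq (bar d) (bar e); last first.
    by rewrite linear0 scaler0 addr0 scaler0; case: eqP => // de; rewrite de eqxx in bde.
  rewrite zE scalerA; have [->|dNe] := eqVneq d e.
    by rewrite mulVf ?chi_neq0 // scale1r two.
  have [/eqP|->] := bar_eq bde; first by rewrite (negPf dNe).
  by rewrite chi_add_eps invrN mulNr mulVf ?chi_neq0 // scaleN1r subrr scaler0.
Qed.

Lemma total_q1 k z : z \in total k -> q1 F z \in D k.
Proof.
move: z; apply: total_ind => [c z t Hz Ht||l l' x y <- xl yl'].
- by rewrite linearP memvD // memvZ.
- by rewrite linear0 mem0v.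
rewrite q1E; have [->|l'0] := eqVneq l' 0; first by rewrite addr0 memvZ.
by rewrite (D_trace DP yl' l'0) mulr0 scale0r mem0v.
Qed.

(** On [j1 x + j2 y] the eigenvalue equation for [twist_swap] reads [y = chi d *: x]. *)
Lemma twisted_S d z : z \in (S :&: twisted_grading d)%VS <->
  exists x, [/\ x \in D (bar d), skewc x & z = j1 F x + chi d *: j2 F x].
Proof.
rewrite memv_cap; split=> [/andP[/mem_skew_sum[x [y [sx sy ->]]]]|[x [xd sx ->]]].
  move=> /mem_twisted[zd]; have xd : x \in D (bar d).
    by have := total_q1 zd; rewrite q1_j.
  rewrite twist_swap_j scalerDr -j1Z -j2Z (eta_scaleE xd).
  case/(j12_inj two_neq0); try exact: skewcZ; first by [].
  by move=> -> _; exists x; split=> //; rewrite j2Z.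
rewrite -j2Z; apply/andP; split; first exact: mem_S sx (skewcZ _ sx).
apply/mem_twisted; split.
  rewrite j1E j2E memvD //; first by rewrite -[bar d]addr0 mem_total // (D_one DP).
  by rewrite -[bar d]add0r mem_total ?(D_one DP) // memvZ.
by rewrite twist_swap_j (eta_scaleE xd) eta_bar scalerDr -j1Z -j2Z scalerA -expr2.
Qed.

Lemma mem_twisted_diag c (W : {vspace C}) z :
  z \in twisted_diag c W <-> exists2 x, x \in W & z = j1 F x + c *: j2 F x.
Proof.
pose f : 'Hom(C, A) := (j1 F + c *: j2 F)%VF.
have fE x : f x = j1 F x + c *: j2 F x by rewrite !lfun_simp.
have -> : twisted_diag c W = (f @: W)%VS.
  rewrite -[in RHS](span_basis (vbasisP W)) limg_span /twisted_diag.
  by congr <<_>>%VS; apply: eq_map => x; rewrite fE j1E j2E.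
split=> [/memv_imgP[x xW ->]|[x xW ->]]; first by exists x.
by rewrite -fE memv_img.
Qed.

(** For uniqueness, a grading that contains the given components contains all of [twisted_grading]
    by [S_generates], and [grading_eq] turns the inclusions into equalities. *)
Lemma twisted_generated (comp : E -> {vspace A}) :
  (forall d, exists2 W : {vspace C}, comp d = twisted_diag (chi d) W &
     forall x, x \in W <-> x \in D (bar d) /\ skewc x) ->
  is_grading_generated_by (cayley2_mul F) S comp twisted_grading.
Proof.
move=> compW; have tG := twisted_is_grading.
have Scomp d : (S :&: twisted_grading d)%VS = comp d.
  have [W -> WP] := compW d; apply/vspaceP => z; apply/idP/idP.
    by move=> /twisted_S[x [xd sx ->]]; apply/mem_twisted_diag; exists x => //; apply/WP.
  by move=> /mem_twisted_diag[x /WP[xd sx] ->]; apply/twisted_S; exists x.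
split=> // Delta DeltaP DeltaS; have [[t [q qP]] mG] := (is_gradingP _ _).1 tG.
apply: (grading_eq tG DeltaP) => d.
apply: (S_generates two_neq0 qP mG (psi := idfun)); first exact: grading_mul DeltaP.
by move=> e; rewrite Scomp; apply: DeltaS.
Qed.

End Total.
End TwistedGrading.


(** * The extensions and characters behind gradings 4, 5 and 6 *)

Lemma Z4_ind (P : 'Z_4 -> Prop) : P 0 -> P 1 -> P 2 -> P 3 -> forall k, P k.
Proof.
move=> P0 P1 P2 P3 [[|[|[|[|//]]]] k4].
- by move: P0; congr P; apply: val_inj.
- by move: P1; congr P; apply: val_inj.
- by move: P2; congr P; apply: val_inj.
- by move: P3; congr P; apply: val_inj.
Qed.

Definition mod2 (k : 'Z_4) : 'Z_2 := (k : nat)%:R.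

Lemma mod2_zmod_morphism : zmod_morphism mod2.
Proof. by do 2!apply: Z4_ind; apply: val_inj. Qed.

HB.instance Definition _ := GRing.isZmodMorphism.Build 'Z_4 'Z_2 mod2 mod2_zmod_morphism.

Definition bar6 (d : 'Z_4 * 'Z_2 * 'Z_2) : 'Z_2 * 'Z_2 * 'Z_2 := (mod2 d.1.1, d.1.2, d.2).

Lemma bar6_zmod_morphism : zmod_morphism bar6.
Proof. by move=> d e; rewrite /bar6 /= raddfB. Qed.

HB.instance Definition _ := GRing.isZmodMorphism.Build _ _ bar6 bar6_zmod_morphism.

Definition lift6 (g : 'Z_2 * 'Z_2 * 'Z_2) : 'Z_4 * 'Z_2 * 'Z_2 :=
  ((g.1.1 : nat)%:R, g.1.2, g.2).

Lemma expr_ord_add (F : fieldType) (n : nat) (x : F) (k l : 'Z_n.+2) : x ^+ n.+2 = 1 ->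
  x ^+ (k + l)%R = x ^+ k * x ^+ l.
Proof. by move=> xn; rewrite -exprD -[RHS](expr_mod _ xn). Qed.

Section Instances.
Variable F : closedFieldType.
Local Notation C := (cayley F).
Local Notation A := (cayley2 F).
Local Notation S := (skew_sum F).
Local Notation "1c" := (cayley_one F).

Lemma twist_data_Z2 (K : zmodType) :
  twist_data (@snd 'Z_2 K) (fun k => (0, k)) (fun d => (-1) ^+ d.1 : F) (1, 0).
Proof.
split=> //=.
- by move=> d e; apply: expr_ord_add; rewrite sqrrN expr1n.
- by congr pair; [apply: val_inj|rewrite addr0].
- move=> [k g] /= ->; move: k; apply: Z2_ind; [by left|by right].
Qed.

Lemma twist_data_Z4 (i : F) : i ^+ 2 = -1 ->
  twist_data bar6 lift6 (fun d => i ^+ d.1.1) (2, 0, 0).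
Proof.
move=> i2; split=> //=.
- move=> [[k n] p]; rewrite /bar6 /lift6 /=; congr (_, _, _).
  by move: k; apply: Z2_ind; apply: val_inj.
- by move=> d e; apply: expr_ord_add; rewrite (exprM _ 2 2) i2 sqrrN expr1n.
- by congr (_, _, _); apply: val_inj.
- by congr (_, _, _); apply: val_inj.
- move=> [[k n] p]; rewrite /bar6 => -[] /=; move: k.
  apply: Z4_ind => // _ -> ->; [by left|by right].
Qed.

Hypothesis two_neq0 : (2 : F) != 0.

(* The gradings whose components on [S] are the graphs, in C_0 + C_0, of the *)
(* homotheties of ratio [chi d] of the components [D (bar d)] of C_0.        *)
Definition twisted_by (K E : zmodType) (D : K -> {vspace C}) (bar : E -> K) (chi : E -> F)
    (Gamma : E -> {vspace A}) : Prop :=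
  is_grading (cayley2_mul F) Gamma /\
  forall d z, z \in (S :&: Gamma d)%VS <->
    exists x, [/\ x \in D (bar d), skewc x & z = j1 F x + chi d *: j2 F x].

Lemma twisted_by_exists (K E : zmodType) (D : K -> {vspace C}) (bar : {additive E -> K})
    (lift : K -> E) (chi : E -> F) (eps : E) (comp : E -> {vspace A}) :
  is_grading (cayley_mul F) D -> twist_data bar lift chi eps ->
  (forall d, exists2 W : {vspace C}, comp d = twisted_diag (chi d) W &
     forall x, x \in W <-> x \in D (bar d) /\ skewc x) ->
  exists2 Gamma, is_grading_generated_by (cayley2_mul F) S comp Gamma &
    twisted_by D bar chi Gamma.
Proof.
move=> DP tP compW; have [[s [p pP]] _] := (is_gradingP _ _).1 DP.
have [[sT [pT pTP]] _] := (is_gradingP _ _).1 (tensor_is_grading DP DP).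
exists (twisted_grading D s p bar lift chi sT).
  exact: (twisted_generated two_neq0 DP pP tP pTP).
split; first exact: (twisted_is_grading two_neq0 DP pP tP pTP).
by move=> d z; apply: (twisted_S two_neq0 DP pP tP pTP).
Qed.

Lemma mem_skew_cartan g x :
  x \in (if g == (0, 0) then <[e1 F - e2 F]>%VS else cartan_grading F g) <->
  x \in cartan_grading F g /\ skewc x.
Proof.
case: eqP => [->|/eqP g0]; last first.
  split=> [xg|[]//]; split=> //; exact: (D_trace (cartan_is_grading F) xg g0).
rewrite /cartan_grading eqxx; split=> [/vlineP[k ->]|[x0 sx]].
  split; last exact/skewcZ/skew_u.
  by rewrite memvZ // memvB // memv_span // !inE eqxx ?orbT.
move: x0; rewrite span_cons span_seq1 => /memv_addP[_ /vlineP[a ->] [_ /vlineP[b ->] xE]].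
move: sx; rewrite /skewc xE ctrE !addcE !scalecE /e1 /e2 !basisE /= !mulr1 !mulr0 addr0 add0r.
move=> /eqP; rewrite addrC addr_eq0 => /eqP ->.
by rewrite scaleNr -scalerBr memvZ ?memv_line.
Qed.

Lemma mem_skew_cube g x :
  x \in (if g == (0, 0, 0) then 0%VS else z2cube_grading F g) <->
  x \in z2cube_grading F g /\ skewc x.
Proof.
have cP := z2cube_is_grading two_neq0.
case: eqP => [->|/eqP g0]; last first.
  split=> [xg|[]//]; split=> //; exact: (D_trace cP xg g0).
rewrite memv0 z2cube_gradingE -/(std_basis F (0, 0, 0)) std_basisE -/1c; split=> [/eqP->|[/vlineP[k ->]]].
  by rewrite mem0v; split=> //; exact: skewc0.
rewrite /skewc ctrZ ctr1 => /eqP; rewrite mulf_eq0 (negPf two_neq0) orbF => /eqP ->.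
by rewrite scale0r.
Qed.

Lemma twisted_diag0 (c : F) : twisted_diag c 0%VS = 0%VS.
Proof.
apply/eqP; rewrite -subv0; apply/subvP => z /mem_twisted_diag[x]; rewrite memv0 => /eqP ->.
by move=> ->; rewrite !linear0 addr0 mem0v.
Qed.

Lemma grading4_exists : exists2 Gamma,
  is_grading_generated_by (cayley2_mul F) S (@components4 F) Gamma &
  twisted_by (@cartan_grading F) snd (fun d : 'Z_2 * (int * int) => (-1) ^+ d.1) Gamma.
Proof.
apply: (twisted_by_exists (cartan_is_grading F) (twist_data_Z2 _)) => -[k g].
eexists; first by rewrite /components4.
exact: mem_skew_cartan.
Qed.

Lemma grading5_exists : exists2 Gamma,
  is_grading_generated_by (cayley2_mul F) S (@components5 F) Gamma &
  twisted_by (@z2cube_grading F) snd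
    (fun d : 'Z_2 * ('Z_2 * 'Z_2 * 'Z_2) => (-1) ^+ d.1) Gamma.
Proof.
apply: (twisted_by_exists (z2cube_is_grading two_neq0) (twist_data_Z2 _)) => -[k g].
exists (if g == (0, 0, 0) then 0%VS else z2cube_grading F g); last exact: mem_skew_cube.
by rewrite /components5; case: ifP; rewrite ?twisted_diag0.
Qed.

Lemma grading6_exists (i : F) : i ^+ 2 = -1 -> exists2 Gamma,
  is_grading_generated_by (cayley2_mul F) S (components6 i) Gamma &
  twisted_by (@z2cube_grading F) bar6 (fun d : 'Z_4 * 'Z_2 * 'Z_2 => i ^+ d.1.1) Gamma.
Proof.
move=> i2.
apply: (twisted_by_exists (z2cube_is_grading two_neq0) (twist_data_Z4 i2)) => -[[k n] p].
exists (if bar6 (k, n, p) == (0, 0, 0) then 0%VS else z2cube_grading F (bar6 (k, n, p))).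
  by rewrite /components6 /bar6 /mod2 /=; case: ifP; rewrite ?twisted_diag0.
exact: mem_skew_cube.
Qed.

End Instances.


(** * Rigidity of the six gradings *)

Section AdditiveMaps.
Variable H : zmodType.

Lemma zmod_morphism_of_add (G : zmodType) (f : G -> H) :
  {morph f : x y / x + y} -> zmod_morphism f.
Proof. by move=> fD x y; rewrite -[in RHS](subrK y x) [in RHS]fD addrK. Qed.

Definition int_map (h : H) (k : int) : H := h *~ k.
Lemma int_map_zmod_morphism h : zmod_morphism (int_map h).
Proof. by apply: zmod_morphism_of_add => k l; apply: mulrzDr. Qed.
HB.instance Definition _ h :=
  GRing.isZmodMorphism.Build int H (int_map h) (int_map_zmod_morphism h).

Definition ord_map n (h : H) (hn : h *+ n.+2 = 0) (k : 'Z_n.+2) : H := h *+ k.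
Lemma ord_map_zmod_morphism n h (hn : h *+ n.+2 = 0) : zmod_morphism (ord_map hn).
Proof.
apply: zmod_morphism_of_add => k l; rewrite /ord_map -mulrnDr.
rewrite [in RHS](divn_eq (k + l) n.+2) mulrnDr mulnC mulrnA hn mul0rn add0r.
by [].
Qed.
HB.instance Definition _ n h hn :=
  GRing.isZmodMorphism.Build 'Z_n.+2 H (@ord_map n h hn) (ord_map_zmod_morphism hn).

Definition pair_map (G K : zmodType) (f : G -> H) (g : K -> H) (d : G * K) : H :=
  f d.1 + g d.2.
Lemma pair_map_zmod_morphism (G K : zmodType) (f : {additive G -> H}) (g : {additive K -> H}) :
  zmod_morphism (pair_map f g).
Proof. by move=> d e; rewrite /pair_map /= !raddfB opprD addrACA. Qed.
HB.instance Definition _ (G K : zmodType) (f : {additive G -> H}) (g : {additive K -> H}) :=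
  GRing.isZmodMorphism.Build (G * K)%type H (pair_map f g) (pair_map_zmod_morphism f g).

End AdditiveMaps.

Lemma z2cube_avoid (r : seq ('Z_2 * 'Z_2 * 'Z_2)) : (size r < 8)%N -> exists c, c \notin r.
Proof.
rewrite ltnNge => /negP r8; apply: contrapT => H; apply: r8.
have /subset_leq_card : predT \subset r.
  by apply/subsetP => c _; apply: contra_notT H => cr; exists c.
by move=> /leq_trans/(_ (card_size _)); rewrite !card_prod !card_ord.
Qed.

Lemma z2cube_double (a : 'Z_2 * 'Z_2 * 'Z_2) : a + a = 0.
Proof. by case: a => [[i j] k]; congr (_, _, _); move: i j k; do 3!apply: Z2_ind; apply: val_inj. Qed.

(* The extension maps [d] to [delta (d + e) - delta e], where [bar e] is *)
(* neither [0] nor [bar d].                                              *)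
Lemma partial_additive_extension (E H K : zmodType) (bar : {additive E -> K})
    (delta : E -> H) :
  (forall a : K, a + a = 0) ->
  (forall r : seq K, (size r < 8)%N -> exists c, c \notin r) ->
  (forall k, exists d, bar d = k) ->
  (forall d e, bar d != 0 -> bar e != 0 -> bar d != bar e -> delta (d + e) = delta d + delta e) ->
  exists psi : {additive E -> H}, forall d, bar d != 0 -> psi d = delta d.
Proof.
move=> K2 avoid surj dD.
have add_eq0 (a b : K) : (a + b == 0) = (a == b).
  by rewrite -(K2 b) (inj_eq (addIr b)).
have add_eq (a b c : K) : (a + b == c) = (b == a + c).
  by rewrite -(inj_eq (addrI a)) addrA K2 add0r.
have step d e e' : bar e != 0 -> bar e' != 0 -> bar e != bar d -> bar e' != bar d ->
    bar e != bar e' -> bar e' != bar d + bar e ->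
    delta (d + e) - delta e = delta (d + e') - delta e'.
  move=> e0 e'0 ed e'd ee' e'de.
  have E1 : delta (d + e + e') = delta (d + e) + delta e'.
    by apply: dD; rewrite // raddfD /= ?add_eq0 eq_sym.
  have E2 : delta (d + e' + e) = delta (d + e') + delta e.
    by apply: dD; rewrite // raddfD /= ?add_eq0 ?add_eq // eq_sym.
  by apply/eqP; rewrite subr_eq addrAC eq_sym subr_eq -E1 -E2 addrAC.
(* Two admissible elements [e] and [e'] are compared through a third one in general position with
   both; it has six values to avoid. *)
have indep d e e' : bar e != 0 -> bar e' != 0 -> bar e != bar d -> bar e' != bar d ->
    delta (d + e) - delta e = delta (d + e') - delta e'.
  move=> e0 e'0 ed e'd.
  have [c] := avoid [:: 0; bar d; bar e; bar d + bar e; bar e'; bar d + bar e'] isT.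
  have [e3 <-] := surj c; rewrite !inE !negb_or => /and5P[c0 cd ce cde /andP[ce' cde']].
  by rewrite (step d e e3) ?(step d e' e3) // eq_sym.
have /choice[c cP] : forall d, exists c, bar c != 0 /\ bar c != bar d.
  move=> d; have [c] := avoid [:: 0; bar d] isT.
  by have [e <-] := surj c; rewrite !inE negb_or => /andP[]; exists e.
pose psi d := delta (d + c d) - delta (c d).
have psiE d e : bar e != 0 -> bar e != bar d -> psi d = delta (d + e) - delta e.
  by move=> e0 ed; have [] := cP d; move=> *; apply: indep.
have psiD : {morph psi : d e / d + e}.
  move=> d d'; have [k] := avoid [:: 0; bar d; bar d'; bar d + bar d'] isT.
  have [e <-] := surj k; rewrite !inE !negb_or => /and4P[e0 ed ed' edd'].
  have de0 : bar (d' + e) != 0 by rewrite raddfD add_eq0 eq_sym.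
  have ded : bar (d' + e) != bar d by rewrite raddfD add_eq addrC.
  rewrite (psiE (d + d') e) ?raddfD // (psiE d' e) // (psiE d (d' + e)) //.
  by rewrite !addrA subrK.
pose psiM := GRing.isZmodMorphism.Build E H psi (zmod_morphism_of_add psiD).
exists (HB.pack_for {additive E -> H} psi psiM) => d d0 /=.
have [] := cP d => c0 cd; rewrite (psiE _ (c d)) // dD ?addrK //.
by rewrite eq_sym.
Qed.

(** * Homogeneous lines in refinements *)

Section Refinement.
Variable F : closedFieldType.
Local Notation C := (cayley F).
Local Notation A := (cayley2 F).
Local Notation "1c" := (cayley_one F).
Local Notation S := (skew_sum F).
Local Notation bv := (@basis_vector F cayley_index : cayley_index -> C).
Hypothesis two_neq0 : (2 : F) != 0.

Lemma tensor_S (G H : zmodType) (D1 : G -> {vspace C}) (D2 : H -> {vspace C}) g h x y :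
  is_grading (cayley_mul F) D1 -> is_grading (cayley_mul F) D2 -> skewc x -> skewc y ->
  j1 F x + j2 F y \in tensor_grading D1 D2 (g, h) ->
  [/\ x \in D1 g, y \in D2 h, h != 0 -> x = 0 & g != 0 -> y = 0].
Proof.
move=> D1P D2P sx sy zgh.
have H1 z : z \in tensor_grading D1 D2 (g, h) -> q1 F z \in D1 g /\ (h != 0 -> q1 F z = 0).
  move: z; apply: tensor_space_ind => [k z t [Hz Hz0] [Ht Ht0]||u v ug vh].
  - by rewrite linearP /=; split=> [|h0]; rewrite ?memvD ?memvZ // Hz0 // Ht0 // scaler0 addr0.
  - by rewrite linear0 mem0v.
  - by rewrite q1E memvZ //; split=> // h0; rewrite (D_trace D2P vh h0) mulr0 scale0r.
have H2 z : z \in tensor_grading D1 D2 (g, h) -> q2 F z \in D2 h /\ (g != 0 -> q2 F z = 0).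
  move: z; apply: tensor_space_ind => [k z t [Hz Hz0] [Ht Ht0]||u v ug vh].
  - by rewrite linearP /=; split=> [|g0]; rewrite ?memvD ?memvZ // Hz0 // Ht0 // scaler0 addr0.
  - by rewrite linear0 mem0v.
  - by rewrite q2E memvZ //; split=> // g0; rewrite (D_trace D1P ug g0) mulr0 scale0r.
by have [] := H1 _ zgh; have [] := H2 _ zgh; rewrite q1_j // q2_j.
Qed.

Section WithRefinement.
Variables (H : zmodType) (Delta : H -> {vspace A}).
Hypothesis DeltaP : is_grading (cayley2_mul F) Delta.

Lemma degree_uniq h h' z : z != 0 -> z \in Delta h -> z \in Delta h' -> h = h'.
Proof.
have [[s [p pP]] _] := (is_gradingP _ _).1 DeltaP; exact: (homogeneous_degree_uniq pP).
Qed.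

(** The projections of [Delta] preserve [S], and also [Gamma g] because [Delta] refines [Gamma]. So
    they act on the line by scalars, and one that does not kill [z] shows its degree. *)
Lemma line_homogeneous (G : zmodType) (Gamma : G -> {vspace A}) g z :
  is_grading (cayley2_mul F) Gamma -> refines Delta Gamma ->
  z \in (S :&: Gamma g)%VS -> ((S :&: Gamma g) <= <[z]>)%VS -> exists h, z \in Delta h.
Proof.
move=> GammaP DG zg line.
have [[s [p pP]] mD] := (is_gradingP _ _).1 DeltaP.
have [[t [q qP]] _] := (is_gradingP _ _).1 GammaP.
have zl h : p h z \in <[z]>%VS.
  apply: (subvP line); move: zg; rewrite !memv_cap => /andP[zS zg].
  rewrite (S_proj pP mD) //=.
  rewrite -[p h z](_ : q g (p h z) = _) ?(proj_mem qP) //.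
  have [b bP] : exists b : H -> G, forall h, (Delta h <= Gamma (b h))%VS.
    by have [b bP] := choice DG; exists b.
  rewrite -[in RHS](proj_id qP zg) -[in RHS](proj_sum pP z) linear_sum linear_sum /=.
  have E k : q g (p k z) = if b k == g then p k z else 0.
    have pk : p k z \in Gamma (b k) by exact: (subvP (bP k)) (proj_mem pP k z).
    case: eqP => [<-|/eqP bg]; first exact: (proj_id qP pk).
    by apply: (proj_neq qP pk); rewrite eq_sym.
  under eq_bigr => k _ do rewrite E.
  rewrite E; case: ifP => bh; last first.
    rewrite big1 // => k _; case: ifP => bk; last by rewrite linear0.
    apply: (proj_neq pP (proj_mem pP k z)); apply: contraTneq bk => <-.
    by rewrite bh.
  have [hs|hs] := boolP (h \in s); last first.
    by rewrite (proj_out pP) // big1 // => k _; rewrite (proj_out pP).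
  rewrite (bigD1_seq h) //=; last by case: pP.
  rewrite bh (proj_id pP (proj_mem pP h z)) big1 ?addr0 // => k kh.
  case: ifP => _; last by rewrite linear0.
  by apply: (proj_neq pP (proj_mem pP k z)); rewrite eq_sym.
have [z0|z0] := eqVneq z 0; first by exists 0; rewrite z0 mem0v.
have [h ph] : exists h, p h z != 0.
  apply: contrapT => H0; case/eqP: z0; rewrite -(proj_sum pP z) big1 // => h _.
  by apply: contra_notP H0 => /eqP ?; exists h.
exists h; have /vlineP[k kE] := zl h.
have k0 : k != 0 by apply: contraNneq ph => k0; rewrite kE k0 scale0r.
rewrite -[z]scale1r -(mulVf k0) -scalerA -kE memvZ //; exact: (proj_mem pP).
Qed.

Section Bracket.
Variable j : 'Hom(C, A).
Hypotheses (j_inj : forall x, skewc x -> j x = 0 -> x = 0).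
Hypothesis jbr : forall x y, abr (j x) (j y) = j (cbr x y).

Lemma jbr_mem h h' x y : j x \in Delta h -> j y \in Delta h' -> j (cbr x y) \in Delta (h + h').
Proof. by move=> xh yh'; rewrite -jbr; apply: Gamma_abr (grading_mul DeltaP) _ _ _ _ xh yh'. Qed.

(** The brackets [[u_ i, v_ i] = - a] and [[a, u_ i] = 2 u_ i] make the degrees of [u_ i] and [v_ i]
    opposite, and [[u_ 1, u_ 2] = 2 v_ 0] fixes the remaining one. Only the degrees of [u_ 1] and
    [u_ 2] are free, and they define [psi]. *)
Lemma cartan_degrees :
  (forall c, c != E1 -> c != E2 -> exists h, j (bv c) \in Delta h) ->
  exists psi : {additive int * int -> H}, forall g x,
    x \in cartan_grading F g -> skewc x -> j x \in Delta (psi g).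
Proof.
move=> hom; pose a := e1 F - e2 F.
have /choice[dU dUP] : forall i, exists h, j (u_ F i) \in Delta h by move=> i; exact: hom.
have /choice[dV dVP] : forall i, exists h, j (v_ F i) \in Delta h by move=> i; exact: hom.
have jZ h x (k : F) : k != 0 -> j (k *: x) \in Delta h -> j x \in Delta h.
  by move=> k0 xh; rewrite -[x]scale1r -(mulVf k0) -scalerA linearZ /= memvZ.
have bv0 c : c != E1 -> c != E2 -> j (bv c) != 0.
  move=> c1 c2; apply/eqP => /(j_inj (skew_basis F c1 c2))/ffunP/(_ c)/eqP; rewrite basisE eqxx ffunE; exact/negP/oner_neq0.
have au i : cbr a (u_ F i) = 2 *: u_ F i.
  by rewrite /cbr mulcBl mulcBr !basis_mul /= subr0 sub0r opprK scaler_nat.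
have uv i : cbr (u_ F i) (v_ F i) = - a.
  by rewrite /cbr !basis_mul /= !eqxx /a opprK opprB addrC.
have ja i : j a \in Delta (dU i + dV i).
  by rewrite -[a]opprK linearN memvN -(uv i) jbr_mem.
have dVE i : dV i = - dU i.
  apply/eqP; rewrite -addr_eq0 addrC.
  have := jbr_mem (ja i) (dUP i); rewrite au => /(jZ _ _ _ two_neq0) H1.
  have := degree_uniq (bv0 (U i) isT isT) H1 (dUP i) => /eqP.
  by rewrite -subr_eq0 addrK.
have ja0 : j a \in Delta 0 by have := ja 0; rewrite dVE subrr.
have dV0 : dV 0 = dU 1 + dU 2.
  have uu : cbr (u_ F 1) (u_ F 2) = 2 *: v_ F 0.
    by rewrite /cbr !basis_mul /= opprK scaler_nat.
  have := jbr_mem (dUP 1) (dUP 2); rewrite uu => /(jZ _ _ _ two_neq0).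
  exact: degree_uniq (bv0 (V 0) isT isT) (dVP 0).
pose psi : {additive int * int -> H} := pair_map (int_map (dU 1)) (int_map (dU 2)).
have psiE (k l : int) : psi (k, l) = dU 1 *~ k + dU 2 *~ l by [].
exists psi => g x xg sx; have := (mem_skew_cartan g x).2 (conj xg sx).
case: eqP => [->|/eqP g0].
  by move=> /vlineP[k ->]; rewrite linearZ memvZ //= raddf0.
rewrite cartan_gradingE => /memv_sumP[xs xsP ->].
rewrite linear_sum; apply: rpred_sum => c cg.
have /vlineP[k ->] := xsP c cg; rewrite linearZ memvZ //=.
move: (eqP cg) g0 => <- {xg sx xs xsP cg x}; move: c; apply: cayley_index_ind' => //= _;
  rewrite psiE ?mulr1z ?mulr0z ?mulrN1z ?addr0 ?add0r -?dVE -?dV0 ?dUP ?dVP //.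
by rewrite !dVE -opprD -dV0 dVE opprK dUP.
Qed.

End Bracket.
End WithRefinement.
End Refinement.


Section Rigid.
Variable F : closedFieldType.
Local Notation C := (cayley F).
Local Notation A := (cayley2 F).
Local Notation "1c" := (cayley_one F).
Local Notation S := (skew_sum F).
Local Notation bv := (@basis_vector F cayley_index : cayley_index -> C).
Hypothesis two_neq0 : (2 : F) != 0.

(** Twisted components meet [S] in images of [graph (chi d)]; under brackets the ratios multiply
    ([graph_abr]) while the degrees add. *)
Definition graph (k : F) : 'Hom(C, A) := (j1 F + k *: j2 F)%VF.

Lemma graphE k x : graph k x = j1 F x + k *: j2 F x.
Proof. by rewrite add_lfunE scale_lfunE. Qed.

Lemma q1_j1 x : q1 F (j1 F x) = x.
Proof. by have := q1_j two_neq0 x (skewc0 F); rewrite j20 addr0. Qed.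
Lemma q2_j2 x : q2 F (j2 F x) = x.
Proof. by have := q2_j two_neq0 x (skewc0 F); rewrite j10 add0r. Qed.

Lemma graph_inj k x : skewc x -> graph k x = 0 -> x = 0.
Proof.
move=> sx; rewrite graphE -j2Z => /(congr1 (q1 F)).
by rewrite q1_j ?linear0 //; exact: skewcZ.
Qed.

Lemma graph_abr k l x y : abr (graph k x) (graph l y) = graph (k * l) (cbr x y).
Proof.
have E c u : graph c u = j1 F u + j2 F (c *: u) by rewrite graphE j2Z.
transitivity (abr (j1 F x + j2 F (k *: x)) (j1 F y + j2 F (l *: y))).
  by congr abr; apply: E.
rewrite (E (k * l)) (abr_j x (k *: x) y (l *: y)); congr (_ + j2 F _).
by rewrite cbrZl cbrZr scalerA.
Qed.

Lemma cube_skew g x : g != 0 -> x \in z2cube_grading F g -> skewc x.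
Proof. by move=> g0 xg; apply: (D_trace (z2cube_is_grading two_neq0) xg g0). Qed.

Lemma std_basis_mem g : std_basis F g \in z2cube_grading F g.
Proof. by rewrite z2cube_gradingE memv_line. Qed.

Lemma std_basis_bracket g h : g != 0 -> h != 0 -> g != h ->
  cbr (std_basis F g) (std_basis F h) = (2 * cd_sign F g h) *: std_basis F (g + h).
Proof.
move=> g0 h0 gh; rewrite /cbr (@skew_orthE _ (std_basis F g)) //.
- by rewrite opprK std_basis_mul -mulr2n -scaler_nat scalerA.
- exact: cube_skew g0 (std_basis_mem g).
- exact: cube_skew h0 (std_basis_mem h).
- apply: (D_cbil (z2cube_is_grading two_neq0)); try exact: std_basis_mem.
  by rewrite -(z2cube_double h) (inj_eq (addIr h)).
Qed.

Lemma std_basis_norm g : cnorm (std_basis F g) != 0.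
Proof.
have [_ [na nx nz]] := std_triple F.
case: g => [[a b] c]; rewrite /std_basis /cdbasis !cnormM /cdpow.
by rewrite !mulf_neq0 //; case: ifP => _; rewrite ?cnorm1 ?na ?nx ?nz ?oppr_eq0 ?oner_eq0.
Qed.

Lemma std_basis_neq0 g : std_basis F g != 0.
Proof.
by apply: contraNneq (std_basis_norm g) => ->; rewrite -(scale0r 0) cnormZ expr2 !mul0r.
Qed.

Section WithGrading.
Variables (H : zmodType) (Delta : H -> {vspace A}).
Hypothesis DeltaP : is_grading (cayley2_mul F) Delta.

(** The bracket of two distinct basis elements of nonzero degree is a nonzero multiple of the basis
    element at the sum. So degrees add for pairs in general position, and
    [partial_additive_extension] gives the homomorphism. The family [jf] is constant for tensor
    products and [graph (chi d)] for twisted gradings. *)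
Lemma cube_degrees (E : zmodType) (bar : {additive E -> 'Z_2 * 'Z_2 * 'Z_2})
    (jf : E -> 'Hom(C, A)) :
  (forall k, exists d, bar d = k) ->
  (forall d x, skewc x -> jf d x = 0 -> x = 0) ->
  (forall d e x y, skewc x -> skewc y -> abr (jf d x) (jf e y) = jf (d + e) (cbr x y)) ->
  (forall d, bar d != 0 -> exists h, jf d (std_basis F (bar d)) \in Delta h) ->
  exists psi : {additive E -> H}, forall d x,
    x \in z2cube_grading F (bar d) -> skewc x -> jf d x \in Delta (psi d).
Proof.
move=> surj jf_inj jfbr hom.
have /choice[delta deltaP] : forall d, exists h,
    bar d != 0 -> jf d (std_basis F (bar d)) \in Delta h.
  move=> d; have [->|/hom[h hP]] := eqVneq (bar d) 0; first by exists 0.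
  by exists h.
have ss g : g != 0 -> skewc (std_basis F g).
  by move=> g0; exact: cube_skew g0 (std_basis_mem g).
have add_neq0 (a b : 'Z_2 * 'Z_2 * 'Z_2) : a != b -> a + b != 0.
  by rewrite -[X in _ -> _ != X](z2cube_double b) (inj_eq (addIr b)).
have deltaD d e : bar d != 0 -> bar e != 0 -> bar d != bar e ->
    delta (d + e) = delta d + delta e.
  move=> d0 e0 de; have de0 : bar (d + e) != 0 by rewrite raddfD add_neq0.
  apply: (degree_uniq DeltaP (z := jf (d + e) (std_basis F (bar (d + e))))).
  - by apply/eqP => /jf_inj; move/(_ (ss _ de0))/eqP; apply/negP/std_basis_neq0.
  - exact: deltaP.
  have := Gamma_abr (grading_mul DeltaP) (deltaP d d0) (deltaP e e0).
  rewrite (jfbr d e _ _ (ss _ d0) (ss _ e0)) std_basis_bracket // linearZ /= => /(memvZ (2 * cd_sign F (bar d) (bar e))^-1).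
  by rewrite scalerA mulVf ?mulf_neq0 ?cd_sign_neq0 // scale1r raddfD.
have [psi psiE] := partial_additive_extension z2cube_double (@z2cube_avoid) surj deltaD.
exists psi => d x xd sx; have := (mem_skew_cube two_neq0 (bar d) x).2 (conj xd sx).
case: eqP => [_|/eqP d0]; first by rewrite memv0 => /eqP ->; rewrite linear0 mem0v.
rewrite z2cube_gradingE => /vlineP[k ->]; rewrite linearZ memvZ //=.
by rewrite psiE // deltaP.
Qed.

Section Tensor.
Variables (G1 G2 : zmodType) (D1 : G1 -> {vspace C}) (D2 : G2 -> {vspace C}).
Hypotheses (D1P : is_grading (cayley_mul F) D1) (D2P : is_grading (cayley_mul F) D2).
Hypothesis Dref : refines Delta (tensor_grading D1 D2).

Lemma tensor_line1 g x : g != 0 -> x \in D1 g -> (forall y, y \in D1 g -> y \in <[x]>%VS) ->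
  exists h, j1 F x \in Delta h.
Proof.
move=> g0 xg line.
have sx : skewc x by exact: (D_trace D1P xg g0).
apply: (line_homogeneous DeltaP (tensor_is_grading D1P D2P) Dref (g := (g, 0))).
  rewrite memv_cap mem_S1 //= j1E mem_tensor_space //; exact: D_one D2P.
apply/subvP => z; rewrite memv_cap => /andP[/mem_skew_sum[u [v [su sv ->]]]].
move=> /(tensor_S two_neq0 D1P D2P su sv)[ug _ _ /(_ g0) ->].
by have /vlineP[k ->] := line u ug; rewrite linear0 addr0 linearZ memvZ // memv_line.
Qed.

Lemma tensor_line2 g x : g != 0 -> x \in D2 g -> (forall y, y \in D2 g -> y \in <[x]>%VS) ->
  exists h, j2 F x \in Delta h.
Proof.
move=> g0 xg line.
have sx : skewc x by exact: (D_trace D2P xg g0).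
apply: (line_homogeneous DeltaP (tensor_is_grading D1P D2P) Dref (g := (0, g))).
  rewrite memv_cap mem_S2 //= j2E mem_tensor_space //; exact: D_one D1P.
apply/subvP => z; rewrite memv_cap => /andP[/mem_skew_sum[u [v [su sv ->]]]].
move=> /(tensor_S two_neq0 D1P D2P su sv)[_ vg /(_ g0) ->].
by have /vlineP[k ->] := line v vg; rewrite linear0 add0r linearZ memvZ // memv_line.
Qed.

Lemma tensor_degrees (psi1 : {additive G1 -> H}) (psi2 : {additive G2 -> H}) :
  (forall g x, x \in D1 g -> skewc x -> j1 F x \in Delta (psi1 g)) ->
  (forall g x, x \in D2 g -> skewc x -> j2 F x \in Delta (psi2 g)) ->
  exists psi : {additive G1 * G2 -> H}, forall d,
    (tensor_grading D1 D2 d <= Delta (psi d))%VS.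
Proof.
move=> P1 P2; have TP := tensor_is_grading D1P D2P.
have [[s [p pP]] mT] := (is_gradingP _ _).1 TP.
exists (pair_map psi1 psi2); apply: (S_generates two_neq0 pP mT (grading_mul DeltaP)).
move=> [g h]; apply/subvP => z; rewrite memv_cap => /andP[/mem_skew_sum[u [v [su sv ->]]]].
move=> /(tensor_S two_neq0 D1P D2P su sv)[ug vh u0 v0]; rewrite memvD //.
  have [->|/u0 ->] := eqVneq h 0; last by rewrite linear0 mem0v.
  by have := P1 _ _ ug su; rewrite -[psi1 g]addr0 -(raddf0 psi2).
have [->|/v0 ->] := eqVneq g 0; last by rewrite linear0 mem0v.
by have := P2 _ _ vh sv; rewrite -[psi2 h]add0r -(raddf0 psi1).
Qed.

End Tensor.

End WithGrading.

Lemma cartan_line c x : x \in cartan_grading F (cartan_degree c) -> c != E1 -> c != E2 ->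
  x \in <[bv c]>%VS.
Proof.
rewrite cartan_gradingE => /memv_sumP[xs xsP ->] c1 c2.
apply: rpred_sum => c' /eqP cc'; suff <- : c' = c by apply: xsP; rewrite cc'.
move: cc' c1 c2 {xs xsP}; move: c' c; do 2!apply: cayley_index_ind'; by [].
Qed.

Lemma cartan_degree_neq0 c : c != E1 -> c != E2 -> cartan_degree c != 0.
Proof. by move: c; apply: cayley_index_ind'. Qed.

Lemma bv_mem c : bv c \in cartan_grading F (cartan_degree c).
Proof. by rewrite cartan_gradingE basis_grading_mem. Qed.

Lemma cube_line g x : x \in z2cube_grading F g -> x \in <[std_basis F g]>%VS.
Proof. by rewrite z2cube_gradingE. Qed.

(** Rigidity of a grading of C, tested on any bracket-preserving copy [j] of C_0 in the tensor
    square. Its last assumption is what [line_homogeneous] supplies. *)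
Definition cayley_rigid (G : zmodType) (D : G -> {vspace C}) : Prop :=
  is_grading (cayley_mul F) D /\
  forall (H : zmodType) (Delta : H -> {vspace A}) (j : 'Hom(C, A)),
    is_grading (cayley2_mul F) Delta ->
    (forall x, skewc x -> j x = 0 -> x = 0) -> (forall x y, abr (j x) (j y) = j (cbr x y)) ->
    (forall g x, g != 0 -> x \in D g -> (forall y, y \in D g -> y \in <[x]>%VS) ->
       exists h, j x \in Delta h) ->
    exists psi : {additive G -> H}, forall g x,
      x \in D g -> skewc x -> j x \in Delta (psi g).

Lemma cartan_cayley_rigid : cayley_rigid (@cartan_grading F).
Proof.
split=> [|H Delta j DP j_inj jbr hom]; first exact: cartan_is_grading.
apply: (cartan_degrees two_neq0 DP j_inj jbr) => c c1 c2.
apply: (hom _ _ (cartan_degree_neq0 c1 c2) (bv_mem c)) => y yc.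
exact: cartan_line yc c1 c2.
Qed.

Lemma cube_cayley_rigid : cayley_rigid (@z2cube_grading F).
Proof.
split=> [|H Delta j DP j_inj jbr hom]; first exact: z2cube_is_grading.
apply: (cube_degrees DP (bar := idfun) (jf := fun=> j)) => //.
- by move=> k; exists k.
- by move=> g g0; apply: (hom _ _ g0 (std_basis_mem g)) => y; apply: cube_line.
Qed.

Lemma tensor_rigid (G1 G2 : zmodType) (D1 : G1 -> {vspace C}) (D2 : G2 -> {vspace C}) :
  cayley_rigid D1 -> cayley_rigid D2 -> rigid (cayley2_mul F) (tensor_grading D1 D2).
Proof.
move=> [D1P r1] [D2P r2] H Delta DP Dref.
have j1_0 x : skewc x -> j1 F x = 0 -> x = 0 by move=> _ /(congr1 (q1 F)); rewrite q1_j1 linear0.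
have j2_0 x : skewc x -> j2 F x = 0 -> x = 0 by move=> _ /(congr1 (q2 F)); rewrite q2_j2 linear0.
have [psi1 P1] := r1 H Delta (j1 F) DP j1_0 (@abr_j1 F)
  (fun g x g0 xg xl => tensor_line1 DP D1P D2P Dref g0 xg xl).
have [psi2 P2] := r2 H Delta (j2 F) DP j2_0 (@abr_j2 F)
  (fun g x g0 xg xl => tensor_line2 DP D1P D2P Dref g0 xg xl).
exact: tensor_degrees P1 P2.
Qed.

Section Twisted.
Variables (K E : zmodType) (D : K -> {vspace C}) (bar : {additive E -> K}).
Variables (chi : E -> F) (Gamma : E -> {vspace A}).
Hypothesis GP : twisted_by D bar chi Gamma.
Variables (H : zmodType) (Delta : H -> {vspace A}).
Hypotheses (DeltaP : is_grading (cayley2_mul F) Delta) (Dref : refines Delta Gamma).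

Lemma twisted_line d x : x \in D (bar d) -> skewc x ->
  (forall y, y \in D (bar d) -> skewc y -> y \in <[x]>%VS) ->
  exists h, graph (chi d) x \in Delta h.
Proof.
move=> xd sx line; have [GammaP GS] := GP.
apply: (line_homogeneous DeltaP GammaP Dref (g := d)).
  by apply/GS; exists x; rewrite graphE.
apply/subvP => z /GS[y [yd sy ->]]; have /vlineP[k ->] := line y yd sy.
by rewrite -graphE linearZ memvZ // memv_line.
Qed.

Lemma twisted_degrees (psi : {additive E -> H}) :
  (forall d x, x \in D (bar d) -> skewc x -> graph (chi d) x \in Delta (psi d)) ->
  forall d, (Gamma d <= Delta (psi d))%VS.
Proof.
move=> P; have [GammaP GS] := GP; have [[s [p pP]] mT] := (is_gradingP _ _).1 GammaP.
apply: (S_generates two_neq0 pP mT (grading_mul DeltaP)) => d.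
by apply/subvP => z /GS[x [xd sx ->]]; rewrite -graphE P.
Qed.

End Twisted.

Lemma twisted_cube_rigid (E : zmodType) (bar : {additive E -> 'Z_2 * 'Z_2 * 'Z_2})
    (chi : E -> F) (Gamma : E -> {vspace A}) :
  (forall k, exists d, bar d = k) -> (forall d e, chi (d + e) = chi d * chi e) ->
  twisted_by (@z2cube_grading F) bar chi Gamma -> rigid (cayley2_mul F) Gamma.
Proof.
move=> surj chiD GP H Delta DP Dref.
have [psi P] : exists psi : {additive E -> H}, forall d x,
    x \in z2cube_grading F (bar d) -> skewc x -> graph (chi d) x \in Delta (psi d).
  apply: (cube_degrees DP (jf := fun d => graph (chi d)) surj) => [d x|d e x y _ _|d d0].
  - exact: graph_inj.
  - by rewrite graph_abr chiD.
  - have xd := std_basis_mem (bar d).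
    apply: (twisted_line GP DP Dref xd (cube_skew d0 xd)) => y yd _; exact: cube_line.
by exists psi; apply: (twisted_degrees GP DP P).
Qed.

(** The copy [graph 1] is closed under brackets and gives the homomorphism on [Z^2]. Bracketing with
    [graph (-1) a] passes from [graph 1] to [graph (-1)] and back, so its degree [h0] satisfies
    [2 h0 = 0] and is the image of the generator of [Z/2]. *)
Lemma twisted_cartan_rigid (Gamma : 'Z_2 * (int * int) -> {vspace A}) :
  twisted_by (@cartan_grading F) snd (fun d : 'Z_2 * (int * int) => (-1) ^+ d.1) Gamma ->
  rigid (cayley2_mul F) Gamma.
Proof.
move=> GP H Delta DP Dref; pose a := e1 F - e2 F.
have lineP := twisted_line (bar := snd) GP DP Dref.
have a_line y : y \in cartan_grading F (0, 0) -> skewc y -> y \in <[a]>%VS.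
  by move=> y0 sy; have := (mem_skew_cartan (0, 0) y).2 (conj y0 sy); rewrite eqxx.
have a0 : a \in cartan_grading F (0, 0).
  by apply: ((mem_skew_cartan (0, 0) a).1 _).1; rewrite eqxx memv_line.
have [psi0 P0] : exists psi : {additive int * int -> H}, forall g x,
    x \in cartan_grading F g -> skewc x -> graph 1 x \in Delta (psi g).
  apply: (cartan_degrees two_neq0 DP) => [x|x y|c c1 c2]; first exact: graph_inj.
    by rewrite graph_abr mulr1.
  have := lineP (0, cartan_degree c) _ (bv_mem c) (skew_basis F c1 c2); apply => y yc _.
  exact: cartan_line yc c1 c2.
have [h0 h0P] : exists h, graph (-1) a \in Delta h.
  by apply: (lineP (1, (0, 0)) a a0 (skew_u F)); apply: a_line.
have gZ k h x (l : F) : l != 0 -> graph k (l *: x) \in Delta h -> graph k x \in Delta h.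
  by move=> l0 xh; rewrite -[x]scale1r -(mulVf l0) -scalerA linearZ /= memvZ.
have brP k l h h' x y : graph k x \in Delta h -> graph l y \in Delta h' ->
    graph (k * l) (cbr x y) \in Delta (h + h').
  by move=> xh yh; rewrite -graph_abr; apply: Gamma_abr (grading_mul DP) _ _ _ _ xh yh.
have abv c : c != E1 -> c != E2 -> exists2 l : F, l != 0 & cbr a (bv c) = l *: bv c.
  move=> c1 c2; case: c c1 c2 => // i _ _; [exists 2|exists (-2)]; rewrite ?oppr_eq0 //.
    by rewrite /cbr mulcBl mulcBr !basis_mul /= subr0 sub0r opprK scaler_nat.
  by rewrite /cbr mulcBl mulcBr !basis_mul /= subr0 sub0r -opprD scaleNr scaler_nat.
have P1 c : c != E1 -> c != E2 ->
    graph (-1) (bv c) \in Delta (h0 + psi0 (cartan_degree c)).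
  move=> c1 c2; have [l l0 lE] := abv c c1 c2.
  have := brP _ _ _ _ _ _ h0P (P0 _ _ (bv_mem c) (skew_basis F c1 c2)).
  by rewrite mulr1 lE; apply: gZ.
have h02 : h0 *+ 2 = 0.
  have [l l0 lE] := abv (U 1) isT isT.
  have := brP _ _ _ _ _ _ h0P (P1 (U 1) isT isT).
  rewrite mulrNN mulr1 lE => /(gZ _ _ _ _ l0) H1.
  have u0 : graph 1 (bv (U 1)) != 0.
    apply/eqP => /(graph_inj (@skew_basis F (U 1) isT isT))/ffunP/(_ (U 1))/eqP.
    by rewrite basisE eqxx ffunE oner_eq0.
  have := degree_uniq DP u0 H1 (P0 _ _ (bv_mem (U 1)) (@skew_basis F (U 1) isT isT)).
  by move/eqP; rewrite -subr_eq0 addrA addrK => /eqP.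
exists (pair_map (ord_map h02) psi0); apply: (twisted_degrees GP DP) => -[k g] x /= xg sx.
move: k; apply: Z2_ind.
  by have := P0 g x xg sx; rewrite -[psi0 g]add0r.
rewrite expr1; have := (mem_skew_cartan g x).2 (conj xg sx).
case: eqP => [g0|/eqP g0].
  move=> /vlineP[t ->]; rewrite linearZ memvZ //=.
  by have : graph (-1) a \in Delta (h0 + psi0 0); [rewrite raddf0 addr0|rewrite g0].
rewrite cartan_gradingE => /memv_sumP[xs xsP ->].
rewrite linear_sum; apply: rpred_sum => c cg.
have /vlineP[t ->] := xsP c cg; rewrite linearZ memvZ //=.
have [c1 c2] : c != E1 /\ c != E2.
  by split; apply: contraNneq g0 => cE; rewrite -(eqP cg) cE.
by have := P1 c c1 c2; rewrite (eqP cg).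
Qed.

End Rigid.


(** * Grading groups *)

Section SupportGenerates.

(** Generation of the group by the support, phrased as an induction principle. *)
Definition support_spans (F : fieldType) (V : vectType F) (G : zmodType)
    (Gamma : G -> {vspace V}) : Prop :=
  forall P : G -> Prop, P 0 -> (forall x y, P x -> P y -> P (x - y)) ->
    (forall g, Gamma g != 0%VS -> P g) -> forall g, P g.

Lemma support_spans_generates (F : fieldType) (V : vectType F) (G : zmodType)
    (Gamma : G -> {vspace V}) : support_spans Gamma -> support_generates Gamma.
Proof.
move=> span psi psiE; apply: span psiE => [|x y Hx Hy]; first exact: raddf0.
by rewrite raddfB /= Hx Hy.
Qed.

Section Closure.
Variables (G : zmodType) (P : G -> Prop).
Hypotheses (P0 : P 0) (PB : forall x y, P x -> P y -> P (x - y)).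

Lemma closed_opp x : P x -> P (- x).
Proof. by rewrite -sub0r; apply: PB. Qed.

Lemma closed_add x y : P x -> P y -> P (x + y).
Proof. by move=> Px Py; rewrite -[y]opprK; apply/PB/closed_opp. Qed.

Lemma closed_mulz x (n : int) : P x -> P (x *~ n).
Proof.
move=> Px; have Pn k : P (x *+ k).
  by elim: k => [|k IHk]; rewrite ?mulr0n // mulrS; apply: closed_add.
by case: n => k; [exact: Pn|exact/closed_opp/Pn].
Qed.

End Closure.

Variable F : closedFieldType.
Local Notation C := (cayley F).
Local Notation A := (cayley2 F).
Local Notation bv := (@basis_vector F cayley_index : cayley_index -> C).
Hypothesis two_neq0 : (2 : F) != 0.

Lemma vspace_neq0 (V : vectType F) (U : {vspace V}) x : x \in U -> x != 0 -> U != 0%VS.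
Proof. by move=> xU; apply: contraNneq => U0; rewrite -memv0 -U0. Qed.

Lemma bv_neq0 c : bv c != 0.
Proof. by apply/eqP => /ffunP/(_ c)/eqP; rewrite basisE eqxx ffunE oner_eq0. Qed.

Lemma cartan_support c : cartan_grading F (cartan_degree c) != 0%VS.
Proof. exact: vspace_neq0 (bv_mem F c) (bv_neq0 c). Qed.

Lemma cube_support g : z2cube_grading F g != 0%VS.
Proof. exact: vspace_neq0 (std_basis_mem F g) (std_basis_neq0 F g). Qed.

Lemma pair_int (a b : int) : (a, b) = (1, 0) *~ a + (0, 1) *~ b :> (int * int)%type.
Proof.
have E (x : int * int) (n : int) : x *~ n = (x.1 *~ n, x.2 *~ n).
  rewrite [LHS]surjective_pairing; congr (_, _).
    exact: (raddfMz (@fst int int) n x).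
  exact: (raddfMz (@snd int int) n x).
by rewrite !E /=; congr (_, _); rewrite /= ?mul0rz ?intz ?addr0 ?add0r.
Qed.

Lemma cartan_spans : support_spans (@cartan_grading F).
Proof.
move=> P P0 PB PG [a b]; rewrite pair_int.
by apply: (closed_add P0 PB); apply: (closed_mulz P0 PB);
  [apply: PG (cartan_support (U 1))|apply: PG (cartan_support (U 2))].
Qed.

Lemma cube_spans : support_spans (@z2cube_grading F).
Proof. by move=> P P0 PB PG g; apply/PG/cube_support. Qed.

Lemma tensor_neq0 (x y : C) : x != 0 -> y != 0 -> x *t y != 0.
Proof.
move=> x0 y0; have [a xa] : exists a, x a != 0 :> F.
  apply: contrapT => H; case/eqP: x0; apply/ffunP => a; rewrite ffunE.
  by apply/eqP; apply: contra_notT H => xa; exists a.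
have [b yb] : exists b, y b != 0 :> F.
  apply: contrapT => H; case/eqP: y0; apply/ffunP => b; rewrite ffunE.
  by apply/eqP; apply: contra_notT H => yb; exists b.
apply/eqP => /ffunP/(_ (a, b))/eqP; rewrite !ffunE /= mulf_eq0.
by rewrite (negPf xa) (negPf yb).
Qed.

Lemma tensor_spans (G H : zmodType) (D1 : G -> {vspace C}) (D2 : H -> {vspace C}) :
  is_grading (cayley_mul F) D1 -> is_grading (cayley_mul F) D2 ->
  support_spans D1 -> support_spans D2 -> support_spans (tensor_grading D1 D2).
Proof.
move=> D1P D2P s1 s2 P P0 PB PG [g h].
have one0 : cayley_one F != 0 by exact: onec_neq0.
have nz g' h' x y : x \in D1 g' -> y \in D2 h' -> x != 0 -> y != 0 -> P (g', h').
  move=> xg yh x0 y0; apply: PG; apply: vspace_neq0 (tensor_neq0 x0 y0).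
  exact: mem_tensor_space.
have -> : (g, h) = (g, 0) + (0, h) by congr (_, _); rewrite /= ?addr0 ?add0r.
apply: (closed_add P0 PB).
  apply: (s1 (fun g => P (g, 0))) => // [x y Px Py|k k0].
    by rewrite -[0 in X in P X]subr0; apply: PB Px Py.
  by apply: nz (memv_pick _) (D_one D2P) _ one0; rewrite vpick0.
apply: (s2 (fun h => P (0, h))) => // [x y Px Py|k k0].
  by rewrite -[0 in X in P X]subr0; apply: PB Px Py.
by apply: nz (D_one D1P) (memv_pick _) one0 _; rewrite vpick0.
Qed.

Lemma twisted_support (K E : zmodType) (D : K -> {vspace C}) (bar : E -> K) (chi : E -> F)
    (Gamma : E -> {vspace A}) d x : twisted_by D bar chi Gamma ->
  x \in D (bar d) -> skewc x -> x != 0 -> Gamma d != 0%VS.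
Proof.
move=> [_ GS] xd sx x0; apply: (@vspace_neq0 _ _ (graph (chi d) x)).
  have : graph (chi d) x \in (skew_sum F :&: Gamma d)%VS.
    by apply/GS; exists x; rewrite graphE.
  by rewrite memv_cap => /andP[].
by apply: contraNneq x0 => /(graph_inj two_neq0 sx) ->.
Qed.

Lemma twisted_cube_spans (E : zmodType) (bar : {additive E -> 'Z_2 * 'Z_2 * 'Z_2})
    (chi : E -> F) (Gamma : E -> {vspace A}) :
  (forall k, exists d, bar d = k) ->
  twisted_by (@z2cube_grading F) bar chi Gamma -> support_spans Gamma.
Proof.
move=> surj GP P P0 PB PG.
have P1 d : bar d != 0 -> P d.
  move=> d0; apply: PG; have xd := std_basis_mem F (bar d).
  exact: (twisted_support GP xd (cube_skew two_neq0 d0 xd) (std_basis_neq0 F _)).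
move=> d; have [d0|/P1 //] := eqVneq (bar d) 0.
(* A degree [d] over zero is the difference of [d + e] and [e], which both lie over [(1, 0, 0)]. *)
have [e eE] := surj (1, 0, 0); rewrite -[d](addrK e).
by apply: PB; apply: P1; rewrite ?raddfD /= ?d0 ?add0r eE.
Qed.

Lemma twisted_cartan_spans (Gamma : 'Z_2 * (int * int) -> {vspace A}) :
  twisted_by (@cartan_grading F) snd (fun d : 'Z_2 * (int * int) => (-1) ^+ d.1) Gamma ->
  support_spans Gamma.
Proof.
move=> GP P P0 PB PG.
have P1 k c : c != E1 -> c != E2 -> P (k, cartan_degree c).
  move=> c1 c2; apply: PG.
  exact: (twisted_support (d := (k, cartan_degree c)) GP (bv_mem F c) (skew_basis F c1 c2) (bv_neq0 c)).
have Pk k : P (k, 0).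
  have -> : (k, 0) = (k, cartan_degree (U 1)) - (0, cartan_degree (U 1)) :> ('Z_2 * (int * int))%type.
    by congr (_, _); rewrite /= ?subr0 ?subrr.
  by apply: PB; apply: P1.
move=> [k g]; have -> : (k, g) = (k, 0) + (0, g) by congr (_, _); rewrite /= ?addr0 ?add0r.
apply: (closed_add P0 PB) => //.
apply: (cartan_spans (P := fun g => P (0, g))) => // [x y Px Py|g' g'0].
  by rewrite -[0 in X in P X]subr0; apply: PB Px Py.
have [-> //|gN0] := eqVneq g' 0.
have : exists2 c, cartan_degree c == g' & true.
  apply: contrapT => H; case/negP: g'0; rewrite cartan_gradingE /basis_grading big1 // => c cg.
  by case: H; exists c.
move=> [c /eqP cg _]; rewrite -cg; apply: P1; by apply: contraNneq gN0 => cE; rewrite -cg cE.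
Qed.

End SupportGenerates.

Section Groups.

Lemma pairings_isomorphic : isomorphic_groups ((int * int) * (int * int))%type 'rV[int]_4.
Proof.
pose f (x : (int * int) * (int * int)) : 'rV[int]_4 :=
  \row_i nth 0 [:: x.1.1; x.1.2; x.2.1; x.2.2] i.
have fM : zmod_morphism f.
  move=> x y; apply/rowP => -[[|[|[|[|//]]]] i]; by rewrite !mxE.
exists (HB.pack_for {additive _ -> _} f (GRing.isZmodMorphism.Build _ _ f fM)).
exists (fun r : 'rV[int]_4 => ((r 0 0, r 0 1), (r 0 2, r 0 3))) => /= [[[a b] [c d]]|r].
  by rewrite /f !mxE.
by apply/rowP => -[[|[|[|[|//]]]] i]; rewrite /f !mxE /=; congr (r _ _); apply: val_inj.
Qed.

Lemma cubes_isomorphic :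
  isomorphic_groups (('Z_2 * 'Z_2 * 'Z_2) * ('Z_2 * 'Z_2 * 'Z_2))%type 'rV['Z_2]_6.
Proof.
pose f (x : ('Z_2 * 'Z_2 * 'Z_2) * ('Z_2 * 'Z_2 * 'Z_2)) : 'rV['Z_2]_6 :=
  \row_i nth 0 [:: x.1.1.1; x.1.1.2; x.1.2; x.2.1.1; x.2.1.2; x.2.2] i.
have fM : zmod_morphism f.
  move=> x y; apply/rowP => -[[|[|[|[|[|[|//]]]]]] i]; by rewrite !mxE.
exists (HB.pack_for {additive _ -> _} f (GRing.isZmodMorphism.Build _ _ f fM)).
exists (fun r : 'rV['Z_2]_6 => ((r 0 0, r 0 1, r 0 2), (r 0 3, r 0 4, r 0 5))) => /= [|r].
  by move=> [[[a b] c] [[a' b'] c']]; rewrite /f !mxE.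
by apply/rowP => -[[|[|[|[|[|[|//]]]]]] i]; rewrite /f !mxE /=; congr (r _ _); apply: val_inj.
Qed.

(** First of five isomorphism invariants that together separate the six grading groups. *)
Definition has_double (G : zmodType) : Prop := exists x : G, x + x != 0.
Definition has_quadruple (G : zmodType) : Prop := exists x : G, x *+ 4 != 0.
Definition has_involution (G : zmodType) : Prop := exists x : G, x != 0 /\ x + x = 0.
Definition has_two_involutions (G : zmodType) : Prop :=
  exists x y : G, [/\ x != 0, y != 0, x != y, x + x = 0 & y + y = 0].
Definition small (G : zmodType) : Prop := exists2 r : seq G, (size r <= 16)%N & forall x, x \in r.

Lemma isomorphic_transfer (G H : zmodType) : isomorphic_groups G H ->
  [/\ has_double G <-> has_double H, has_quadruple G <-> has_quadruple H,
      has_involution G <-> has_involution H,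
      has_two_involutions G <-> has_two_involutions H & small G <-> small H].
Proof.
move=> [phi [psi phiK psiK]].
have phi0 x : (phi x == 0) = (x == 0) by rewrite raddf_eq0 //; exact: can_inj phiK.
have psiP y : exists x, phi x = y by exists (psi y).
have phiI := can_inj phiK.
split; split.
- by move=> [x x0]; exists (phi x); rewrite -raddfD phi0.
- by move=> [y]; have [x <-] := psiP y; rewrite -raddfD phi0 => x0; exists x.
- by move=> [x x0]; exists (phi x); rewrite -raddfMn phi0.
- by move=> [y]; have [x <-] := psiP y; rewrite -raddfMn phi0 => x0; exists x.
- by move=> [x [x0 xx]]; exists (phi x); rewrite phi0 -raddfD xx raddf0.
- move=> [y]; have [x <-] := psiP y; rewrite phi0 -raddfD => -[x0 /eqP].
  by rewrite phi0 => /eqP xx; exists x.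
- move=> [x [y [x0 y0 xy xx yy]]]; exists (phi x), (phi y).
  by rewrite !phi0 (inj_eq phiI) -!raddfD xx yy raddf0.
- move=> [x' [y' [+ + + + +]]]; have [x <-] := psiP x'; have [y <-] := psiP y'.
  rewrite !phi0 (inj_eq phiI) -!raddfD => x0 y0 xy /eqP + /eqP.
  by rewrite !phi0 => /eqP xx /eqP yy; exists x, y.
- move=> [r r16 rP]; exists (map phi r); rewrite ?size_map // => y.
  by have [x <-] := psiP y; rewrite map_f.
- move=> [r r16 rP]; exists (map psi r); rewrite ?size_map // => x.
  by rewrite -[x]phiK map_f.
Qed.

End Groups.


(** * Classification *)

Section CayleyTypes.
Variable F : closedFieldType.
Local Notation C := (cayley F).
Local Notation "1c" := (cayley_one F).
Local Notation cube := ('Z_2 * 'Z_2 * 'Z_2)%type.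
Hypothesis two_neq0 : (2 : F) != 0.
Implicit Types (x y z a : C).

Definition cayley_auto (f : 'End(C)) : Prop :=
  is_alg_isomorphism (cayley_mul F) (cayley_mul F) f.

(** Only inclusions are recorded, as [D'] may be a proper coarsening of the image of [D]. *)
Definition carries (K G : zmodType) (D : K -> {vspace C}) (alpha : K -> G)
    (D' : G -> {vspace C}) (f : 'End(C)) : Prop :=
  forall k x, x \in D k -> f x \in D' (alpha k).

Definition cube_map (H : zmodType) (h1 h2 h3 : H) (H1 : h1 *+ 2 = 0) (H2 : h2 *+ 2 = 0)
    (H3 : h3 *+ 2 = 0) : {additive cube -> H} :=
  pair_map (pair_map (ord_map H1) (ord_map H2)) (ord_map H3).

Definition cartan_map (H : zmodType) (h1 h2 : H) : {additive int * int -> H} :=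
  pair_map (int_map h1) (int_map h2).

(** Since square roots exist, the triple can be rescaled to a [cd_triple] without changing degrees.
    The degrees [ga], [gx], [gz] may well be dependent. *)
Lemma homogeneous_triple (G : zmodType) (D : G -> {vspace C}) a x z (ga gx gz : G)
    (Ha : ga *+ 2 = 0) (Hx : gx *+ 2 = 0) (Hz : gz *+ 2 = 0) :
  is_grading (cayley_mul F) D -> ortho_triple a x z ->
  cnorm a != 0 -> cnorm x != 0 -> cnorm z != 0 -> a \in D ga -> x \in D gx -> z \in D gz ->
  exists2 f, cayley_auto f & carries (@z2cube_grading F) (cube_map Ha Hx Hz) D f.
Proof.
move=> DP [[sa sx sz] [ax az xz axz]] na nx nz aD xD zD.
have n10 : (-1 : F) != 0 by rewrite oppr_eq0 oner_eq0.
have [ka ka0 kaE] := scale_norm na n10.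
have [kx kx0 kxE] := scale_norm nx (oner_neq0 F).
have [kz kz0 kzE] := scale_norm nz (oner_neq0 F).
have tP : cd_triple (ka *: a) (kx *: x) (kz *: z).
  split=> //; split; split; try exact: skewcZ.
  - by rewrite cbilZl cbilZr ax !mulr0.
  - by rewrite cbilZl cbilZr az !mulr0.
  - by rewrite cbilZl cbilZr xz !mulr0.
  - by rewrite mulcZl mulcZr !cbilZl cbilZr axz !mulr0.
have [f [fP fE]] := triple_automorphism two_neq0 tP.
exists f => // -[[i j] k] y; rewrite z2cube_gradingE => /vlineP[l ->].
rewrite (_ : f _ = l *: cdbasis (ka *: a) (kx *: x) (kz *: z) (i, j, k)); last first.
  by rewrite -fE; exact: linearZ.
apply: memvZ.
have pw (w : C) g (Hg : g *+ 2 = 0) (m : 'Z_2) : w \in D g -> cdpow w m \in D (ord_map Hg m).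
  move=> wg; rewrite /cdpow /ord_map; move: m; apply: Z2_ind; last by rewrite mulr1n.
  by rewrite mulr0n (D_one DP).
by apply: (D_mul DP); [apply: (D_mul DP)|]; apply: pw; rewrite memvZ.
Qed.

Lemma cayley_type (G : zmodType) (D : G -> {vspace C}) : is_grading (cayley_mul F) D ->
  (exists f (alpha : {additive int * int -> G}),
     cayley_auto f /\ carries (@cartan_grading F) alpha D f) \/
  (exists f (alpha : {additive cube -> G}),
     cayley_auto f /\ carries (@z2cube_grading F) alpha D f).
Proof.
move=> DP; have [[a0 [a0D sa0 a00]]|no] :=
    pselect (exists a0, [/\ a0 \in D 0, skewc a0 & a0 != 0]).
  left; have [f [g1 [g2 [fP [[fe1 fe2] [fu1 fv1] [fu2 fv2] [fv0 fu0]]]]]] :=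
    cartan_type two_neq0 DP a0D sa0 a00.
  exists f, (cartan_map g1 g2); split=> // g x.
  rewrite cartan_gradingE => /memv_sumP[xs xsP ->].
  rewrite linear_sum; apply: rpred_sum => c /[dup] cg /xsP/vlineP[k ->].
  rewrite linearZ memvZ //= -(eqP cg).
  rewrite /cartan_map /pair_map /int_map /= {cg xsP}; move: c; apply: cayley_index_ind' => /=;
  by rewrite ?mulr1z ?mulr0z ?mulrN1z ?addr0 ?add0r.
right; have [|a [x [z [ga [gx [gz [tP [na nx nz] [aD xD zD] [Ha Hx Hz]]]]]]]] :=
    cube_type two_neq0 DP.
  move=> x x0 sx; apply/eqP; apply: contra_notT no => xN0; by exists x.
have [f fP fc] := homogeneous_triple Ha Hx Hz DP tP na nx nz aD xD zD.
by exists f, (cube_map Ha Hx Hz).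
Qed.

Lemma cube_double2 (t : cube) : t *+ 2 = 0.
Proof. exact: z2cube_double. Qed.

(** The hypotheses say that [t1], [t2], [t3] form a basis of [(Z/2)^3]; then the corresponding basis
    elements of C form an orthogonal triple. So every linear change of degrees is induced by an
    automorphism. *)
Lemma cube_change (t1 t2 t3 : cube) : [&& t1 != 0, t2 != 0 & t3 != 0] ->
  [&& t1 != t2, t1 != t3, t2 != t3 & t1 + t2 != t3] ->
  exists2 f, cayley_auto f & carries (@z2cube_grading F)
    (cube_map (cube_double2 t1) (cube_double2 t2) (cube_double2 t3)) (@z2cube_grading F) f.
Proof.
move=> /and3P[t10 t20 t30] /and4P[t12 t13 t23 t123].
have cP := z2cube_is_grading two_neq0.
have sb t : t != 0 -> skewc (std_basis F t).
  by move=> t0; have := cube_skew two_neq0 t0 (std_basis_mem F t).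
have orth t t' x y : t != t' -> x \in z2cube_grading F t -> y \in z2cube_grading F t' ->
    cbil x y = 0.
  move=> tt' xt yt'; apply: (D_cbil cP xt yt').
  by rewrite -(z2cube_double t') (inj_eq (addIr t')).
have mb := std_basis_mem F.
apply: (homogeneous_triple _ _ _ cP) (std_basis_norm F t1) (std_basis_norm F t2)
  (std_basis_norm F t3) (mb t1) (mb t2) (mb t3).
split; split; try exact: sb; try exact: orth (mb _) (mb _).
exact: orth t123 (D_mul cP (mb _) (mb _)) (mb _).
Qed.

Lemma skew_auto f x : cayley_auto f -> skewc x -> skewc (f x).
Proof.
move=> [_ _ fM] sx.
apply: (skew_bracket_ind (P := fun x => skewc (f x)) _ _ _ sx) => [y z|k y|y z].
- by rewrite linearD; apply: skewcD.
- by rewrite linearZ; apply: skewcZ.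
have -> : f (cbr y z) = cbr (f y) (f z) by rewrite linearB /= !fM.
exact: cbr_skew.
Qed.

Lemma skew_nondegenerate x : skewc x -> x != 0 -> exists2 y, skewc y & cbil x y != 0.
Proof.
move=> sx x0; apply: contrapT => H; case/eqP: x0; apply: cbil_nondegenerate => y.
apply/eqP; apply: contra_notT H => xy; exists (y - (2^-1 * ctr y) *: 1c).
  exact: half_skew.
by rewrite cbilDr cbilNr cbilZr cbil1 sx mulr0 oppr0 addr0.
Qed.

(** If [f x = 0], applying [f] to [cbr_cbr] for [w] and [x] gives [2 * cbil w x *: f w = 0], so [f]
    kills every skew [w] not orthogonal to [x]. These span C_0, since adding such a [y] to an
    orthogonal element gives another one. *)
Lemma bracket_map_injective (f : 'End(C)) x0 :
  (forall x y, skewc x -> skewc y -> f (cbr x y) = cbr (f x) (f y)) ->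
  skewc x0 -> f x0 != 0 -> forall x, skewc x -> f x = 0 -> x = 0.
Proof.
move=> fB sx0 fx0 x sx fx; apply/eqP; apply: contraT => xN0.
have [y sy xy] := skew_nondegenerate sx xN0.
have f0 w : skewc w -> cbil w x != 0 -> f w = 0.
  move=> sw wx; have := congr1 f (cbr_cbr sw sx).
  rewrite fB ?fB //; last exact: cbr_skew.
  rewrite fx /cbr !(mulc0l, mulc0r, subrr) linearD !linearZ /= fx scaler0 add0r => /esym/eqP.
  by rewrite scaler_eq0 mulf_eq0 (negPf two_neq0) (negPf wx) => /eqP.
have fy : f y = 0 by apply: f0; rewrite // cbilC.
case/negP: fx0; have [x0x|x0x] := eqVneq (cbil x0 x) 0; last by rewrite f0.
have : f (x0 + y) = 0.
  by apply: f0; [exact: skewcD|rewrite cbilDl x0x add0r cbilC].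
by rewrite linearD /= fy addr0 => ->.
Qed.

End CayleyTypes.


(** * The split case *)

Section Split.
Variable F : closedFieldType.
Local Notation C := (cayley F).
Local Notation A := (cayley2 F).
Local Notation "1c" := (cayley_one F).
Local Notation S := (skew_sum F).
Local Notation cube := ('Z_2 * 'Z_2 * 'Z_2)%type.
Hypothesis two_neq0 : (2 : F) != 0.
Variables (G : zmodType) (Gamma : G -> {vspace A}).
Hypothesis GammaP : is_grading (cayley2_mul F) Gamma.

Lemma one_degree0 : 1c *t 1c \in Gamma 0.
Proof.
have E z : (1c *t 1c) *** z = z /\ z *** (1c *t 1c) = z.
  move: z; apply: tensor_ind => [k z t [Hz Hz'] [Ht Ht']||x y].
  - by rewrite amulDr amulDl amulZr amulZl Hz Hz' Ht Ht'.
  - by rewrite amul0r amul0l.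
  - by rewrite !tensor_mul !mul1c !mulc1.
by apply: (grading_unit _ _ GammaP) => z; case: (E z).
Qed.

(** The projections commute with [j \o q] on [S], and the unit has degree zero, so they preserve the
    whole image of [j] and restrict to it. *)
Lemma split_factor (j : 'Hom(C, A)) (q : 'Hom(A, C)) :
  (forall x, q (j x) = x) -> (forall x y, j (x ** y) = j x *** j y) -> j 1c = 1c *t 1c ->
  (forall x, skewc x -> j x \in S) ->
  (forall g z, z \in S -> z \in Gamma g -> j (q z) \in Gamma g) ->
  is_grading (cayley_mul F) (fun g => j @^-1: Gamma g)%VS.
Proof.
move=> qj jM j1 jS jq; have [[s [p pP]] mG] := (is_gradingP _ _).1 GammaP.
have comm g z : z \in S -> p g (j (q z)) = j (q (p g z)).
  move: z; apply: (S_ind pP mG) => [z t _ _ Hz Ht||h z zh zS].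
  - by rewrite 3!linearD /= Hz Ht 3!linearD.
  - by rewrite !linear0.
  have jz := jq _ _ zS zh; have [->|gh] := eqVneq g h.
    by rewrite (proj_id pP jz) (proj_id pP zh).
  by rewrite (proj_neq pP jz gh) (proj_neq pP zh gh) !linear0.
have E g x : p g (j x) = j (q (p g (j x))).
  have E1 : p g (j 1c) = j (q (p g (j 1c))).
    have j10 : j 1c \in Gamma 0 by rewrite j1 one_degree0.
    have [->|g0] := eqVneq g 0; first by rewrite (proj_id pP j10) qj.
    by rewrite (proj_neq pP j10 g0) !linear0.
  have E0 u : skewc u -> p g (j u) = j (q (p g (j u))).
    by move=> su; rewrite -comm ?qj // jS.
  pose l : 'Hom(C, A) := (p g \o j)%VF; pose r : 'Hom(C, A) := (j \o (q \o (p g \o j)))%VF.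
  suff : l x = r x by rewrite !comp_lfunE.
  have l1 : l 1c = r 1c by rewrite !comp_lfunE.
  have D (f : 'Hom(C, A)) v (c : F) : f (v + c *: 1c) = f v + c *: f 1c.
    by rewrite linearD linearZ.
  rewrite -[x](subrK ((2^-1 * ctr x) *: 1c)) (D l) (D r) l1; congr (_ + _).
  by rewrite !comp_lfunE; apply/E0/half_skew.
apply/is_gradingP; split; last first.
  by move=> g h x y; rewrite -!memv_preim -[cayley_mul F x y]/(x ** y) jM; apply: mG.
exists s, (fun g => q \o p g \o j)%VF; split=> [|g x|x|g h x].
- by case: pP.
- by rewrite -memv_preim !comp_lfunE -E (proj_mem pP).
- under eq_bigr => g _ do rewrite !comp_lfunE.
  by rewrite -linear_sum /= (proj_sum pP) qj.
rewrite -memv_preim !comp_lfunE => jx; have [->|gh] := eqVneq g h.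
  by rewrite (proj_id pP jx) qj.
by rewrite (proj_neq pP jx gh) linear0.
Qed.

Hypothesis split : forall g z, z \in S -> z \in Gamma g -> eps1 F z \in Gamma g.

Lemma split_factor1 : is_grading (cayley_mul F) (fun g => j1 F @^-1: Gamma g)%VS.
Proof.
apply: (split_factor (q := q1 F)) => [x|x y|||g z zS zg].
- exact: q1_j1.
- exact: j1M.
- exact: j1E.
- by move=> x; apply: mem_S1.
- by have := split zS zg; rewrite comp_lfunE.
Qed.

Lemma split_factor2 : is_grading (cayley_mul F) (fun g => j2 F @^-1: Gamma g)%VS.
Proof.
apply: (split_factor (q := q2 F)) => [x|x y|||g z zS zg].
- exact: q2_j2.
- exact: j2M.
- exact: j2E.
- by move=> x; apply: mem_S2.
have := split zS zg; case/mem_skew_sum: zS zg => x [y [sx sy ->]] zg.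
by rewrite eps1_j // q2_j // => xg; rewrite -[j2 F y](addKr (j1 F x)) memvD ?memvN.
Qed.

Lemma tmap_carries (K1 K2 : zmodType) (D1 : K1 -> {vspace C}) (D2 : K2 -> {vspace C})
    (a1 : K1 -> G) (a2 : K2 -> G) f1 f2 :
  carries D1 a1 (fun g => j1 F @^-1: Gamma g)%VS f1 ->
  carries D2 a2 (fun g => j2 F @^-1: Gamma g)%VS f2 ->
  forall d, (tmap f1 f2 @: tensor_grading D1 D2 d <= Gamma (a1 d.1 + a2 d.2))%VS.
Proof.
move=> c1 c2 [k l]; apply/subvP => _ /memv_imgP[z zd ->]; move: z zd.
apply: tensor_space_ind => [c z t Hz Ht||x y xk yl].
- by rewrite linearP memvD // memvZ.
- by rewrite linear0 mem0v.
rewrite tmapE -j12M; apply: (grading_mul GammaP).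
  by have := c1 k x xk; rewrite -memv_preim.
by have := c2 l y yl; rewrite -memv_preim.
Qed.

Lemma split_equivalent : is_fine_grading (cayley2_mul F) Gamma ->
  [\/ equivalent_gradings (cayley2_mul F) (cayley2_mul F) Gamma
        (tensor_grading (@cartan_grading F) (@cartan_grading F)),
      equivalent_gradings (cayley2_mul F) (cayley2_mul F) Gamma
        (tensor_grading (@cartan_grading F) (@z2cube_grading F))
    | equivalent_gradings (cayley2_mul F) (cayley2_mul F) Gamma
        (tensor_grading (@z2cube_grading F) (@z2cube_grading F))].
Proof.
move=> fine.
have cP := cartan_is_grading F; have zP := z2cube_is_grading two_neq0.
have TP (K L : zmodType) D1 D2 := @tensor_is_grading F K L D1 D2.
have [[f1 [a1 [f1P c1]]]|[f1 [a1 [f1P c1]]]] := cayley_type two_neq0 split_factor1;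
have [[f2 [a2 [f2P c2]]]|[f2 [a2 [f2P c2]]]] := cayley_type two_neq0 split_factor2.
- constructor 1; apply: (fine_equivalent GammaP (TP _ _ _ _ cP cP) fine (tmap_iso f1P f2P)).
  exact: tmap_carries c1 c2.
- constructor 2; apply: (fine_equivalent GammaP (TP _ _ _ _ cP zP) fine (tmap_iso f1P f2P)).
  exact: tmap_carries c1 c2.
(* The two types occur in the opposite order, which [swap] corrects. *)
- constructor 2; apply: (fine_equivalent GammaP (TP _ _ _ _ cP zP) fine
    (iso_comp (tmap_iso f1P f2P) (swap_iso F)) (a := fun d => a1 d.2 + a2 d.1)).
  move=> [k l]; apply/subvP => _ /memv_imgP[z zd ->]; rewrite comp_lfunE.
  apply: (subvP (tmap_carries c1 c2 (l, k))); apply: memv_img.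
  move: z zd; apply: tensor_space_ind => [c z t Hz Ht||x y xk yl].
  + by rewrite linearP memvD // memvZ.
  + by rewrite linear0 mem0v.
  by rewrite swapE mem_tensor_space.
- constructor 3; apply: (fine_equivalent GammaP (TP _ _ _ _ zP zP) fine (tmap_iso f1P f2P)).
  exact: tmap_carries c1 c2.
Qed.

End Split.


Section HalfTrace.
Variable F : closedFieldType.
Local Notation C := (cayley F).
Local Notation "1c" := (cayley_one F).
Hypothesis two_neq0 : (2 : F) != 0.

Definition half_trace : 'End(C) :=
  lin_ext (fun c => match c with E1 | E2 => (2^-1 : F) *: 1c | _ => 0 end).

Lemma half_traceE x : half_trace x = (2^-1 * ctr x) *: 1c.
Proof.
by rewrite lin_extE sum_cayley /= !scaler0 !addr0 !scalerA -scalerDl -mulrDl -ctrE mulrC.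
Qed.

Lemma cbr_half_trace x y : cbr (x - half_trace x) (y - half_trace y) = cbr x y.
Proof.
rewrite !half_traceE -!scaleN1r !scalerA !(cbrDl, cbrDr) !(cbrZl, cbrZr) !(cbr1l, cbr1r).
by rewrite !scaler0 !addr0.
Qed.

Section Components.
Variables (K : zmodType) (D : K -> {vspace C}) (s : seq K) (p : K -> 'End(C)).
Hypotheses (DP : is_grading (cayley_mul F) D) (pP : projections D s p).

Lemma ctr_proj k x : ctr (p k x) = if k == 0 then ctr x else 0.
Proof.
move: x; apply: (homogeneous_ind pP) => [x y Hx Hy||l x xl].
- by rewrite linearD /= !ctrD Hx Hy; case: ifP; rewrite ?addr0.
- by rewrite linear0 ctr0 if_same.
have [->|kl] := eqVneq k l.
  by rewrite (proj_id pP xl); case: eqP => // /eqP l0; apply: D_trace xl l0.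
rewrite (proj_neq pP xl kl) ctr0; case: eqP => // k0.
by rewrite (D_trace DP xl) // -k0 eq_sym.
Qed.

Lemma skew_proj k x : skewc x -> skewc (p k x).
Proof. by rewrite /skewc ctr_proj => ->; rewrite if_same. Qed.

Lemma skew_part_homogeneous k x : x \in D k -> x - half_trace x \in D k.
Proof.
move=> xk; rewrite memvB // half_traceE; have [->|k0] := eqVneq k 0.
  by rewrite memvZ // (D_one DP).
by rewrite (D_trace DP xk k0) mulr0 scale0r mem0v.
Qed.

End Components.
End HalfTrace.

(** * The twisted case: components of [S] as graphs *)

Section Twisted.
Variable F : closedFieldType.
Local Notation C := (cayley F).
Local Notation A := (cayley2 F).
Local Notation "1c" := (cayley_one F).
Local Notation S := (skew_sum F).
Hypothesis two_neq0 : (2 : F) != 0.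
Variables (G : zmodType) (Gamma : G -> {vspace A}) (s : seq G) (p : G -> 'End(A)).
Hypotheses (pP : projections Gamma s p) (mG : graded_mul (cayley2_mul F) Gamma).
Variable h : G.
Hypotheses (h0 : h != 0) (hh : h + h = 0).
Hypothesis twist : forall g x y, skewc x -> skewc y ->
  j1 F x + j2 F y \in Gamma g -> j1 F x - j2 F y \in Gamma (g + h).
Implicit Types (x y : C) (g : G).

Local Notation I := (generated_subgroup (fun g : G => g = h)).
Local Notation Gq := (Quotient.quot I).
Local Notation pi := (quotient_map I).

Lemma pi_eq g g' : pi g = pi g' <-> g = g' \/ g = g' + h.
Proof.
rewrite quotient_map_eq; split=> [/asboolP H|H].
  have [E|E] : g - g' = 0 \/ g - g' = h.
  - elim: H => [|x ->|x y _ Hx _ Hy]; [by left|by right|].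
    have hN : - h = h by apply/eqP; rewrite eq_sym -addr_eq0 hh.
    by case: Hx => ->; case: Hy => ->; rewrite ?subrr ?subr0 ?sub0r ?hN; [left|right|right|left].
  - by left; apply/subr0_eq.
  - by right; rewrite -E addrC subrK.
apply/asboolP; case: H => ->; first by rewrite subrr; apply: in_gen_zero.
by rewrite addrAC subrr add0r; apply: in_gen_mem.
Qed.

Let Gb : Gq -> {vspace A} := coarsening s pi Gamma.

Lemma quotient_is_grading : is_grading (cayley2_mul F) Gb.
Proof.
apply/is_gradingP; split; last first.
  by apply: (coarsening_multiplicative pP mG) => g g' x y _ _ _; rewrite raddfD.
by exists (undup (map pi s)), (coarse_proj s p pi); exact: (coarsening_projections _ pP).
Qed.

(** Twice [eps1 z] is the sum of [z] and its twist, whose degrees [g] and [g + h] agree modulo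
    [h]. *)
Lemma twist_eps1 g z : z \in S -> z \in Gamma g -> eps1 F z \in Gb (pi g).
Proof.
case/mem_skew_sum => x [y [sx sy ->]] zg; rewrite eps1_j //.
have := twist sx sy zg => zgh.
rewrite (half_sum two_neq0 (j1 F x) (j2 F y)) memvZ // memvD //.
  exact: (mem_coarsening pi pP zg).
have := mem_coarsening pi pP zgh; rewrite (_ : pi (g + h) = pi g) //.
by apply/pi_eq; right.
Qed.

Lemma quotient_split k z : z \in S -> z \in Gb k -> eps1 F z \in Gb k.
Proof.
move=> zS zk; rewrite -(proj_id (coarsening_projections pi pP) zk) coarse_projE.
rewrite linear_sum; apply: rpred_sum => g /eqP <-.
by apply: twist_eps1; [exact: (S_proj pP mG)|exact: (proj_mem pP)].
Qed.

Definition quotient_factor : Gq -> {vspace C} := fun k => (j1 F @^-1: Gb k)%VS.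

Lemma quotient_factor_is_grading : is_grading (cayley_mul F) quotient_factor.
Proof. exact: (split_factor1 two_neq0 quotient_is_grading quotient_split). Qed.

(** The component of degree [g] of [S] as a relation between the two copies of C_0. The lemmas below
    show that it is the graph of an injective map compatible with brackets. *)
Definition related g x y : Prop := [/\ skewc x, skewc y & j1 F x + j2 F y \in Gamma g].

Lemma related_opp g x y : related g x y -> related (g + h) x (- y).
Proof.
by case=> sx sy xy; split; [|exact: skewcN|rewrite linearN; apply: twist].
Qed.

Lemma related_scale g x y (c : F) : related g x y -> related g (c *: x) (c *: y).
Proof.
by case=> sx sy xy; split; rewrite ?j1Z ?j2Z -?scalerDr ?memvZ //; exact: skewcZ.
Qed.

Lemma neq_shift g : g != g + h.
Proof. by rewrite -subr_eq0 opprD addrA subrr sub0r oppr_eq0. Qed.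

(** Twisting shows that [j2 y] has both degrees [g] and [g + h]. *)
Lemma related0 g y : related g 0 y -> y = 0.
Proof.
move=> r; have [_ sy] := r; have [_ _] := related_opp r.
rewrite j10 !add0r linearN memvN => H1 H2; apply: (j2_inj two_neq0).
rewrite j20; apply/eqP; apply: contraT => y0; case/eqP: (neq_shift g).
by have := homogeneous_degree_uniq pP y0 H2 H1.
Qed.

Lemma related_zero g x : related g x 0 -> x = 0.
Proof.
move=> r; have [sx _] := r; have [_ _] := related_opp r.
rewrite oppr0 j20 !addr0 => H1 H2; apply: (j1_inj two_neq0).
rewrite j10; apply/eqP; apply: contraT => y0; case/eqP: (neq_shift g).
by have := homogeneous_degree_uniq pP y0 H2 H1.
Qed.

Lemma related_uniq g x y y' : related g x y -> related g x y' -> y = y'.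
Proof.
case=> sx sy H [_ sy' H']; apply/subr0_eq; apply: (@related0 g); split.
- exact: skewc0.
- by apply: skewcD => //; apply: skewcN.
by rewrite j10 add0r j2B; have := memvB H H'; rewrite opprD addrACA subrr add0r.
Qed.

Lemma related_cbr g g' x y x' y' : related g x y -> related g' x' y' ->
  related (g + g') (cbr x x') (cbr y y').
Proof.
case=> sx sy H [sx' sy' H']; split; try exact: cbr_skew.
by rewrite -abr_j; apply: Gamma_abr mG _ _ _ _ H H'.
Qed.

(** If [x] is related to [y] in degree [g], then [j1 x] is the half sum of [j1 x + j2 y] and its
    twist, and its part of degree [g] is half of [j1 x + j2 y]: hence the factor 2. *)
Definition partner g : 'End(C) := (2 *: (q2 F \o (p g \o j1 F)))%VF.

Lemma related_partner g x : skewc x -> x \in quotient_factor (pi g) -> related g x (partner g x).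
Proof.
move=> sx; rewrite -memv_preim => xg.
have ghh : g + h + h = g by rewrite -addrA hh addr0.
set w := p g (j1 F x); set v := p (g + h) (j1 F x).
have wg : w \in Gamma g by exact: (proj_mem pP).
have vg : v \in Gamma (g + h) by exact: (proj_mem pP).
have xE : j1 F x = w + v.
  apply/subr0_eq; rewrite -(proj_sum pP (_ - _)) big1 // => k _.
  rewrite linearB linearD /=; have [->|kg] := eqVneq k g.
    by rewrite (proj_id pP wg) (proj_neq pP vg (neq_shift g)) addr0 subrr.
  have [->|kgh] := eqVneq k (g + h).
    by rewrite (proj_id pP vg) (proj_neq pP wg) ?add0r ?subrr // eq_sym neq_shift.
  rewrite (proj_neq pP wg kg) (proj_neq pP vg kgh) addr0 subr0.
  apply: (mem_coarseningP pi pP _ _ xg); apply/eqP => /pi_eq[/eqP|/eqP].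
    by rewrite (negPf kg).
  by rewrite (negPf kgh).
have jS := mem_S1 sx.
have /mem_skew_sum[a [b [sa sb wE]]] : w \in S by exact: (S_proj pP mG).
have /mem_skew_sum[c [d [sc sd vE]]] : v \in S by exact: (S_proj pP mG).
have w'g : j1 F a - j2 F b \in Gamma (g + h) by apply: twist => //; rewrite -wE.
have v'g : j1 F c - j2 F d \in Gamma g by rewrite -ghh; apply: twist => //; rewrite -vE.
have [xac bd] : x = a + c /\ 0 = b + d.
  apply: (j12_inj two_neq0 sx (skewc0 F) (skewcD sa sc) (skewcD sb sd)).
  by rewrite j20 addr0 xE wE vE addrACA -j1D -j2D.
(* The twists of [w] and [v] also add up to [j1 x], with degrees exchanged, so [w] is the twist of
   [v]. *)
have wv : w = j1 F c - j2 F d.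
  have : p g (w + v) = p g ((j1 F a - j2 F b) + (j1 F c - j2 F d)).
    by rewrite -xE addrACA -opprD -j1D -j2D -xac -bd j20 subr0.
  rewrite linearD /= (proj_id pP wg) (proj_neq pP vg (neq_shift g)) addr0 => ->.
  by rewrite linearD /= (proj_id pP v'g) (proj_neq pP w'g (neq_shift g)) add0r.
have [ac _] : a = c /\ b = - d.
  apply: (j12_inj two_neq0 sa sb sc (skewcN sd)).
  by rewrite -wE wv linearN.
have -> : partner g x = 2 *: b.
  by rewrite scale_lfunE !comp_lfunE -/w wE q2_j.
rewrite xac -ac -mulr2n -scaler_nat; apply: related_scale.
by split=> //; rewrite -wE.
Qed.

Section Model.
Variables (K E : zmodType) (D : K -> {vspace C}) (sK : seq K) (pK : K -> 'End(C)).
Hypotheses (DP : is_grading (cayley_mul F) D) (pKP : projections D sK pK).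
Variables (bar : {additive E -> K}) (lift : K -> E) (chi : E -> F) (eps : E).
Hypothesis tP : twist_data bar lift chi eps.
Variables (phi : 'End(C)) (beta : K -> Gq) (hat : {additive E -> G}).
Hypotheses (phiP : cayley_auto phi) (phi_carries : carries D beta quotient_factor phi).
Hypotheses (hat_eps : hat eps = h) (hat_pi : forall d, pi (hat d) = beta (bar d)).

(** Division by [chi] makes the result independent of the lift of each degree [k]. *)
Definition partner_map : 'End(C) :=
  \sum_(k <- sK) (chi (lift k))^-1 *: (partner (hat (lift k)) \o (phi \o pK k))%VF.

Definition second : 'End(C) :=
  (half_trace F + (partner_map \o (\1 - half_trace F)))%VF.

Lemma second_def x : second x = half_trace F x + partner_map (x - half_trace F x).
Proof. by rewrite add_lfunE comp_lfunE add_lfunE opp_lfunE id_lfunE. Qed.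

Lemma second_skewE x : skewc x -> second x = partner_map x.
Proof.
by move=> sx; rewrite second_def half_traceE sx mulr0 scale0r subr0 add0r.
Qed.

Lemma second1 : second 1c = 1c.
Proof.
have -> : second 1c = 1c + partner_map (1c - 1c).
  by rewrite second_def half_traceE ctr1 mulVf // scale1r.
by rewrite subrr linear0 addr0.
Qed.

(** Adding [eps] to a lift moves the degree in [G] by [h], which changes the sign of the partner,
    and it changes the sign of [chi] as well. *)
Lemma related_second d x : x \in D (bar d) -> skewc x ->
  skewc (second x) /\ related (hat d) (phi x) (chi d *: second x).
Proof.
move=> xd sx; set k := bar d.
have chi0 e : chi e != 0 by exact: (chi_neq0 tP).
have sE : second x = (chi (lift k))^-1 *: partner (hat (lift k)) (phi x).
  have uK : uniq sK by case: pKP.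
  rewrite second_skewE // sum_lfunE.
  under eq_bigr => l _ do rewrite scale_lfunE !comp_lfunE.
  have [ks|ks] := boolP (k \in sK); last first.
    have -> : x = 0 by move: xd; rewrite (proj_supp pKP ks) memv0 => /eqP.
    by rewrite !linear0 big1 // => l _; rewrite !linear0.
  rewrite (bigD1_seq k) //= (proj_id pKP xd) big1 ?addr0 // => l lk.
  by rewrite (proj_neq pKP xd lk) !linear0.
have sphi := skew_auto phiP sx.
have r : related (hat (lift k)) (phi x) (chi (lift k) *: second x).
  rewrite sE scalerA mulfV // scale1r; apply: related_partner => //.
  by rewrite hat_pi (twist_lift tP); apply: phi_carries.
split.
  have [_ + _] := r; move=> /(skewcZ (chi (lift k))^-1).
  by rewrite scalerA mulVf // scale1r.
have [E1|E1] : lift k = d \/ lift k = d + eps.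
  by apply: (bar_eq tP); rewrite (twist_lift tP).
  by move: r; rewrite E1.
have := related_opp r; rewrite E1 raddfD /= hat_eps (chi_add_eps tP) scaleNr opprK.
by rewrite -addrA hh addr0.
Qed.

Lemma second_skew x : skewc x -> skewc (second x).
Proof.
move=> sx; rewrite -(proj_sum pKP x) linear_sum /=.
elim/big_ind: _ => [|y z|k _]; [exact: skewc0|exact: skewcD|].
have xk : pK k x \in D (bar (lift k)) by rewrite (twist_lift tP) (proj_mem pKP).
by have [] := related_second xk (skew_proj DP pKP k sx).
Qed.

Lemma second_trace x : second x = half_trace F x + second (x - half_trace F x).
Proof.
rewrite second_def second_skewE //; rewrite half_traceE; exact: half_skew.
Qed.

(** For homogeneous skew [x] and [y], both sides times the same value of [chi] are related to
    [phi (cbr x y)] in the same degree, because [chi] is multiplicative and [hat] additive;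
    [related_uniq] concludes. *)
Lemma second_cbr x y : second (cbr x y) = cbr (second x) (second y).
Proof.
have secondD u v : second (u + v) = second u + second v by exact: linearD.
move: x; apply: (homogeneous_ind pKP) => [x x' Hx Hx'||k x xk].
- by rewrite cbrDl secondD Hx Hx' secondD cbrDl.
- have c0 z : cbr 0 z = 0 by rewrite /cbr mulc0l mulc0r subrr.
  by rewrite c0 !linear0 c0.
move: y; apply: (homogeneous_ind pKP) => [y y' Hy Hy'||l y yl].
- by rewrite cbrDr secondD Hy Hy' secondD cbrDr.
- have c0 z : cbr z 0 = 0 by rewrite /cbr mulc0l mulc0r subrr.
  by rewrite c0 !linear0 c0.
have cbr1D (u v : C) (c c' : F) : cbr (c *: 1c + u) (c' *: 1c + v) = cbr u v.
  rewrite !(cbrDl, cbrDr) !(cbrZl, cbrZr) !(cbr1l, cbr1r).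
  by rewrite !scaler0 !add0r.
rewrite (second_trace x) (second_trace y) -(cbr_half_trace x y).
have sx0 : skewc (x - half_trace F x) by rewrite half_traceE; exact: half_skew.
have sy0 : skewc (y - half_trace F y) by rewrite half_traceE; exact: half_skew.
have := skew_part_homogeneous DP xk; have := skew_part_homogeneous DP yl.
rewrite (half_traceE x) (half_traceE y) cbr1D -(half_traceE x) -(half_traceE y).
move: (x - _) (y - _) sx0 sy0 => {xk yl}x {}y sx sy yl xk.
move: xk yl; rewrite -(twist_lift tP k) -(twist_lift tP l) => xk yl.
have [_ rx] := related_second xk sx; have [_ ry] := related_second yl sy.
have xy : cbr x y \in D (bar (lift k + lift l)).
  rewrite raddfD memvB //; first exact: (D_mul DP).
  by rewrite addrC; exact: (D_mul DP).
have [_ rxy] := related_second xy (cbr_skew x y).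
have := related_cbr rx ry; rewrite -raddfD => r.
have phiB : phi (cbr x y) = cbr (phi x) (phi y).
  by have [_ _ pM] := phiP; rewrite linearB /= !pM.
rewrite phiB in rxy; have := related_uniq rxy r.
rewrite cbrZl cbrZr scalerA -(twist_chiD tP) => /scalerI; apply.
exact: (chi_neq0 tP).
Qed.

(** [second] is injective on homogeneous skew elements, so it is nonzero on C_0. This suffices for
    injectivity by [bracket_map_injective], and [bracket_automorphism] applies. *)
Lemma second_auto : cayley_auto second.
Proof.
have [phiK _ _] := iso_inv phiP.
have homog_inj k x : x \in D k -> skewc x -> second x = 0 -> x = 0.
  rewrite -(twist_lift tP k) => xk sx x0; have [_] := related_second xk sx.
  by rewrite x0 scaler0 => /related_zero/(congr1 (phi^-1)%VF); rewrite phiK linear0.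
have [x0 [sx0 fx0]] : exists x0, skewc x0 /\ second x0 != 0.
  apply: contrapT => H; have := onec_neq0 F; suff u0 : e1 F - e2 F = 0.
    have [_ [nu _ _]] := std_triple F; move: nu; rewrite u0 -(scale0r 0) cnormZ expr2 !mul0r.
    by move/esym/eqP; rewrite oppr_eq0 oner_eq0.
  rewrite -(proj_sum pKP (_ - _)) big1 // => k _; have sk := skew_proj DP pKP k (skew_u F).
  apply: homog_inj (proj_mem pKP k _) sk _; apply/eqP; apply: contra_notT H => pk0.
  exists (pK k (e1 F - e2 F)); split=> //.
  by have := skew_proj DP pKP k (skew_u F).
have inj := bracket_map_injective two_neq0 (fun x y _ _ => second_cbr x y) sx0 fx0.
apply: (bracket_automorphism two_neq0) second1 second_skew second_cbr _ => x fx.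
have sxh : skewc (x - half_trace F x) by rewrite half_traceE; exact: half_skew.
have tx : ctr x = 0.
  have := congr1 (@ctr F) fx; rewrite second_trace ctrD (second_skew sxh) addr0 ctr0.
  by rewrite half_traceE ctrZ ctr1 mulrAC mulVf // mul1r.
exact: inj tx fx.
Qed.

Lemma twisted_carries (Lambda : E -> {vspace A}) : twisted_by D bar chi Lambda ->
  forall d, (tmap phi second @: Lambda d <= Gamma (hat d))%VS.
Proof.
move=> [LP LS]; pose f := tmap phi second.
have [[sL [pL pLP]] mL] := (is_gradingP _ _).1 LP.
have [_ _ fM] := tmap_iso phiP second_auto.
have [_ _ phiM] := phiP.
have phi1 : phi 1c = 1c.
  have [phiK phiVK _] := iso_inv phiP.
  have phiM' x y : phi (x ** y) = phi x ** phi y by exact: phiM.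
  by rewrite -[LHS]mulc1 -{2}(phiVK 1c) -phiM' mul1c phiVK.
have H : forall d, (Lambda d <= f @^-1: Gamma (hat d))%VS.
  apply: (S_generates two_neq0 pLP mL (Delta := fun g => f @^-1: Gamma g)%VS).
    by move=> g g' x y; rewrite -!memv_preim fM; apply: mG.
  move=> d; apply/subvP => z /LS[x [xd sx ->]]; rewrite -memv_preim.
  rewrite /f linearD linearZ /= j1E j2E !tmapE phi1 second1 -j1E -j2E -j2Z.
  by have [_ []] := related_second xd sx.
by move=> d; apply/subvP => _ /memv_imgP[z zd ->]; have := subvP (H d) z zd; rewrite -memv_preim.
Qed.

End Model.
End Twisted.


(** * Lifting degrees through the quotient by [h] *)

Section TwistedCases.
Variable F : closedFieldType.
Local Notation C := (cayley F).
Local Notation A := (cayley2 F).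
Local Notation cube := ('Z_2 * 'Z_2 * 'Z_2)%type.
Local Notation equivalent := (equivalent_gradings (cayley2_mul F) (cayley2_mul F)).
Hypothesis two_neq0 : (2 : F) != 0.
Variables (i : F) (i2 : i ^+ 2 = -1).
Variables (Gamma4 : 'Z_2 * (int * int) -> {vspace A}) (Gamma5 : 'Z_2 * cube -> {vspace A}).
Variable Gamma6 : 'Z_4 * 'Z_2 * 'Z_2 -> {vspace A}.
Hypothesis G4P : twisted_by (@cartan_grading F) snd
  (fun d : 'Z_2 * (int * int) => (-1) ^+ d.1) Gamma4.
Hypothesis G5P : twisted_by (@z2cube_grading F) snd (fun d : 'Z_2 * cube => (-1) ^+ d.1) Gamma5.
Hypothesis G6P : twisted_by (@z2cube_grading F) bar6
  (fun d : 'Z_4 * 'Z_2 * 'Z_2 => i ^+ d.1.1) Gamma6.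
Variables (G : zmodType) (Gamma : G -> {vspace A}).
Hypothesis fine : is_fine_grading (cayley2_mul F) Gamma.
Variable h : G.
Hypotheses (h0 : h != 0) (hh : h + h = 0).
Hypothesis twist : forall g x y, skewc x -> skewc y ->
  j1 F x + j2 F y \in Gamma g -> j1 F x - j2 F y \in Gamma (g + h).
Variables (s : seq G) (p : G -> 'End(A)).
Hypotheses (pP : projections Gamma s p) (mG : graded_mul (cayley2_mul F) Gamma).

Local Notation pi := (quotient_map (generated_subgroup (fun g : G => g = h))).
Local Notation Gq := (Quotient.quot (generated_subgroup (fun g : G => g = h))).
Local Notation D := (@quotient_factor F G Gamma s h).

Let h2 : h *+ 2 = 0. Proof. exact: hh. Qed.
Let pi_h : pi h = 0.
Proof. by rewrite -(raddf0 pi); apply/(pi_eq hh); right; rewrite add0r. Qed.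

Let piD x y : pi (x + y) = pi x + pi y. Proof. exact: raddfD. Qed.
Let piMn x n : pi (x *+ n) = pi x *+ n. Proof. exact: raddfMn. Qed.
Let piMz x n : pi (x *~ n) = pi x *~ n. Proof. exact: (raddfMz pi). Qed.

(** Reduces the twisted case to a question on groups: find [hat] into [G] that sends [eps] to [h]
    and lifts [beta] along [bar]. *)
Lemma model_equivalent (K E : zmodType) (DK : K -> {vspace C}) (bar : {additive E -> K})
    (lift : K -> E) (chi : E -> F) (eps : E) (Lambda : E -> {vspace A})
    (phi : 'End(C)) (beta : K -> Gq) (hat : {additive E -> G}) :
  is_grading (cayley_mul F) DK -> twist_data bar lift chi eps ->
  twisted_by DK bar chi Lambda -> cayley_auto phi -> carries DK beta D phi ->
  hat eps = h -> (forall d, pi (hat d) = beta (bar d)) -> equivalent Gamma Lambda.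
Proof.
move=> DP tP LP phiP phiD hat_eps hat_pi.
have [[sK [pK pKP]] _] := (is_gradingP _ _).1 DP.
have sP := second_auto two_neq0 pP mG h0 hh twist DP pKP tP phiP phiD hat_eps hat_pi.
apply: (fine_equivalent fine.1 LP.1 fine (tmap_iso phiP sP) (a := hat)) => d.
exact: (twisted_carries two_neq0 pP mG h0 hh twist DP pKP tP phiP phiD hat_eps hat_pi LP d).
Qed.

(** [Z^2] is free, so [alpha] always lifts to [G]. *)
Lemma cartan_case phi (alpha : {additive int * int -> Gq}) :
  cayley_auto phi -> carries (@cartan_grading F) alpha D phi -> equivalent Gamma Gamma4.
Proof.
move=> phiP phiD; have [a aE] := quotient_map_surj (alpha (1, 0)).
have [b bE] := quotient_map_surj (alpha (0, 1)).
pose hat : {additive 'Z_2 * (int * int) -> G} := pair_map (ord_map h2) (cartan_map a b).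
apply: (model_equivalent (hat := hat) (cartan_is_grading F) (twist_data_Z2 F _) G4P phiP phiD).
  by rewrite [LHS](_ : _ = h *+ 1 + cartan_map a b 0) // raddf0 addr0.
move=> [k [m n]]; rewrite [LHS](_ : _ = pi (h *+ k + (a *~ m + b *~ n))) //.
rewrite !piD piMn !piMz pi_h mul0rn add0r aE bE.
by rewrite [in RHS]pair_int raddfD !raddfMz.
Qed.

Lemma cube_int (t : cube) :
  t = (1, 0, 0) *+ t.1.1 + (0, 1, 0) *+ t.1.2 + (0, 0, 1) *+ t.2.
Proof.
by case: t => [[k m] n]; move: k m n; do 3!apply: Z2_ind; congr (_, _, _); apply: val_inj.
Qed.

Section Cube.
Variables (phi : 'End(C)) (alpha : {additive cube -> Gq}).
Hypotheses (phiP : cayley_auto phi) (phiD : carries (@z2cube_grading F) alpha D phi).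

Lemma cube_case_split a b c : a *+ 2 = 0 -> b *+ 2 = 0 -> c *+ 2 = 0 ->
  pi a = alpha (1, 0, 0) -> pi b = alpha (0, 1, 0) -> pi c = alpha (0, 0, 1) ->
  equivalent Gamma Gamma5.
Proof.
move=> Ha Hb Hc aE bE cE.
pose hat : {additive 'Z_2 * cube -> G} := pair_map (ord_map h2) (cube_map Ha Hb Hc).
have cP := z2cube_is_grading two_neq0.
apply: (model_equivalent (hat := hat) cP (twist_data_Z2 F _) G5P phiP phiD).
  by rewrite [LHS](_ : _ = h *+ 1 + cube_map Ha Hb Hc 0) // raddf0 addr0.
move=> [k [[l m] n]].
rewrite [LHS](_ : _ = pi (h *+ k + (a *+ l + b *+ m + c *+ n))) //.
rewrite !piD !piMn pi_h mul0rn add0r aE bE cE.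
by rewrite [in RHS](cube_int (l, m, n)) !raddfD !raddfMn.
Qed.

(** As [2a = h] and [2h = 0], the lift [a] receives the factor [Z/4]; [cube_change] moves the basis
    [t1], [t2], [t3] to the standard one. *)
Lemma cube_case_nonsplit t1 t2 t3 a b c : [&& t1 != 0, t2 != 0 & t3 != 0] ->
  [&& t1 != t2, t1 != t3, t2 != t3 & t1 + t2 != t3] ->
  a + a = h -> b *+ 2 = 0 -> c *+ 2 = 0 ->
  pi a = alpha t1 -> pi b = alpha t2 -> pi c = alpha t3 -> equivalent Gamma Gamma6.
Proof.
move=> t_neq0 t_free Ha Hb Hc aE bE cE.
have Ha4 : a *+ 4 = 0 by rewrite (mulrnA _ 2 2) [a *+ 2]Ha.
pose hat : {additive 'Z_4 * 'Z_2 * 'Z_2 -> G} :=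
  pair_map (pair_map (ord_map Ha4) (ord_map Hb)) (ord_map Hc).
have [theta thetaP thetaD] := cube_change two_neq0 t_neq0 t_free.
have cP := z2cube_is_grading two_neq0.
set T := cube_map _ _ _ in thetaD.
have ptD : carries (@z2cube_grading F) (fun g => alpha (T g)) D (phi \o theta)%VF.
  by move=> g x xg; rewrite comp_lfunE; apply/phiD/thetaD.
apply: (model_equivalent (hat := hat) cP (twist_data_Z4 i2) G6P (iso_comp phiP thetaP) ptD).
  by rewrite [LHS](_ : _ = a *+ 2 + b *+ 0 + c *+ 0) // !mulr0n !addr0.
move=> [[k m] n]; rewrite [LHS](_ : _ = pi (a *+ k + b *+ m + c *+ n)) //.
rewrite [RHS](_ : _ = alpha (t1 *+ (mod2 k) + t2 *+ m + t3 *+ n)) //.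
rewrite !piD !piMn !raddfD !raddfMn aE bE cE; congr (_ + _ + _).
have a2 : alpha t1 *+ 2 = 0 by rewrite -raddfMn cube_double2 raddf0.
have a3 : alpha t1 *+ 3 = alpha t1 by rewrite mulrSr a2 add0r.
by move: k; apply: Z4_ind.
Qed.

(** A lift of an element of [(Z/2)^3] doubles to [0] or [h], and the sum of two lifts doubling to
    [h] doubles to [0]. So either three basis lifts all double to zero, or the basis can be changed
    so that exactly one of them doubles to [h]. *)
Lemma cube_case : equivalent Gamma Gamma5 \/ equivalent Gamma Gamma6.
Proof.
have [a aE] := quotient_map_surj (alpha (1, 0, 0)).
have [b bE] := quotient_map_surj (alpha (0, 1, 0)).
have [c cE] := quotient_map_surj (alpha (0, 0, 1)).
have dbl x t : pi x = alpha t -> x + x = 0 \/ x + x = h.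
  move=> xE; have /(pi_eq hh) : pi (x + x) = pi 0.
    by rewrite piD xE -raddfD z2cube_double !raddf0.
  by rewrite add0r.
have abE : pi (a + b) = alpha ((1, 0, 0) + (0, 1, 0)) by rewrite piD raddfD aE bE.
have acE : pi (a + c) = alpha ((1, 0, 0) + (0, 0, 1)) by rewrite piD raddfD aE cE.
have bcE : pi (b + c) = alpha ((0, 1, 0) + (0, 0, 1)) by rewrite piD raddfD bE cE.
have dd x y : x + x = h -> y + y = h -> (x + y) *+ 2 = 0.
  by move=> xh yh; rewrite mulr2n addrACA xh yh.
have [Ha|Ha] := dbl _ _ aE; have [Hb|Hb] := dbl _ _ bE; have [Hc|Hc] := dbl _ _ cE.
- left; exact: cube_case_split Ha Hb Hc aE bE cE.
- right; exact: cube_case_nonsplit Hc Ha Hb cE aE bE.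
- right; exact: cube_case_nonsplit Hb Ha Hc bE aE cE.
- right; exact: cube_case_nonsplit Hb Ha (dd _ _ Hb Hc) bE aE bcE.
- right; exact: cube_case_nonsplit Ha Hb Hc aE bE cE.
- right; exact: cube_case_nonsplit Ha Hb (dd _ _ Ha Hc) aE bE acE.
- right; exact: cube_case_nonsplit Ha (dd _ _ Ha Hb) Hc aE abE cE.
- right; exact: cube_case_nonsplit Ha (dd _ _ Ha Hb) (dd _ _ Ha Hc) aE abE acE.
Qed.

End Cube.

Lemma twisted_equivalent :
  [\/ equivalent Gamma Gamma4, equivalent Gamma Gamma5 | equivalent Gamma Gamma6].
Proof.
have DP := quotient_factor_is_grading two_neq0 pP mG hh twist.
have [[f [a [fP fD]]]|[f [a [fP fD]]]] := cayley_type two_neq0 DP.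
  constructor 1; exact: cartan_case fP fD.
by have [H|H] := cube_case fP fD; [constructor 2|constructor 3].
Qed.

End TwistedCases.


(** * Separating the six grading groups *)

Lemma int_pair_torsion (x : int * int) : x + x = 0 -> x = 0.
Proof. by case: x => a b [Ha Hb]; congr (_, _); lia. Qed.

Lemma I6_ind (P : 'I_6 -> Prop) :
  P (@Ordinal 6 0 isT) -> P (@Ordinal 6 1 isT) -> P (@Ordinal 6 2 isT) ->
  P (@Ordinal 6 3 isT) -> P (@Ordinal 6 4 isT) -> P (@Ordinal 6 5 isT) -> forall k, P k.
Proof.
move=> P0 P1 P2 P3 P4 P5 [[|[|[|[|[|[|//]]]]]] k6];
  [move: P0|move: P1|move: P2|move: P3|move: P4|move: P5]; congr P; exact: val_inj.
Qed.

Section Invariants.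
Local Notation cube := ('Z_2 * 'Z_2 * 'Z_2)%type.

Definition grading_group (k : 'I_6) : zmodType :=
  match val k with
  | 0 => ((int * int) * (int * int))%type
  | 1 => ((int * int) * cube)%type
  | 2 => (cube * cube)%type
  | 3 => ('Z_2 * (int * int))%type
  | 4 => ('Z_2 * cube)%type
  | _ => ('Z_4 * 'Z_2 * 'Z_2)%type
  end%N.

Lemma double_table k : has_double (grading_group k) <-> val k \notin [:: 2; 4]%N.
Proof.
move: k; apply: I6_ind; split=> //.
- by exists ((1, 0), (0, 0)).
- by exists ((1, 0), 0).
- by move=> [x /eqP[]]; case: x => x y; congr (_, _); apply: z2cube_double.
- by exists (0, (1, 0)).
- move=> [x /eqP[]]; case: x => x y.
  by congr (_, _); [move: x; apply: Z2_ind; apply: val_inj|apply: z2cube_double].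
- by exists (1, 0, 0).
Qed.

Lemma quadruple_table k : has_quadruple (grading_group k) <-> val k \in [:: 0; 1; 3]%N.
Proof.
move: k; apply: I6_ind; split=> //.
- by exists ((1, 0), (0, 0)).
- by exists ((1, 0), 0).
- move=> [x /eqP[]]; rewrite (mulrnA x 2 2) (_ : x *+ 2 = 0) ?mul0rn //.
  by case: x => x y; congr (_, _); apply: z2cube_double.
- by exists (0, (1, 0)).
- move=> [x /eqP[]]; rewrite (mulrnA x 2 2) (_ : x *+ 2 = 0) ?mul0rn //.
  by case: x => x y; congr (_, _); [move: x; apply: Z2_ind; apply: val_inj|apply: z2cube_double].
- move=> [[[k m] n] /eqP[]]; congr (_, _, _); [move: k|move: m|move: n];
  by [apply: Z4_ind; apply: val_inj|apply: Z2_ind; apply: val_inj].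
Qed.

Lemma involution_table k : has_involution (grading_group k) <-> val k != 0%N.
Proof.
move: k; apply: I6_ind; split=> //.
- move=> [[x y] [+ xy]]; have /int_pair_torsion -> : x + x = 0 := congr1 fst xy.
  by have /int_pair_torsion -> : y + y = 0 := congr1 snd xy; rewrite eqxx.
- by exists (0, (1, 0, 0)); split=> //; congr (_, _); apply: z2cube_double.
- by exists (0, (1, 0, 0)); split=> //; congr (_, _); apply: z2cube_double.
- by exists (1, 0); split=> //; congr (_, _); apply: val_inj.
- by exists (0, (1, 0, 0)); split=> //; congr (_, _); [apply: val_inj|apply: z2cube_double].
- by exists (2, 0, 0); split=> //; congr (_, _, _); apply: val_inj.
Qed.

Lemma two_involutions_table k : val k \in [:: 1; 3]%N ->
  has_two_involutions (grading_group k) <-> val k = 1%N.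
Proof.
move: k; apply: I6_ind; rewrite ?inE //= => _; split=> //.
  exists (0, (1, 0, 0)), (0, (0, 1, 0)).
  by split=> //; congr (_, _); apply: z2cube_double.
move=> [[k x] [[l y] [+ + + kx ly]]].
have /int_pair_torsion -> : x + x = 0 := congr1 snd kx.
have /int_pair_torsion -> : y + y = 0 := congr1 snd ly.
by move: k l {kx ly}; do 2!apply: Z2_ind.
Qed.

Lemma small_table k : val k \in [:: 2; 4]%N -> small (grading_group k) <-> val k = 4%N.
Proof.
move: k; apply: I6_ind; rewrite ?inE //= => _; split=> //.
  move=> [r r16 rP]; have /subset_leq_card : predT \subset (r : seq (cube * cube)) by apply/subsetP => x _; apply: rP.
  by move=> /leq_trans/(_ (leq_trans (card_size _) r16)); rewrite !card_prod !card_ord.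
exists (enum [set: 'Z_2 * cube]); last by move=> x; rewrite mem_enum inE.
by rewrite -cardE cardsT !card_prod !card_ord.
Qed.

(** Only the groups of gradings 3 and 5 have no nonzero doubles, and their sizes differ. Among the
    others, only that of 6 has no nonzero quadruples, only that of 1 has no involution, and that of
    2 has several involutions while that of 4 has one. *)
Lemma grading_group_inj j k : isomorphic_groups (grading_group j) (grading_group k) -> j = k.
Proof.
move=> /isomorphic_transfer[Hd Hq Hi Ht Hs].
have {Hd} := iff_trans (iff_sym (double_table j)) (iff_trans Hd (double_table k)).
have {Hq} := iff_trans (iff_sym (quadruple_table j)) (iff_trans Hq (quadruple_table k)).
have {Hi} := iff_trans (iff_sym (involution_table j)) (iff_trans Hi (involution_table k)).
have {Ht} Ht jP kP := iff_trans (iff_sym (@two_involutions_table j jP))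
  (iff_trans Ht (@two_involutions_table k kP)).
have {Hs} Hs jP kP := iff_trans (iff_sym (@small_table j jP))
  (iff_trans Hs (@small_table k kP)).
move: j k Ht Hs; do 2!apply: I6_ind; rewrite /= ?inE /= => Ht Hs [i1 i2] [q1 q2] [d1 d2];
  by [|have := i1 isT|have := i2 isT|have := q1 isT|have := q2 isT|have := d1 isT|have := d2 isT
     |have [] := Ht isT isT; lia|have [] := Hs isT isT; lia].
Qed.

End Invariants.

Theorem proposition3p20 (F : closedFieldType) (char_not2 : 2%N \notin [pchar F])
    (i : F) (i_sqr : i ^+ 2 = -1) :
  exists (Gamma4 : 'Z_2 * (int * int) -> {vspace cayley2 F})
         (Gamma5 : 'Z_2 * ('Z_2 * 'Z_2 * 'Z_2) -> {vspace cayley2 F})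
         (Gamma6 : 'Z_4 * 'Z_2 * 'Z_2 -> {vspace cayley2 F}),
    let Gamma1C := @cartan_grading F in
    let Gamma2C := @z2cube_grading F in
    let L (k : 'I_6) : graded_family (cayley2 F) :=
      match val k with
      | 0 => GradedFamily (tensor_grading Gamma1C Gamma1C)
      | 1 => GradedFamily (tensor_grading Gamma1C Gamma2C)
      | 2 => GradedFamily (tensor_grading Gamma2C Gamma2C)
      | 3 => GradedFamily Gamma4
      | 4 => GradedFamily Gamma5
      | _ => GradedFamily Gamma6
      end%N in
    [/\ is_grading_generated_by (cayley2_mul F) (skew_sum F) (@components4 F) Gamma4,
        is_grading_generated_by (cayley2_mul F) (skew_sum F) (@components5 F) Gamma5
      & is_grading_generated_by (cayley2_mul F) (skew_sum F) (components6 i) Gamma6]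
    /\
    [/\ forall k, is_fine_grading (cayley2_mul F) (L k),
        forall k, graded_by_universal_group (cayley2_mul F) (L k),
        forall j k, equivalent_gradings (cayley2_mul F) (cayley2_mul F)
                      (L j) (L k) -> j = k
      & forall (G : zmodType) (Gamma : G -> {vspace cayley2 F}),
          is_fine_grading (cayley2_mul F) Gamma ->
          exists k, equivalent_gradings (cayley2_mul F) (cayley2_mul F)
                      Gamma (L k)]
    /\
    [/\ isomorphic_groups ((int * int) * (int * int))%type 'rV[int]_4
      & isomorphic_groups (('Z_2 * 'Z_2 * 'Z_2) * ('Z_2 * 'Z_2 * 'Z_2))%type
                          'rV['Z_2]_6].
Proof.
have two_neq0 : (2 : F) != 0 by apply: contra char_not2 => /eqP two0; rewrite inE /= two0.
have [Gamma4 gen4 tw4] := grading4_exists two_neq0.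
have [Gamma5 gen5 tw5] := grading5_exists two_neq0.
have [Gamma6 gen6 tw6] := grading6_exists two_neq0 i_sqr.
exists Gamma4, Gamma5, Gamma6 => Gamma1C Gamma2C L.
have cP := cartan_is_grading F; have zP := z2cube_is_grading two_neq0.
have cR := cartan_cayley_rigid two_neq0; have zR := cube_cayley_rigid two_neq0.
have cS := @cartan_spans F; have zS := @cube_spans F.
have surj2 : forall k : 'Z_2 * 'Z_2 * 'Z_2, exists d, @snd 'Z_2 _ d = k.
  by move=> k; exists (0, k).
have surj6 k : exists d, bar6 d = k.
  by exists (lift6 k); exact: twist_lift (twist_data_Z4 i_sqr) k.
have LP k : [/\ is_grading (cayley2_mul F) (L k), rigid (cayley2_mul F) (L k) &
    support_generates (L k)].
  move: k; apply: I6_ind; split; rewrite /L /=.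
  - exact: tensor_is_grading.
  - exact: tensor_rigid.
  - exact: support_spans_generates (tensor_spans cP cP cS cS).
  - exact: tensor_is_grading.
  - exact: tensor_rigid.
  - exact: support_spans_generates (tensor_spans cP zP cS zS).
  - exact: tensor_is_grading.
  - exact: tensor_rigid.
  - exact: support_spans_generates (tensor_spans zP zP zS zS).
  - exact: tw4.1.
  - exact: twisted_cartan_rigid tw4.
  - exact: support_spans_generates (twisted_cartan_spans two_neq0 tw4).
  - exact: tw5.1.
  - by have := twisted_cube_rigid two_neq0 surj2 (twist_chiD (twist_data_Z2 F _)) tw5.
  - exact: support_spans_generates (twisted_cube_spans two_neq0 surj2 tw5).
  - exact: tw6.1.
  - by have := twisted_cube_rigid two_neq0 surj6 (twist_chiD (twist_data_Z4 i_sqr)) tw6.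
  - exact: support_spans_generates (twisted_cube_spans two_neq0 surj6 tw6).
split; [by split|split; last by split; [exact: pairings_isomorphic|exact: cubes_isomorphic]].
split=> [k|k|j k jk|G Gamma fine].
- by have [gk rk _] := LP k; apply: rigid_fine.
- by have [gk rk sk] := LP k; apply: rigid_universal.
- apply: grading_group_inj; have [gj rj sj] := LP j; have [gk rk sk] := LP k.
  have := equivalent_rigid_iso gj gk rj rk sj sk jk.
  by move: j k {jk gj rj sj gk rk sk}; do 2!apply: I6_ind.
have [[s [p pP]] mG] := (is_gradingP _ _).1 fine.1.
have [split|[h [h0 hh twist]]] := split_or_twisted two_neq0 pP mG.
  have [H|H|H] := split_equivalent two_neq0 fine.1 split fine.
  - by exists (@Ordinal 6 0 isT).
  - by exists (@Ordinal 6 1 isT).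
  - by exists (@Ordinal 6 2 isT).
have [H|H|H] := twisted_equivalent two_neq0 i_sqr tw4 tw5 tw6 fine h0 hh twist pP mG.
- by exists (@Ordinal 6 3 isT).
- by exists (@Ordinal 6 4 isT).
- by exists (@Ordinal 6 5 isT).
Qed.
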